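(* Let $M$ be a smooth manifold of dimension $4n+3$ equipped with an $Sp(n)Sp(1)$ structure (with local 1-forms $\eta_s$, local fundamental 2-forms $\omega_s$, $s=1,2,3$, and horizontal metric $g_H$) such that, for some constant $\tau$, the structure equations $$d\eta_i=2\omega_i+2\tau\,\eta_j\wedge\eta_k$$ hold for any cyclic permutation $(i,j,k)$ of $(1,2,3)$. Then for any constant $a$ the manifold $M\times\mathbb R$ (with $u$ the coordinate on $\mathbb R$, restricted to the range $u>0$, $\tau u+au^2>0$) has a quaternionic K\''ahler structure given by the following metric and fundamental 4-form: $$g=u\,g_H+(\tau u+au^2)(\eta_1^2+\eta_2^2+\eta_3^2)+\frac{1}{4(\tau u+au^2)}(du)^2,\qquad \Phi=F_1\wedge F_1+F_2\wedge F_2+F_3\wedge F_3,$$ where locally, for any cyclic permutation $(i,j,k)$ of $(1,2,3)$, $$F_i(u)=u\,\omega_i+(au^2+\tau u)\,\eta_j\wedge\eta_k-\tfrac12\,\eta_i\wedge du.$$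
   Context: $Sp(n)Sp(1)$ structure on a $(4n+3)$-dimensional Riemannian manifold $M$ ($n\ge1$): a codimension three distribution $H$ which is locally the kernel of an $\mathbb R^3$-valued 1-form $\eta=(\eta_1,\eta_2,\eta_3)$, together with the metric $g_H$ on $H$ and a rank-three bundle $\mathbb Q\subset\mathrm{End}(H)$ locally generated by almost complex structures $I_1,I_2,I_3$ with $I_1I_2=-I_2I_1=I_3$, $I_1I_2I_3=-\mathrm{id}_H$, $g_H(I_s\cdot,I_s\cdot)=g_H$. The $\eta_s$ are orthonormal on the orthogonal complement $V$ of $H$ and, together with $I_s$, are determined locally up to simultaneous $SO(3)$ rotations. The local fundamental 2-forms are $\omega_s(X,Y)=g_H(I_sX,Y)$ on $H$, extended by zero on $V$; $g_H$ is likewise extended by zero on $V$. A quaternionic K\''ahler structure on a $(4n+4)$-manifold, $n\ge1$, is an almost quaternion hermitian structure $(g,J_1,J_2,J_3)$ (locally defined $J_s$ satisfying the quaternion identities, spanning a globally defined rank-three bundle, compatible with the Riemannian metric $g$) such that the holonomy of the Levi-Civita connection of $g$ is contained in $Sp(n+1)Sp(1)$ (hyper-K\''ahler allowed), the structure group being that of this almost quaternion hermitian structure; its local K\''ahler forms are $F_s=g(J_s\cdot,\cdot)$, and equivalently the fundamental 4-form $\Phi=\sum_sF_s\wedge F_s$ is parallel for the Levi-Civita connection. *)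

(* Defs.v *)
From HB Require Import structures.
From mathcomp Require Import all_boot all_order all_algebra.
From mathcomp Require Import all_classical all_reals all_analysis.
Import Order.TTheory GRing.Theory Num.Theory.
Import numFieldNormedType.Exports.
Set Implicit Arguments.
Unset Strict Implicit.
Unset Printing Implicit Defensive.
Local Open Scope classical_set_scope.
Local Open Scope ring_scope.

(* Conventions.  A tangent vector is represented in a chart by a row vector   *)
(* [v]; a covector by a column [al], with value [v *m al]; a bilinear form by *)
(* a square matrix [B], with value [v *m B *m w^T]; an endomorphism by a      *)
(* square matrix [E], mapping [v] to [v *m E].  A tensor field on a manifold  *)
(* is the family of its component functions in all charts.  The indices       *)
(* 1, 2, 3 are the elements 0, 1, 2 of ['I_3]; with the addition of ['I_3]    *)
(* the cyclic permutations of (1,2,3) are the triples (s, s + 1, s + 2).      *)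

Fixpoint Ck (R : realType) (V W : normedModType R) (k : nat) (U : set V)
    (f : V -> W) : Prop :=
  if k is k'.+1 then
    (forall x, U x -> differentiable f x) /\
    (forall v, Ck k' U (fun x => 'D_v f x))
  else forall x, U x -> {for x, continuous f}.

(* meaningful for open [U] only *)
Definition smooth (R : realType) (V W : normedModType R) (U : set V)
  (f : V -> W) : Prop := forall k, Ck k U f.

Section PointwiseAlgebra.
Context (R : realType) (d : nat).
Implicit Types (v w x y : 'rV[R]_d) (E : 'M[R]_d) (G A B : 'M[R]_d).
Implicit Types (al be : 'cV[R]_d).

Definition bilin B v w : R := (v *m B *m w^T) 0 0.

(* E o E', in this order *)
Definition ecomp E E' : 'M[R]_d := E' *m E.

Definition wedge11 al be : 'M[R]_d := al *m be^T - be *m al^T.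

Definition sqcov al : 'M[R]_d := al *m al^T.

(* sum over the (2,2)-shuffles *)
Definition wedge22 A B v w x y : R :=
  bilin A v w * bilin B x y - bilin A v x * bilin B w y
  + bilin A v y * bilin B w x + bilin A w x * bilin B v y
  - bilin A w y * bilin B v x + bilin A x y * bilin B v w.

(* the form g(J ., .) *)
Definition kahler_form G J : 'M[R]_d := J *m G.

Definition fundamental4 (F : 'I_3 -> 'M[R]_d) v w x y : R :=
  \sum_s wedge22 (F s) (F s) v w x y.

Definition quaternion_identities (J : 'I_3 -> 'M[R]_d) : Prop :=
  [/\ forall s, ecomp (J s) (J s) = - 1%:M,
      ecomp (J 0) (J 1) = J 2%:R,
      ecomp (J 1) (J 0) = - J 2%:R &
      ecomp (J 0) (ecomp (J 1) (J 2%:R)) = - 1%:M].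

Definition quaternionic_basis G (Q : set 'M[R]_d) (J : 'I_3 -> 'M[R]_d) :
    Prop :=
  [/\ quaternion_identities J,
      forall s v w, bilin G (v *m J s) (w *m J s) = bilin G v w &
      Q = [set E | exists c : 'I_3 -> R, E = \sum_s c s *: J s]].

(* The group Sp(m)Sp(1) of a quaternion hermitian vector space of dimension   *)
(* d = 4m: the products of a linear isometry commuting with Q and of a unit   *)
(* quaternion c0 + c1 J1 + c2 J2 + c3 J3.                                     *)
Definition SpSp1 G (Q : set 'M[R]_d) : set 'M[R]_d :=
  [set P | exists (J : 'I_3 -> 'M[R]_d) B (c0 : R) (c : 'I_3 -> R),
    [/\ quaternionic_basis G Q J,
        forall v w, bilin G (v *m B) (w *m B) = bilin G v w,
        forall s, ecomp B (J s) = ecomp (J s) B,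
        c0 ^+ 2 + \sum_s c s ^+ 2 = 1 &
        P = ecomp B (c0%:M + \sum_s c s *: J s)]].

(* exterior derivative: d al(X,Y) = X al(Y) - Y al(X) - al([X,Y]) *)
Definition dext (al : 'rV[R]_d -> 'cV[R]_d) x : 'M[R]_d :=
  \matrix_(p, q) ('D_('e_p) (fun y => al y q 0) x
                  - 'D_('e_q) (fun y => al y p 0) x).

(* The Levi-Civita connection in coordinates, nabla_v w for constant v, w:    *)
(* 2 g(nabla_v w, z) = v g(w,z) + w g(v,z) - z g(v,w).                        *)
Definition christoffel (G : 'rV[R]_d -> 'M[R]_d) x v w : 'rV[R]_d :=
  (\row_l (2^-1 * ('D_v (fun y => bilin (G y) w 'e_l) x
                   + 'D_w (fun y => bilin (G y) v 'e_l) x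
                   - 'D_('e_l) (fun y => bilin (G y) v w) x)))
  *m invmx (G x).

End PointwiseAlgebra.

(* The charts of a manifold carried by a subset of [T]; [param i] is the      *)
(* inverse of the restriction of [coord i] to [dom i].                        *)
Record atlas (R : realType) (T : topologicalType) (d : nat) := Atlas {
  chart : Type;
  dom : chart -> set T;
  coord : chart -> T -> 'rV[R]_d;
  param : chart -> 'rV[R]_d -> T }.

Section Manifold.
Context (R : realType) (T : topologicalType) (d : nat) (A : atlas R T d).
Implicit Types (i j : chart A) (p q : T) (U : set T).

Definition carrier : set T := [set p | exists i, dom i p].

(* The manifold is the subset [carrier], open as a union of chart domains.    *)
Definition smooth_manifold : Prop :=
  [/\ hausdorff_space T, @second_countable T,
      forall i,
        [/\ open (dom i), open (coord i @` dom i),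
            forall p, dom i p -> param i (coord i p) = p,
            forall p, dom i p -> {for p, continuous (coord i)} &
            forall x, (coord i @` dom i) x -> {for x, continuous (param i)}] &
      forall i j, smooth (coord i @` (dom i `&` dom j))
                         (coord j \o param i)].

(* v *m jac i j p are the components in chart j at p of the tangent vector    *)
(* with components v in chart i                                               *)
Definition jac i j p : 'M[R]_d := 'J (coord j \o param i) (coord i p).

Definition field (V : Type) := chart A -> 'rV[R]_d -> V.

Definition at_pt (V : Type) (X : field V) i p : V := X i (coord i p).

Definition smooth_field (V : normedModType R) U (X : field V) : Prop :=
  forall i, smooth (coord i @` (dom i `&` U)) (X i).

Definition one_form U (al : field 'cV[R]_d) : Prop :=
  smooth_field U al /\
  forall i j p, U p -> dom i p -> dom j p ->
    at_pt al i p = jac i j p *m at_pt al j p.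

Definition bilinear_field U (B : field 'M[R]_d) : Prop :=
  smooth_field U B /\
  forall i j p, U p -> dom i p -> dom j p ->
    at_pt B i p = jac i j p *m at_pt B j p *m (jac i j p)^T.

Definition endo_field U (E : field 'M[R]_d) : Prop :=
  smooth_field U E /\
  forall i j p, U p -> dom i p -> dom j p ->
    at_pt E i p *m jac i j p = jac i j p *m at_pt E j p.

Definition riemannian_metric (g : field 'M[R]_d) : Prop :=
  bilinear_field carrier g /\
  forall i p, dom i p ->
    (at_pt g i p)^T = at_pt g i p /\
    (forall v, v != 0 -> 0 < bilin (at_pt g i p) v v).

(* a local frame (eta_s, I_s) on [fr_dom]; I_s is an endomorphism of H        *)
(* extended by zero on V                                                      *)
Record local_frame := LocalFrame {
  fr_dom : set T;
  fr_eta : 'I_3 -> field 'cV[R]_d;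
  fr_I : 'I_3 -> field 'M[R]_d }.

Record spn_data := SpnData {
  sp_g : field 'M[R]_d;          (* Riemannian metric *)
  sp_H : field (set 'rV[R]_d);   (* the distribution H *)
  sp_gH : field 'M[R]_d;         (* g on H, extended by zero on V *)
  sp_Q : field (set 'M[R]_d);    (* Q in End(H), extended by zero on V *)
  sp_frames : set local_frame }. (* all local frames of the structure *)

Definition sp_V (S : spn_data) : field (set 'rV[R]_d) := fun i x =>
  [set v | forall w, sp_H S i x w -> bilin (sp_g S i x) v w = 0].

(* The components of H and Q in different charts correspond to each other     *)
(* because those of the frames do.                                            *)
Definition adapted_frame (S : spn_data) (f : local_frame) : Prop :=
  [/\ open (fr_dom f),
      forall s, one_form (fr_dom f) (fr_eta f s),
      forall s, endo_field (fr_dom f) (fr_I f s) &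
      forall i p, fr_dom f p -> dom i p ->
        let g := at_pt (sp_g S) i p in
        let H := at_pt (sp_H S) i p in
        let V := at_pt (sp_V S) i p in
        let eta s := at_pt (fr_eta f s) i p in
        let I s := at_pt (fr_I f s) i p in
        [/\ H = [set v | forall s, v *m eta s = 0],
            (exists xi : 'I_3 -> 'rV[R]_d,
               forall s, V (xi s) /\
                 forall t, bilin g (xi s) (xi t) = (s == t)%:R /\
                           xi s *m eta t = (s == t)%:R%:M),
            forall s,
              (forall v, V v -> v *m I s = 0) /\
              (forall v, H v -> H (v *m I s)),
            forall v, H v ->
              [/\ forall s, v *m ecomp (I s) (I s) = - v,
                  v *m ecomp (I 0) (I 1) = v *m I 2%:R,
                  v *m ecomp (I 1) (I 0) = - (v *m I 2%:R),
                  v *m ecomp (I 0) (ecomp (I 1) (I 2%:R)) = - v &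
                  forall s w, H w ->
                    bilin g (v *m I s) (w *m I s) = bilin g v w] &
            at_pt (sp_Q S) i p =
              [set E | exists c : 'I_3 -> R, E = \sum_s c s *: I s]]].

Definition so3_related (f f' : local_frame) : Prop :=
  forall p, fr_dom f p -> fr_dom f' p ->
  exists r : 'M[R]_3,
    [/\ r *m r^T = 1%:M, \det r = 1 &
        forall i s, dom i p ->
          at_pt (fr_eta f' s) i p
            = \sum_t r s t *: at_pt (fr_eta f t) i p /\
          at_pt (fr_I f' s) i p
            = \sum_t r s t *: at_pt (fr_I f t) i p].

(* The last condition says that the frames of the structure are determined    *)
(* exactly up to simultaneous rotations (so the family is maximal).           *)
Definition spn_structure (S : spn_data) : Prop :=
  [/\ riemannian_metric (sp_g S),
      bilinear_field carrier (sp_gH S),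
      forall i p, dom i p ->
        (forall v w, at_pt (sp_H S) i p v -> at_pt (sp_H S) i p w ->
           bilin (at_pt (sp_gH S) i p) v w = bilin (at_pt (sp_g S) i p) v w) /\
        (forall v w, at_pt (sp_V S) i p v ->
           bilin (at_pt (sp_gH S) i p) v w = 0 /\
           bilin (at_pt (sp_gH S) i p) w v = 0),
      forall p, carrier p -> exists2 f, sp_frames S f & fr_dom f p &
      forall f, sp_frames S f <->
        adapted_frame S f /\
        (forall f', sp_frames S f' -> so3_related f' f)].

Definition sp_omega (S : spn_data) (f : local_frame) (s : 'I_3) :
    field 'M[R]_d :=
  fun i x => kahler_form (sp_gH S i x) (fr_I f s i x).

(* d eta_i = 2 omega_i + 2 tau eta_j /\ eta_k *)
Definition structure_equations (S : spn_data) (tau : R) (f : local_frame) :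
    Prop :=
  forall s i p, fr_dom f p -> dom i p ->
    dext (fr_eta f s i) (coord i p) =
      2 *: at_pt (sp_omega S f s) i p
      + (2 * tau) *: wedge11 (at_pt (fr_eta f (s + 1)) i p)
                             (at_pt (fr_eta f (s + 2%:R)) i p).

Definition quaternionic_frame (g : field 'M[R]_d) (Q : field (set 'M[R]_d)) U
    (J : 'I_3 -> field 'M[R]_d) : Prop :=
  [/\ open U, forall s, endo_field U (J s) &
      forall i p, U p -> dom i p ->
        quaternionic_basis (at_pt g i p) (at_pt Q i p)
                           (fun s => at_pt (J s) i p)].

Definition almost_quaternion_hermitian (g : field 'M[R]_d)
    (Q : field (set 'M[R]_d)) : Prop :=
  riemannian_metric g /\
  forall p, carrier p -> exists U J, U p /\ quaternionic_frame g Q U J.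

(* The curve is parametrized by [0,1] and smooth up to the end points, that   *)
(* is, on a neighborhood of [0,1].                                            *)
Definition smooth_curve (c : R -> T) : Prop :=
  forall t, 0 <= t <= 1 -> exists i (W : set R),
    [/\ open W, W t, forall s, W s -> dom i (c s) & smooth W (coord i \o c)].

(* [X i t] are the components in chart i of a vector at [c t] *)
Definition parallel_along (g : field 'M[R]_d) (c : R -> T)
    (X : chart A -> R -> 'rV[R]_d) : Prop :=
  forall t, 0 <= t <= 1 ->
    (forall i j, dom i (c t) -> dom j (c t) ->
       X j t = X i t *m jac i j (c t)) /\
    (forall i, dom i (c t) ->
       is_derive t 1 (X i)
         (- christoffel (g i) (coord i (c t)) ('D_1 (coord i \o c) t) (X i t))).

(* [parallel_transport g i p j q P]: P is the matrix, in the charts i at p    *)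
(* and j at q, of the parallel transport from p to q along some piecewise     *)
(* smooth curve, i.e. along a finite concatenation of smooth curves.          *)
Inductive parallel_transport (g : field 'M[R]_d) :
    chart A -> T -> chart A -> T -> 'M[R]_d -> Prop :=
| Transport_smooth (c : R -> T) i j P :
    smooth_curve c -> dom i (c 0) -> dom j (c 1) ->
    (forall v, exists X,
       [/\ parallel_along g c X, X i 0 = v & X j 1 = v *m P]) ->
    parallel_transport g i (c 0) j (c 1) P
| Transport_concat i p j q k r P P' :
    parallel_transport g i p j q P -> parallel_transport g j q k r P' ->
    parallel_transport g i p k r (ecomp P' P).

(* the holonomy group of the Levi-Civita connection at p, in chart i *)
Definition holonomy (g : field 'M[R]_d) i p : set 'M[R]_d :=
  [set P | parallel_transport g i p i p P].

Definition quaternionic_kahler (g : field 'M[R]_d)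
    (Q : field (set 'M[R]_d)) : Prop :=
  almost_quaternion_hermitian g Q /\
  forall i p, dom i p ->
    holonomy g i p `<=` SpSp1 (at_pt g i p) (at_pt Q i p).

Definition four_tensor :=
  'rV[R]_d -> 'rV[R]_d -> 'rV[R]_d -> 'rV[R]_d -> R.

Definition fundamental_4form (g : field 'M[R]_d) (Q : field (set 'M[R]_d))
    (Phi : field four_tensor) : Prop :=
  forall U J, quaternionic_frame g Q U J ->
  forall i p, U p -> dom i p ->
    at_pt Phi i p
      = fundamental4 (fun s => kahler_form (at_pt g i p) (at_pt (J s) i p)).

End Manifold.

Section Cylinder.
Context (R : realType) (M : topologicalType) (d : nat) (A : atlas R M d).

(* the coordinate u comes first *)
Definition cylinder (Om : set R) : atlas R (M * R)%type (1 + d) :=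
  @Atlas R (M * R)%type (1 + d) (chart A)
    (fun i => [set q | dom i q.1 /\ Om q.2])
    (fun i q => row_mx q.2%:M (coord i q.1))
    (fun i y => (param i (rsubmx y), lsubmx y 0 0)).

Definition du : 'cV[R]_(1 + d) := col_mx 1%:M 0.
Definition lift1 (al : 'cV[R]_d) : 'cV[R]_(1 + d) := col_mx 0 al.
Definition lift2 (B : 'M[R]_d) : 'M[R]_(1 + d) := block_mx 0 0 0 B.

Context (S : spn_data A) (tau a : R) (f : local_frame A).

Definition qk_metric (i : chart A) (p : M) (u : R) : 'M[R]_(1 + d) :=
  u *: lift2 (at_pt (sp_gH S) i p)
  + (tau * u + a * u ^+ 2)
      *: \sum_(s < 3) sqcov (lift1 (at_pt (fr_eta f s) i p))
  + (4 * (tau * u + a * u ^+ 2))^-1 *: sqcov du.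

Definition qk_F (s : 'I_3) (i : chart A) (p : M) (u : R) : 'M[R]_(1 + d) :=
  let eta t := lift1 (at_pt (fr_eta f t) i p) in
  u *: lift2 (at_pt (sp_omega S f s) i p)
  + (a * u ^+ 2 + tau * u) *: wedge11 (eta (s + 1)) (eta (s + 2%:R))
  - 2^-1 *: wedge11 (eta s) du.

End Cylinder.

(* Main.v *)
Require Import Defs.
From HB Require Import structures.
From mathcomp Require Import all_boot all_order all_algebra.
From mathcomp Require Import all_classical all_reals all_analysis.
From mathcomp Require Import ring lra.
Import Order.TTheory GRing.Theory Num.Theory.
Import numFieldNormedType.Exports.
Set Implicit Arguments.
Unset Strict Implicit.
Unset Printing Implicit Defensive.
Local Open Scope classical_set_scope.
Local Open Scope ring_scope.
Local Notation coord := Defs.coord.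

(** Why the theorem is true.

    Put [f = tau u + a u^2] and rescale the contact forms to
    [b_s = u eta_s].  The structure equations turn the definition of the
    two-forms [F_s] into
      [F_i = d b_i / 2 + a b_j /\ b_k],
    that is, up to constants [F] is the curvature of an SO(3)-connection with
    potentials [b] ([cone_curvature]); [tau] has disappeared.  The exterior
    derivative of this equation is the Bianchi identity
      [dF_i = 2 a (b_k /\ F_j - b_j /\ F_k)]
    ([bianchi]), which rests on the symmetry of second derivatives
    ([derive_comm]).

    At each point the metric is an orthogonal sum of [u g_H], on which the
    quaternions act by the [I_s], and of a four-dimensional space with
    orthonormal coframe [du / (2 sqrt f), sqrt f eta_1, sqrt f eta_2,
    sqrt f eta_3], on which they act by left multiplication; hence the [F_s]
    are the Kaehler forms of an almost quaternion hermitian structure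
    ([cone_quaternionic]).

    Three non-degenerate forms compatible with one quaternionic structure are
    parallel as soon as they are closed ([closed_triple_parallel], the lemma
    of Hitchin on hyperkaehler structures).  This is an algebraic statement on
    trilinear maps, so it also applies to the covariant derivatives of the
    [F_s] after the contribution of the potentials [2 a b] has been
    subtracted; it yields
      [nabla F_i = 2 a (b_k F_j - b_j F_k)]
    ([nabla_kahler]) in every dimension, whereas closedness of the fundamental
    four-form alone would leave out dimension eight.

    So the covariant derivative rotates the triple of the [F_s], and the
    metric and the tensor [sum_s F_s (x) F_s] are constant along parallel
    fields ([parallel_metric], [parallel_four_square]).  An isometry that
    preserves this tensor normalizes the quaternions and acts on their
    imaginary part by a rotation.  A rotation is the conjugation by a unit
    quaternion ([unit_intertwiner]), and dividing by it leaves an isometry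
    that commutes with the quaternions: the holonomy lies in Sp(n+1)Sp(1)
    ([invariant_SpSp1], [holonomy_SpSp1]).

    The frames are only local.  Two of them differ by a rotation [r], and the
    [F_s] are transformed by the same [r] because a rotation is its own matrix
    of cofactors ([coneF_rotation]); therefore the bundle of quaternions and
    the fundamental four-form are global. *)

(** * Smooth functions *)

Section DifferentiableExtra.
Context {R : realType} {V W : normedModType R}.
Implicit Types (f g : V -> W) (U : set V).

(** The linear map that approximates [f] to first order at [x] also
    approximates every function with the same germ. *)
Lemma near_eq_differentiable f g x :
  {near x, f =1 g} -> differentiable f x -> differentiable g x.
Proof.
move=> fg df; have fgx := nbhs_singleton fg.
have cdf := diff_continuous df.
have gE : g \o shift x = cst (g x) + 'd f x +o_ 0 id.
  apply/eqaddoP => _/posnumP[e]; near=> h.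
  rewrite -![(_ + _ : _ -> _) _]/(_ + _) -![(- _ : _ -> _) _]/(- _) /cst /=.
  have <- : f (h + x) = g (h + x).
    by near: h; move: fg; rewrite (near_shift 0) /= subr0.
  rewrite -fgx; near: h.
  by have /eqaddoP/(_ e%:num)/(_ [gt0 of e%:num]) := diff_locally df.
by apply/diff_locallyP; rewrite (diff_unique cdf gE); split.
Unshelve. all: by end_near. Qed.

Lemma open_near_eq U f g : open U -> {in U, f =1 g} ->
  forall x, U x -> {near x, f =1 g}.
Proof.
move=> oU fg x Ux; near=> y; apply: fg; rewrite inE.
by near: y; exact: open_nbhs_nbhs.
Unshelve. all: by end_near. Qed.

End DifferentiableExtra.

Section CkTheory.
Context {R : realType}.
Implicit Types V W : normedModType R.

(** On an open set, functions that agree have the same germs, and all the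
    iterated derivatives depend only on the germ.  Most closure properties
    below replace a derivative by the expression that a rule of calculus gives
    on [U], where that rule holds. *)
Lemma eq_Ck V W k (U : set V) (f g : V -> W) :
  open U -> {in U, f =1 g} -> Ck k U f -> Ck k U g.
Proof.
move=> oU; elim: k f g => [|k IHk] f g fg /=.
  move=> fc x Ux; have := fc x Ux; rewrite /prop_for /continuous_at.
  rewrite -(fg x) ?inE//; apply: cvg_trans; apply: near_eq_cvg.
  exact: open_near_eq oU fg x Ux.
move=> [df Df]; split=> [x Ux|v].
  exact: near_eq_differentiable (open_near_eq oU fg Ux) (df x Ux).
apply: IHk (Df v) => x; rewrite inE => Ux.
exact: near_eq_derive (open_near_eq oU fg Ux).
Qed.

Lemma CkW V W k (U : set V) (f : V -> W) : Ck k.+1 U f -> Ck k U f.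
Proof.
elim: k f => [|k IHk] f /= [df Df].
  by move=> x Ux; apply: differentiable_continuous; exact: df.
by split=> // v; apply: IHk; exact: Df.
Qed.

Lemma sub_Ck V W k (U U' : set V) (f : V -> W) :
  U' `<=` U -> Ck k U f -> Ck k U' f.
Proof.
move=> sU; elim: k f => [|k IHk] f /=.
  by move=> fc x /sU; exact: fc.
by move=> [df Df]; split=> [x /sU|v]; [exact: df|exact: IHk].
Qed.

Lemma Ck_cst V W k (U : set V) (c : W) : Ck k U (fun _ => c).
Proof.
elim: k c => [|k IHk] c /=; first by move=> x _; exact: cvg_cst.
split=> [x _|v]; first exact: differentiable_cst.
have -> : (fun x => 'D_v (fun=> c) x) = (fun=> 0).
  by apply/funext => x; exact: derive_cst.
exact: IHk.
Qed.

Lemma CkD V W k (U : set V) (f g : V -> W) :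
  open U -> Ck k U f -> Ck k U g -> Ck k U (fun x => f x + g x).
Proof.
move=> oU; elim: k f g => [|k IHk] f g /=.
  by move=> fc gc x Ux; apply: cvgD; [exact: fc|exact: gc].
move=> [df Df] [dg Dg]; split=> [x Ux|v].
  by apply: differentiableD; [exact: df|exact: dg].
apply: (@eq_Ck _ _ _ _ (fun x => 'D_v f x + 'D_v g x)) => //.
  move=> x; rewrite inE => Ux; rewrite deriveD //; apply: diff_derivable.
    exact: df.
  exact: dg.
exact: IHk.
Qed.

Lemma Ck_sum V W k (U : set V) (I : Type) (r : seq I) (P : pred I)
    (F : I -> V -> W) :
  open U -> (forall i, P i -> Ck k U (F i)) ->
  Ck k U (fun x => \sum_(i <- r | P i) F i x).
Proof.
move=> oU FC; elim: r => [|i r IHr].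
  apply: (eq_Ck oU _ (@Ck_cst _ _ k U 0)) => x _.
  by rewrite big_nil.
case Pi: (P i); last first.
  by apply: (eq_Ck oU _ IHr) => x _; rewrite big_cons Pi.
by apply: (eq_Ck oU _ (CkD oU (FC i Pi) IHr)) => x _; rewrite big_cons Pi.
Qed.

Lemma CkM V k (U : set V) (f g : V -> R) :
  open U -> Ck k U f -> Ck k U g -> Ck k U (fun x => f x * g x).
Proof.
move=> oU; elim: k f g => [|k IHk] f g.
  by move=> /= fc gc x Ux; apply: cvgM; [exact: fc|exact: gc].
move=> Cf Cg; have [Cf' Cg'] := (CkW Cf, CkW Cg).
case: Cf => [df Df]; case: Cg => [dg Dg]; split=> [x Ux|v].
  by apply: differentiableM; [exact: df|exact: dg].
apply: (@eq_Ck _ _ _ _ (fun x => f x * 'D_v g x + g x * 'D_v f x)) => //.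
  move=> x; rewrite inE => Ux; rewrite deriveM //; apply: diff_derivable.
    exact: df.
  exact: dg.
by apply: CkD => //; [exact: IHk Cf' (Dg v)|exact: IHk Cg' (Df v)].
Qed.

Lemma Ck_prod V k (U : set V) (I : Type) (r : seq I) (P : pred I)
    (F : I -> V -> R) :
  open U -> (forall i, P i -> Ck k U (F i)) ->
  Ck k U (fun x => \prod_(i <- r | P i) F i x).
Proof.
move=> oU FC; elim: r => [|i r IHr].
  by apply: (eq_Ck oU _ (@Ck_cst V R k U (1 : R))) => x _; rewrite big_nil.
case Pi: (P i); last first.
  by apply: (eq_Ck oU _ IHr) => x _; rewrite big_cons Pi.
by apply: (eq_Ck oU _ (CkM oU (FC i Pi) IHr)) => x _; rewrite big_cons Pi.
Qed.

Lemma CkV V k (U : set V) (f : V -> R) :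
  open U -> (forall x, U x -> f x != 0) -> Ck k U f ->
  Ck k U (fun x => (f x)^-1).
Proof.
move=> oU f0; elim: k => [|k IHk].
  by move=> /= fc x Ux; apply: cvgV; [exact: f0|exact: fc].
move=> Cf; have Cf' := IHk (CkW Cf).
case: Cf => [df Df]; split=> [x Ux|v].
  by apply: differentiableV; [exact: df|exact: f0].
apply: (@eq_Ck _ _ _ _ (fun x => (-1) * ((f x)^-1 * (f x)^-1) * 'D_v f x)) => //.
  move=> x; rewrite inE => Ux.
  rewrite deriveV ?f0//; last by apply: diff_derivable; exact: df.
  by rewrite -exprVn -expr2 mulN1r.
apply: CkM (Df v) => //; apply: CkM => //; first exact: Ck_cst.
exact: CkM.
Qed.

(** [D_v (f o L) = (D_(L v) f) o L] is again a function composed with [L],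
    which makes the induction on [k] work. *)
Lemma Ck_precomp V V' W k (U : set V) (U' : set V') (L : {linear V' -> V})
    (f : V -> W) :
  continuous L -> (forall x, U' x -> U (L x)) ->
  open U' -> Ck k U f -> Ck k U' (f \o L).
Proof.
move=> cL LU oU'; elim: k f => [|k IHk] f /=.
  move=> fc x U'x; apply: continuous_comp; first exact: cL.
  exact: fc (LU _ U'x).
move=> [df Df]; split=> [x U'x|v].
  apply: differentiable_comp; first exact: linear_differentiable.
  exact: df (LU _ U'x).
apply: (@eq_Ck _ _ _ _ (fun x => 'D_(L v) f (L x))) => //.
  move=> x; rewrite inE => U'x.
  have dfx := df _ (LU _ U'x).
  have dL : differentiable L x by exact: linear_differentiable.
  rewrite deriveE// deriveE; last exact: differentiable_comp.
  by rewrite (diff_comp dL dfx) /= (diff_lin x cL).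
exact: IHk (Df (L v)).
Qed.

Lemma Ck_postcomp V W W' k (U : set V) (L : {linear W -> W'}) (f : V -> W) :
  continuous L -> open U -> Ck k U f -> Ck k U (L \o f).
Proof.
move=> cL oU; elim: k f => [|k IHk] f /=.
  by move=> fc x Ux; apply: continuous_comp; [exact: fc|exact: cL].
move=> [df Df]; split=> [x Ux|v].
  by apply: differentiable_comp; [exact: df|exact: linear_differentiable].
apply: (@eq_Ck _ _ _ _ (fun x => L ('D_v f x))) => //; last exact: IHk.
move=> x; rewrite inE => Ux; have dfx := df _ Ux.
have dL : differentiable L (f x) by exact: linear_differentiable.
have -> : 'D_v (L \o f) x = ('d L (f x) \o 'd f x) v.
  by rewrite deriveE ?(diff_comp dfx dL)//; exact: differentiable_comp.
by rewrite /= (diff_lin (f x) cL) deriveE.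
Qed.

Lemma Ck_entry V k (U : set V) m n (f : V -> 'M[R]_(m, n)) i j :
  open U -> Ck k U f -> Ck k U (fun x => f x i j).
Proof.
move=> oU Cf.
have lin : linear (fun N : 'M[R]_(m, n) => N i j : R^o).
  by move=> a M N; rewrite !mxE.
pose L : {linear 'M[R]_(m, n) -> R} :=
  HB.pack (fun N : 'M[R]_(m, n) => N i j : R^o)
          (GRing.isLinear.Build _ _ _ _ _ lin).
apply: (@Ck_postcomp V 'M[R]_(m, n) R k U L f) => //.
exact: coord_continuous.
Qed.

Lemma Ck_mx V k (U : set V) m n (f : V -> 'M[R]_(m, n)) :
  open U -> (forall i j, Ck k U (fun x => f x i j)) -> Ck k U f.
Proof.
move=> oU Cf.
apply: (@eq_Ck _ _ _ _
  (fun x => \sum_i \sum_j f x i j *: (delta_mx i j : 'M[R]_(m, n)))) => //.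
  by move=> x _; rewrite -matrix_sum_delta.
apply: Ck_sum => // i _; apply: Ck_sum => // j _.
pose E : 'M[R]_(m, n) := delta_mx i j.
have lin : linear (fun r : R^o => r *: E).
  by move=> a r s; rewrite scalerDl scalerA.
pose L : {linear R -> 'M[R]_(m, n)} :=
  HB.pack (fun r : R^o => r *: E) (GRing.isLinear.Build _ _ _ _ _ lin).
have cE : continuous ( *:%R^~ E : R -> _) by exact: scalel_continuous.
exact: (@Ck_postcomp V R _ k U L _ cE oU (Cf i j)).
Qed.

End CkTheory.

Section SmoothTheory.
Context {R : realType}.
Implicit Types V W : normedModType R.

Lemma smooth_differentiable V W (U : set V) (f : V -> W) x :
  smooth U f -> U x -> differentiable f x.
Proof. by move=> sf; have [df _] := sf 1; exact: df. Qed.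

Lemma smooth_derivable V W (U : set V) (f : V -> W) x v :
  smooth U f -> U x -> derivable f x v.
Proof.
by move=> sf Ux; apply: diff_derivable; exact: smooth_differentiable sf Ux.
Qed.

Lemma smooth_derive V W (U : set V) (f : V -> W) v :
  smooth U f -> smooth U (fun x => 'D_v f x).
Proof. by move=> sf k; have [_ Df] := sf k.+1; exact: Df. Qed.

Lemma smooth_continuous V W (U : set V) (f : V -> W) x :
  smooth U f -> U x -> {for x, continuous f}.
Proof. by move=> sf; exact: (sf 0). Qed.

Lemma eq_smooth V W (U : set V) (f g : V -> W) :
  open U -> {in U, f =1 g} -> smooth U f -> smooth U g.
Proof. by move=> oU fg sf k; exact: eq_Ck (sf k). Qed.

Lemma sub_smooth V W (U U' : set V) (f : V -> W) :
  U' `<=` U -> smooth U f -> smooth U' f.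
Proof. by move=> sU sf k; exact: sub_Ck (sf k). Qed.

Lemma smooth_cst V W (U : set V) (c : W) : smooth U (fun _ => c).
Proof. by move=> k; exact: Ck_cst. Qed.

Lemma smoothD V W (U : set V) (f g : V -> W) :
  open U -> smooth U f -> smooth U g -> smooth U (fun x => f x + g x).
Proof. by move=> oU sf sg k; exact: CkD. Qed.

Lemma smooth_sum V W (U : set V) (I : Type) (r : seq I) (P : pred I)
    (F : I -> V -> W) :
  open U -> (forall i, P i -> smooth U (F i)) ->
  smooth U (fun x => \sum_(i <- r | P i) F i x).
Proof. by move=> oU sF k; apply: Ck_sum => // i Pi; exact: sF. Qed.

Lemma smoothM V (U : set V) (f g : V -> R) :
  open U -> smooth U f -> smooth U g -> smooth U (fun x => f x * g x).
Proof. by move=> oU sf sg k; exact: CkM. Qed.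

Lemma smooth_prod V (U : set V) (I : Type) (r : seq I) (P : pred I)
    (F : I -> V -> R) :
  open U -> (forall i, P i -> smooth U (F i)) ->
  smooth U (fun x => \prod_(i <- r | P i) F i x).
Proof. by move=> oU sF k; apply: Ck_prod => // i Pi; exact: sF. Qed.

Lemma smoothV V (U : set V) (f : V -> R) :
  open U -> (forall x, U x -> f x != 0) -> smooth U f ->
  smooth U (fun x => (f x)^-1).
Proof. by move=> oU f0 sf k; exact: CkV. Qed.

Lemma smooth_precomp V V' W (U : set V) (U' : set V') (L : {linear V' -> V})
    (f : V -> W) :
  continuous L -> (forall x, U' x -> U (L x)) ->
  open U' -> smooth U f -> smooth U' (f \o L).
Proof. by move=> cL LU oU' sf k; exact: Ck_precomp cL LU oU' (sf k). Qed.

Lemma smooth_id V (U : set V) : smooth U (id : V -> V).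
Proof.
case=> [|k]; first by move=> x _; exact: cvg_id.
split=> // v; rewrite (_ : (fun x : V => 'D_v id x) = fun=> v).
  exact: Ck_cst.
by apply/funext => x; exact: derive_id.
Qed.

Lemma smooth_entry V (U : set V) m n (f : V -> 'M[R]_(m, n)) i j :
  open U -> smooth U f -> smooth U (fun x => f x i j).
Proof. by move=> oU sf k; exact: Ck_entry. Qed.

Lemma smooth_mx V (U : set V) m n (f : V -> 'M[R]_(m, n)) :
  open U -> (forall i j, smooth U (fun x => f x i j)) -> smooth U f.
Proof. by move=> oU sf k; apply: Ck_mx => // i j; exact: sf. Qed.

Lemma smoothZ V (U : set V) m n (c : V -> R) (f : V -> 'M[R]_(m, n)) :
  open U -> smooth U c -> smooth U f -> smooth U (fun x => c x *: f x).
Proof.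
move=> oU sc sf; apply: smooth_mx => // i j.
apply: (@eq_smooth _ _ _ (fun x => c x * f x i j)) => //.
  by move=> x _; rewrite mxE.
by apply: smoothM => //; exact: smooth_entry.
Qed.

Lemma smooth_trmx V (U : set V) m n (f : V -> 'M[R]_(m, n)) :
  open U -> smooth U f -> smooth U (fun x => (f x)^T).
Proof.
move=> oU sf; apply: smooth_mx => // i j.
apply: (@eq_smooth _ _ _ (fun x => f x j i)) => //.
  by move=> x _; rewrite mxE.
exact: smooth_entry.
Qed.

Lemma smooth_mulmx V (U : set V) m n p (f : V -> 'M[R]_(m, n))
    (g : V -> 'M[R]_(n, p)) :
  open U -> smooth U f -> smooth U g -> smooth U (fun x => f x *m g x).
Proof.
move=> oU sf sg; apply: smooth_mx => // i j.
apply: (@eq_smooth _ _ _ (fun x => \sum_k f x i k * g x k j)) => //.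
  by move=> x _; rewrite mxE.
apply: smooth_sum => // k _; apply: smoothM => //; exact: smooth_entry.
Qed.

Lemma smooth_det V (U : set V) n (f : V -> 'M[R]_n) :
  open U -> smooth U f -> smooth U (fun x => \det (f x)).
Proof.
move=> oU sf; apply: smooth_sum => // s _; apply: smoothM => //.
  exact: smooth_cst.
by apply: smooth_prod => // i _; exact: smooth_entry.
Qed.

(** By Cramer's rule the entries are rational in those of [f]. *)
Lemma smooth_invmx V (U : set V) n (f : V -> 'M[R]_n) :
  open U -> (forall x, U x -> f x \in unitmx) -> smooth U f ->
  smooth U (fun x => invmx (f x)).
Proof.
move=> oU fu sf.
apply: (@eq_smooth _ _ _ (fun x => (\det (f x))^-1 *: \adj (f x))) => //.
  by move=> x; rewrite inE => /fu fxu; rewrite /invmx fxu.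
apply: smoothZ => //.
  apply: smoothV => //; last exact: smooth_det.
  by move=> x /fu; rewrite unitmxE unitfE.
apply: smooth_mx => // i j.
apply: (@eq_smooth _ _ _ (fun x => (-1) ^+ (j + i) *
    \det (row' j (col' i (f x))))) => //.
  by move=> x _; rewrite mxE.
apply: smoothM => //; first exact: smooth_cst.
apply: smooth_det => //; apply: smooth_mx => // k l.
apply: (@eq_smooth _ _ _ (fun x => f x (lift j k) (lift i l))) => //.
  by move=> x _; rewrite !mxE.
exact: smooth_entry.
Qed.

End SmoothTheory.

(** * Symmetry of second derivatives *)
Section Schwarz.
Context {R : realType}.

Lemma is_derive_comp_curve (V W : normedModType R) (f : V -> W) (c : R -> V)
    (t : R) (dc : V) :
  differentiable f (c t) -> is_derive t 1 c dc ->
  is_derive t 1 (f \o c) ('D_dc f (c t)).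
Proof.
move=> df [dct <-].
have dc' : differentiable c t by exact/derivable1_diffP.
apply: DeriveDef; first exact/derivable1_diffP/differentiable_comp.
rewrite !deriveE//; last exact: differentiable_comp.
by rewrite (diff_comp dc' df).
Qed.

Lemma is_derive_line (V : normedModType R) (p v : V) (t : R) :
  is_derive t 1 (fun s : R => p + s *: v) v.
Proof.
have lin : linear (fun r : R^o => r *: v).
  by move=> a r s; rewrite scalerDl scalerA.
pose L : {linear R -> V} :=
  HB.pack (fun r : R^o => r *: v) (GRing.isLinear.Build _ _ _ _ _ lin).
have cL : continuous L by exact: scalel_continuous.
have dL : differentiable L t by exact: linear_differentiable.
have DL : is_derive t 1 (fun r : R => r *: v) v.
  apply: DeriveDef; first exact/derivable1_diffP.
  by rewrite deriveE// (diff_lin t cL); exact: scale1r.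
have := is_deriveD (is_derive_cst p t 1) DL.
by rewrite add0r.
Qed.

Lemma is_derive_along_line (V W : normedModType R) (f : V -> W) (p v : V)
    (t : R) :
  differentiable f (p + t *: v) ->
  is_derive t 1 (fun s : R => f (p + s *: v)) ('D_v f (p + t *: v)).
Proof.
by move=> df; apply: (is_derive_comp_curve df); exact: is_derive_line.
Qed.

(** The mean value theorem in the direction [v], for the difference of two
    parallel segments, and then in the direction [w] for the derivative so
    obtained. *)
Lemma second_difference (V : normedModType R) (U : set V) (f : V -> R)
    (x v w : V) (h : R) :
  smooth U f -> 0 < h ->
  (forall s t, 0 <= s <= h -> 0 <= t <= h -> U (x + s *: v + t *: w)) ->
  exists s t, [/\ 0 <= s <= h, 0 <= t <= h &
    (f (x + h *: v + h *: w) - f (x + h *: v)) - (f (x + h *: w) - f x)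
    = h * h * 'D_w (fun y => 'D_v f y) (x + s *: v + t *: w)].
Proof.
move=> sf h0 box.
have hh : 0 <= h <= h by apply/andP; split; [exact: ltW|exact: lexx].
have h00 : 0 <= (0 : R) <= h by apply/andP; split; [exact: lexx|exact: ltW].
pose g (s : R) : R := f (x + h *: w + s *: v) - f (x + s *: v).
pose g' (s : R) : R := 'D_v f (x + h *: w + s *: v) - 'D_v f (x + s *: v).
have Dg (s : R) : 0 <= s <= h -> is_derive s 1 g (g' s).
  move=> sh; apply: is_deriveB; apply: is_derive_along_line.
    apply: (smooth_differentiable sf).
    by rewrite addrAC; exact: box.
  apply: (smooth_differentiable sf).
  by have := box _ _ sh h00; rewrite scale0r addr0.
have [s sh gE] : exists2 s, s \in `]0, h[%R & g h - g 0 = g' s * (h - 0).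
  apply: (@MVT R g g' 0 h h0).
    by move=> s; rewrite in_itv /= => /andP[s0 sh]; apply: Dg; rewrite !ltW.
  apply: derivable_within_continuous => s; rewrite in_itv /= => sh.
  by have := Dg _ sh => /@ex_derive.
have {}sh : 0 <= s <= h.
  by move: sh; rewrite in_itv /= => /andP[s0 sh]; rewrite !ltW.
pose k (t : R) : R := 'D_v f (x + s *: v + t *: w).
pose k' (t : R) : R := 'D_w (fun y => 'D_v f y) (x + s *: v + t *: w).
have Dk (t : R) : 0 <= t <= h -> is_derive t 1 k (k' t).
  move=> th; apply: (@is_derive_along_line _ _ (fun y => 'D_v f y)).
  by apply: (smooth_differentiable (smooth_derive v sf)); exact: box.
have [t th kE] : exists2 t, t \in `]0, h[%R & k h - k 0 = k' t * (h - 0).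
  apply: (@MVT R k k' 0 h h0).
    by move=> t; rewrite in_itv /= => /andP[t0 th]; apply: Dk; rewrite !ltW.
  apply: derivable_within_continuous => t; rewrite in_itv /= => th.
  by have := Dk _ th => /@ex_derive.
have {}th : 0 <= t <= h.
  by move: th; rewrite in_itv /= => /andP[t0 th]; rewrite !ltW.
exists s, t; split => //.
move: gE kE; rewrite /g /g' /k /k' !scale0r !addr0 subr0.
rewrite [x + h *: w + h *: v]addrAC [x + h *: w + s *: v]addrAC => -> ->.
by rewrite mulrC mulrA mulrAC.
Qed.

Lemma eq_continuous_at (V : normedModType R) (A B : V -> R) (x : V) :
  {for x, continuous A} -> {for x, continuous B} ->
  (forall d, 0 < d -> exists y z, [/\ ball x d y, ball x d z & A y = B z]) ->
  A x = B x.
Proof.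
move=> cA cB AB; apply/eqP; rewrite -subr_eq0 -normr_le0.
apply/ler_addgt0Pl => e e0; rewrite addr0.
have e20 : 0 < e / 2 by rewrite divr_gt0.
have near_dist (F : V -> R) : {for x, continuous F} ->
    \forall y \near x, `|F x - F y| < e / 2.
  by move=> /cvgrPdist_lt; exact.
have nAB : \forall y \near x, `|A x - A y| < e / 2 /\ `|B x - B y| < e / 2.
  exact: filterI (near_dist A cA) (near_dist B cB).
have /nbhs_ballP[d /= d0 dP] := nAB.
have [y [z [/dP[Ay _] /dP[_ Bz] yz]]] := AB d d0.
have -> : A x - B x = (A x - A y) - (B x - B z) by rewrite yz; lra.
by rewrite (le_trans (ler_normB _ _))// [leRHS]splitr lerD// ltW.
Qed.

(** Both orders of the mixed second difference are [h^2] times a mixed second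
    derivative at a point of the small parallelogram spanned by [h v] and
    [h w], and these derivatives are continuous. *)
Lemma derive_comm (V : normedModType R) (U : set V) (f : V -> R) (x v w : V) :
  open U -> smooth U f -> U x ->
  'D_v (fun y => 'D_w f y) x = 'D_w (fun y => 'D_v f y) x.
Proof.
move=> oU sf Ux.
have cA := smooth_continuous (smooth_derive v (smooth_derive w sf)) Ux.
have cB := smooth_continuous (smooth_derive w (smooth_derive v sf)) Ux.
apply: (eq_continuous_at cA cB) => d0 d00.
have nU : nbhs x U by exact: open_nbhs_nbhs.
have /nbhs_ballP[d1 /= d10 d1P] := nU.
pose d := Num.min d0 d1.
have dd : 0 < d by rewrite lt_min d00.
pose c := `|v| + `|w| + 1.
have c0 : 0 < c by rewrite ltr_wpDl// addr_ge0.
pose h := d / (2 * c).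
have h0 : 0 < h by rewrite divr_gt0// mulr_gt0.
have box s t : 0 <= s <= h -> 0 <= t <= h ->
    ball x d (x + s *: v + t *: w).
  move=> /andP[s0 sh] /andP[t0 th]; rewrite -ball_normE /=.
  rewrite -addrA opprD addrA subrr sub0r normrN.
  apply: le_lt_trans (ler_normD _ _) _; rewrite !normrZ !ger0_norm//.
  apply: (@le_lt_trans _ _ (h * c)).
    rewrite /c mulrDr mulr1 mulrDr ler_wpDr ?(ltW h0)//.
    by rewrite lerD// ler_wpM2r.
  rewrite /h; have -> : d / (2 * c) * c = d / 2.
    by field; rewrite gt_eqF.
  by rewrite ltr_pdivrMr// ltr_pMr// ltr1n.
have box0 s t : 0 <= s <= h -> 0 <= t <= h ->
    ball x d0 (x + s *: v + t *: w).
  by move=> sh th; apply: le_ball (box _ _ sh th); rewrite ge_min lexx.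
have Ubox s t : 0 <= s <= h -> 0 <= t <= h -> U (x + s *: v + t *: w).
  move=> sh th; apply: d1P; apply: le_ball (box _ _ sh th).
  by rewrite ge_min lexx orbT.
have [s [t [sh th E1]]] := second_difference sf h0 Ubox.
have Ubox' t' s' (th' : 0 <= t' <= h) (sh' : 0 <= s' <= h) :
  U (x + t' *: w + s' *: v) by rewrite addrAC; exact: Ubox.
have [t' [s' [th' sh' E2]]] := second_difference sf h0 Ubox'.
exists (x + t' *: w + s' *: v), (x + s *: v + t *: w).
split; [by rewrite addrAC; exact: box0|exact: box0|].
have h20 : h * h != 0 by rewrite mulf_neq0// gt_eqF.
apply: (mulfI h20); apply: etrans (etrans (esym E2) _) E1.
rewrite (addrAC x (h *: w)).
by ring.
Qed.

End Schwarz.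

(** * Indices modulo three, bilinear forms, quaternion relations *)
Section Ord3.

Lemma ord3_ind (P : 'I_3 -> Prop) : P 0 -> P 1 -> P 2%:R -> forall s, P s.
Proof.
move=> P0 P1 P2 [[|[|[|//]]] i].
- by rewrite (_ : Ordinal i = 0) //; apply/val_inj.
- by rewrite (_ : Ordinal i = 1) //; apply/val_inj.
- by rewrite (_ : Ordinal i = 2%:R) //; apply/val_inj.
Qed.

Lemma ord3_add11 : 1 + 1 = 2%:R :> 'I_3. Proof. exact/val_inj. Qed.
Lemma ord3_add12 : 1 + 2%:R = 0 :> 'I_3. Proof. exact/val_inj. Qed.
Lemma ord3_add21 : 2%:R + 1 = 0 :> 'I_3. Proof. exact/val_inj. Qed.
Lemma ord3_add22 : 2%:R + 2%:R = 1 :> 'I_3. Proof. exact/val_inj. Qed.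

Definition ord3E :=
  (ord3_add11, ord3_add12, ord3_add21, ord3_add22, add0r 1 : 0 + 1 = 1 :> 'I_3,
   add0r 2%:R : 0 + 2%:R = 2%:R :> 'I_3).

Lemma ord3D (s : 'I_3) :
  (s + 1 + 1 = s + 2%:R) * (s + 1 + 2%:R = s) * (s + 2%:R + 1 = s)
  * (s + 2%:R + 2%:R = s + 1).
Proof. by do !split; rewrite -addrA ord3E ?addr0. Qed.

Lemma sum_ord3 (W : nmodType) (F : 'I_3 -> W) (s : 'I_3) :
  \sum_t F t = F s + F (s + 1) + F (s + 2%:R).
Proof.
have -> : \sum_t F t = F 0 + F 1 + F 2%:R.
  rewrite !big_ord_recl big_ord0 addr0 addrA.
  congr (F _ + F _ + F _); exact/val_inj.
elim/ord3_ind: s; rewrite !ord3E //.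
  by rewrite [RHS]addrC addrA.
by rewrite -[RHS]addrA [RHS]addrC.
Qed.

Lemma ord3_eq (s : 'I_3) :
  ((s + 1 == s) = false) * ((s == s + 1) = false)
  * ((s + 2%:R == s) = false) * ((s == s + 2%:R) = false)
  * ((s + 1 == s + 2%:R) = false) * ((s + 2%:R == s + 1) = false).
Proof. by elim/ord3_ind: s; do !split. Qed.

Lemma ord3_cases (s t : 'I_3) : [\/ t = s, t = s + 1 | t = s + 2%:R].
Proof.
by elim/ord3_ind: s; elim/ord3_ind: t; rewrite !ord3E;
  first [by constructor 1|by constructor 2|by constructor 3].
Qed.

End Ord3.

Section Bilin.
Context {R : realType} {d : nat}.
Implicit Types (v w z : 'rV[R]_d) (B C M : 'M[R]_d).

Lemma bilinDl B v w z : bilin B (v + w) z = bilin B v z + bilin B w z.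
Proof. by rewrite /bilin !mulmxDl mxE. Qed.
Lemma bilinDr B v w z : bilin B z (v + w) = bilin B z v + bilin B z w.
Proof. by rewrite /bilin linearD mulmxDr mxE. Qed.
Lemma bilinNl B v z : bilin B (- v) z = - bilin B v z.
Proof. by rewrite /bilin !mulNmx mxE. Qed.
Lemma bilinNr B v z : bilin B z (- v) = - bilin B z v.
Proof. by rewrite /bilin linearN mulmxN mxE. Qed.
Lemma bilinZl B c v z : bilin B (c *: v) z = c * bilin B v z.
Proof. by rewrite /bilin -!scalemxAl mxE. Qed.
Lemma bilinZr B c v z : bilin B z (c *: v) = c * bilin B z v.
Proof. by rewrite /bilin linearZ -scalemxAr mxE. Qed.
Lemma bilinD B C v w : bilin (B + C) v w = bilin B v w + bilin C v w.
Proof. by rewrite /bilin mulmxDr mulmxDl mxE. Qed.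
Lemma bilinN B v w : bilin (- B) v w = - bilin B v w.
Proof. by rewrite /bilin mulmxN mulNmx mxE. Qed.
Lemma bilinZ c B v w : bilin (c *: B) v w = c * bilin B v w.
Proof. by rewrite /bilin -scalemxAr -scalemxAl mxE. Qed.
Lemma bilin_sum (I : Type) (r : seq I) (P : pred I) (F : I -> 'M[R]_d) v w :
  bilin (\sum_(i <- r | P i) F i) v w = \sum_(i <- r | P i) bilin (F i) v w.
Proof. by rewrite /bilin mulmx_sumr mulmx_suml summxE. Qed.
Lemma bilin_sumr (I : Type) (r : seq I) (P : pred I) B v (F : I -> 'rV[R]_d) :
  bilin B v (\sum_(i <- r | P i) F i) = \sum_(i <- r | P i) bilin B v (F i).
Proof. by rewrite /bilin linear_sum mulmx_sumr summxE. Qed.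
Lemma bilin_suml (I : Type) (r : seq I) (P : pred I) B v (F : I -> 'rV[R]_d) :
  bilin B (\sum_(i <- r | P i) F i) v = \sum_(i <- r | P i) bilin B (F i) v.
Proof. by rewrite /bilin !mulmx_suml summxE. Qed.

Lemma bilin0l B v : bilin B 0 v = 0.
Proof. by rewrite /bilin !mul0mx mxE. Qed.
Lemma bilin0r B v : bilin B v 0 = 0.
Proof. by rewrite /bilin trmx0 mulmx0 mxE. Qed.

Lemma bilinMl B M v w : bilin B (v *m M) w = bilin (M *m B) v w.
Proof. by rewrite /bilin !mulmxA. Qed.
Lemma bilinMr B M v w : bilin B v (w *m M) = bilin (B *m M^T) v w.
Proof. by rewrite /bilin trmx_mul !mulmxA. Qed.
Lemma bilin_tr B v w : bilin B^T v w = bilin B w v.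
Proof.
rewrite /bilin -[in RHS](trmxK (w *m B *m v^T)) [RHS]mxE.
by rewrite !trmx_mul trmxK mulmxA.
Qed.

Lemma bilin_delta B p q : bilin B 'e_p 'e_q = B p q.
Proof. by rewrite /bilin -rowE trmx_delta -colE !mxE. Qed.

Lemma bilin_inj B C : (forall v w, bilin B v w = bilin C v w) -> B = C.
Proof. by move=> BC; apply/matrixP => p q; rewrite -!bilin_delta BC. Qed.

Lemma bilin_injl B v w : B \in unitmx ->
  (forall z, bilin B v z = bilin B w z) -> v = w.
Proof.
move=> uB vw; rewrite -[v](mulmxK uB) -[w](mulmxK uB); congr (_ *m _).
by apply/rowP => q; have := vw 'e_q; rewrite /bilin trmx_delta -!colE !mxE.
Qed.

Lemma definite_unitmx B :
  (forall v, v != 0 -> 0 < bilin B v v) -> B \in unitmx.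
Proof.
move=> pos; rewrite -row_free_unit -kermx_eq0; apply/eqP/row_matrixP => k.
rewrite row0; apply/eqP; apply: contraT => /pos.
have : (row k (kermx B) <= kermx B)%MS by exact: row_sub.
by move=> /sub_kermxP E; rewrite /bilin E mul0mx mxE ltxx.
Qed.

Lemma bilin_wedge11 (al be : 'cV[R]_d) v w :
  bilin (wedge11 al be) v w
  = (v *m al) 0 0 * (w *m be) 0 0 - (v *m be) 0 0 * (w *m al) 0 0.
Proof.
have E (a b : 'cV[R]_d) :
    bilin (a *m b^T) v w = (v *m a) 0 0 * (w *m b) 0 0.
  rewrite /bilin !mulmxA -mulmxA -[b^T *m w^T]trmx_mul.
  by rewrite [v *m a]mx11_scalar mul_scalar_mx !mxE.
by rewrite /wedge11 bilinD bilinN !E.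
Qed.

Lemma bilin_sqcov (al : 'cV[R]_d) v w :
  bilin (sqcov al) v w = (v *m al) 0 0 * (w *m al) 0 0.
Proof.
rewrite /bilin !mulmxA -mulmxA -[al^T *m w^T]trmx_mul.
by rewrite [v *m al]mx11_scalar mul_scalar_mx !mxE.
Qed.

End Bilin.

Section Quaternionic.
Context {R : realType} {d : nat} (J : 'I_3 -> 'M[R]_d).
Hypothesis qJ : quaternion_identities J.

Lemma quat_sq s : J s *m J s = - 1%:M.
Proof. by case: qJ => sq *; exact: sq. Qed.

(** The quaternion identities are invariant under cyclic permutations; in the
    row convention the product [J (s + 1) *m J s] is the composition of [J s]
    after [J (s + 1)]. *)
Lemma quat_succ s :
  J (s + 1) *m J s = J (s + 2%:R) /\ J s *m J (s + 1) = - J (s + 2%:R).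
Proof.
case: qJ => sq; rewrite /ecomp => q01 q10 q012.
have sqK s' (M : 'M[R]_d) : M *m J s' *m J s' = - M.
  by rewrite -mulmxA quat_sq mulmxN mulmx1.
have sqK' s' (M : 'M[R]_d) : J s' *m (J s' *m M) = - M.
  by rewrite mulmxA quat_sq mulNmx mul1mx.
have q2 : J 2%:R = - (J 0 *m J 1) by rewrite q10 opprK.
elim/ord3_ind: s; rewrite !ord3E.
- by rewrite q01 q10.
- by split; [rewrite q2 mulNmx sqK opprK|rewrite -q01 sqK'].
- by split; [rewrite q2 mulmxN sqK' opprK|rewrite -q01 sqK].
Qed.

Lemma quat_mul s :
  (J (s + 1) *m J s = J (s + 2%:R)) * (J s *m J (s + 1) = - J (s + 2%:R))
  * (J (s + 2%:R) *m J (s + 1) = J s) * (J (s + 1) *m J (s + 2%:R) = - J s)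
  * (J s *m J (s + 2%:R) = J (s + 1)) * (J (s + 2%:R) *m J s = - J (s + 1)).
Proof.
have [-> ->] := quat_succ s.
have := quat_succ (s + 1); rewrite !ord3D => -[-> ->].
by have := quat_succ (s + 2%:R); rewrite !ord3D => -[-> ->].
Qed.

Section Hermitian.
Context (G : 'M[R]_d).
Hypothesis hJ : forall s v w, bilin G (v *m J s) (w *m J s) = bilin G v w.

Lemma herm_skew s v w : bilin G (v *m J s) w = - bilin G v (w *m J s).
Proof.
have := hJ s v (w *m J s); rewrite -mulmxA quat_sq mulmxN mulmx1 bilinNr.
by move=> <-; rewrite opprK.
Qed.

End Hermitian.

End Quaternionic.

(** * Derivatives of matrix-valued functions *)
Section DeriveMatrix.
Context {R : realType} {V : normedModType R}.
Implicit Types (x v : V).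

Lemma is_derive_mxP m n (M : V -> 'M[R]_(m, n)) dM x v :
  is_derive x v M dM <->
  forall i j, is_derive x v (fun y => M y i j) (dM i j).
Proof.
split=> [[dMx <-] i j|DM].
  apply: DeriveDef; first exact: (derivable_mxP M x v).1.
  by rewrite derive_mx // mxE.
have dMx : derivable M x v by apply/derivable_mxP => i j; have [] := DM i j.
apply: DeriveDef => //; rewrite derive_mx //; apply/matrixP => i j.
by rewrite mxE; have [_ ->] := DM i j.
Qed.

Lemma is_derive_mulmx m n p (A : V -> 'M[R]_(m, n)) (B : V -> 'M[R]_(n, p))
    dA dB x v :
  is_derive x v A dA -> is_derive x v B dB ->
  is_derive x v (fun y => A y *m B y) (dA *m B x + A x *m dB).
Proof.
move=> /is_derive_mxP DA /is_derive_mxP DB; apply/is_derive_mxP => i j.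
have D := is_derive_sum (fun k => is_deriveM (DA i k) (DB k j)).
move: D; set f := (X in is_derive _ _ X _).
have -> : f = (fun y => (A y *m B y) i j).
  by apply/funext => y; rewrite /f fct_sumE mxE.
move/is_derive_eq; apply.
rewrite !mxE -big_split /=; apply: eq_bigr => k _.
by rewrite addrC [_ *: dA i k]mulrC.
Qed.

Lemma is_derive_trmx m n (A : V -> 'M[R]_(m, n)) dA x v :
  is_derive x v A dA -> is_derive x v (fun y => (A y)^T) dA^T.
Proof.
move=> /is_derive_mxP DA; apply/is_derive_mxP => i j; rewrite mxE.
rewrite (_ : (fun y => _) = (fun y => A y j i)) //.
by apply/funext => y; rewrite mxE.
Qed.

Lemma is_derive_bilin d (B : V -> 'M[R]_d) (X Y : V -> 'rV[R]_d)
    dB dX dY x v :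
  is_derive x v B dB -> is_derive x v X dX -> is_derive x v Y dY ->
  is_derive x v (fun y => bilin (B y) (X y) (Y y))
    (bilin dB (X x) (Y x) + bilin (B x) dX (Y x) + bilin (B x) (X x) dY).
Proof.
move=> DB DX DY.
have /is_derive_mxP/(_ 0 0) D := is_derive_mulmx (is_derive_mulmx DX DB)
  (is_derive_trmx DY).
apply: (is_derive_eq D); rewrite mulmxDl mxE [X in X + _ = _]mxE.
by congr (_ + _); rewrite addrC.
Qed.

Lemma derive_bilin d (B : V -> 'M[R]_d) (w z : 'rV[R]_d) x v :
  derivable B x v ->
  'D_v (fun y => bilin (B y) w z) x = bilin ('D_v B x) w z.
Proof.
move=> dB; have [_ ->] := is_derive_bilin (derivableP dB)
  (is_derive_cst w x v) (is_derive_cst z x v).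
by rewrite bilin0l bilin0r !addr0.
Qed.

End DeriveMatrix.

(** * Closed triples of hermitian forms are parallel *)
(** [TI x y z] stands for [(nabla_x F_I)(y, z)], where [F_I] is the Kaehler
    form of [I]: it is skew in [y, z], its cyclic sum is [dF_I], and [tI] and
    [dK] are the derivatives of the relations [I^2 = -1] and [K = I J]. *)
Section ClosedTriples.
Context {R : realFieldType} {V : zmodType}.
Variables (I J K : V -> V) (TI TJ TK : V -> V -> V -> R).

Definition skew23 (T : V -> V -> V -> R) := forall x y z, T x z y = - T x y z.
Definition cyclic0 (T : V -> V -> V -> R) :=
  forall x y z, T x y z + T y z x + T z x y = 0.

Hypothesis (sI : skew23 TI) (sJ : skew23 TJ) (sK : skew23 TK).
Hypothesis (oI : forall x y z, TI x (- y) z = - TI x y z).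
Hypothesis (oJ : forall x y z, TJ x (- y) z = - TJ x y z).
Hypothesis (oJ1 : forall x y z, TJ (- x) y z = - TJ x y z).
Hypothesis (I2 : forall x, I (I x) = - x) (J2 : forall x, J (J x) = - x).
Hypothesis (IJ : forall x, I (J x) = K x) (JI : forall x, J (I x) = - K x).
Hypothesis tI : forall x y z, TI x (I y) z = TI x y (I z).
Hypothesis dK : forall x y z, TK x y z = TI x (J y) z - TJ x y (I z).

(** This is the integrability of [I], which follows from the closedness of the
    complex two-form [F_J + i F_K].  The difference [D] of the two sides is
    skew in its last two arguments, and the two cyclic sums make it symmetric
    in the first two; a trilinear map with both symmetries vanishes. *)
Lemma closed_pair_integrable :
  cyclic0 TJ -> cyclic0 TK ->
  forall x y z, TI x y z = TI (I x) (I y) z.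
Proof.
move=> cJ cK.
have dK' x y z : TK x y z = TI x y (J z) - TJ x (I y) z.
  have := sK x z y; rewrite (dK x z y) (sI x y (J z)) (sJ x (I y) z); lra.
have star x y z :
    - TK z x y - TJ (I z) x y = TI x (J y) z - TI y (J x) z.
  have := cJ x y (I z); have := cK x y z.
  rewrite (dK x y z) (dK' y z x) (sI y (J x) z); lra.
pose D x y z := TI x y z - TI (I x) (I y) z.
have Dskew x y z : D x z y = - D x y z.
  have := sI x y z; have := sI (I x) (I y) z.
  by rewrite /D (tI (I x) z y); lra.
have DsymJ x y z : D z x (J y) = D x z (J y).
  have H1 := star x y z; have H2 := star (I x) y (I z).
  have E1 : TK (I z) (I x) y = TI (I z) (I x) (J y) + TJ (I z) x y.
    by rewrite dK' I2 oJ opprK.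
  have E2 : TJ (I (I z)) (I x) y = TK z x y - TI z x (J y).
    by rewrite I2 oJ1 dK'; lra.
  have E3 := sI (I x) (I z) (J y); have E4 := sI x z (J y).
  have E5 : TI y (J (I x)) (I z) = TI y (J x) z.
    by rewrite JI oI -IJ -tI I2 oI opprK.
  by move: H1 H2; rewrite E1 E2 E3 E4 E5 /D; lra.
have oI3 x y z : TI x y (- z) = - TI x y z.
  by rewrite (sI x (- z) y) oI (sI x y z) opprK.
have Dsym x y z : D x y z = D y x z.
  have := DsymJ y (J z) x; rewrite J2 /D !oI3. lra.
move=> x y z.
have := Dsym x y z; have := Dskew y z x; have := Dsym y z x.
have := Dskew z x y; have := Dsym z x y; have := Dskew x y z.
rewrite /D; lra.
Qed.

(** By integrability, the last two terms of the cyclic sum do not change when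
    [y, z] are replaced by [I y, I z], while the first one changes sign. *)
Lemma closed_triple_parallel :
  cyclic0 TI -> cyclic0 TJ -> cyclic0 TK -> forall x y z, TI x y z = 0.
Proof.
move=> cI cJ cK x y z.
have N := closed_pair_integrable cJ cK.
have H1 := cI x y z; have H2 := cI x (I y) (I z).
have E1 : TI x (I y) (I z) = - TI x y z by rewrite -tI I2 oI.
have E2 : TI (I z) x (I y) = TI z x y by rewrite -tI -N.
by move: H1 H2; rewrite E1 E2 -N; lra.
Qed.

End ClosedTriples.

(** * The Levi-Civita connection in a chart *)
Fact koszul_term (R : realType) (k c p q r p' q' r' : R) :
  p' = c * p -> q' = c * q -> r' = c * r ->
  k * (p + q - r) * c = k * (p' + q' - r').
Proof. by move=> -> -> ->; ring. Qed.

Fact koszul_symmetric (R : realType) (x y p q r r' : R) :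
  x = 2^-1 * (p + q - r) -> y = 2^-1 * (q + p - r') -> r' = r -> x = y.
Proof. by move=> -> -> ->; rewrite [p + q]addrC. Qed.

Fact koszul_opposite (R : realType) (x y p q r p' q' r' : R) :
  x = 2^-1 * (p' + q' - r') -> y = 2^-1 * (p + q - r) ->
  p' = - p -> q' = - q -> r' = - r -> x = - y.
Proof. by move=> -> -> -> -> ->; ring. Qed.

Fact koszul_metric (R : realType) (x y y' p p' q r : R) :
  x = 2^-1 * (p + q - r) -> y = 2^-1 * (p' + r - q) -> p' = p -> y' = y ->
  p = x + y'.
Proof. by move=> -> -> -> ->; field. Qed.

Section LeviCivita.
Context {R : realType} {d : nat} (O : set 'rV[R]_d) (G : 'rV[R]_d -> 'M[R]_d).
Hypotheses (oO : open O) (sG : smooth O G).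
Hypothesis symG : forall y, O y -> (G y)^T = G y.
Hypothesis uG : forall y, O y -> G y \in unitmx.
Variables (x : 'rV[R]_d) (Ox : O x).
Implicit Types v w z : 'rV[R]_d.

Notation Gam := (christoffel G x).

Lemma bilin_sym v w : bilin (G x) v w = bilin (G x) w v.
Proof. by rewrite -bilin_tr symG. Qed.

Lemma bilin_dG_sym u v w : bilin ('D_u G x) v w = bilin ('D_u G x) w v.
Proof.
have dG : derivable G x u by exact: smooth_derivable sG Ox.
rewrite -!derive_bilin //; apply: near_eq_derive.
apply: (@open_near_eq _ _ _ O (fun y => bilin (G y) v w)
  (fun y => bilin (G y) w v)) => // y; rewrite inE => Oy.
by rewrite -bilin_tr symG.
Qed.

(** Koszul's formula, extended from the coordinate vectors to all [z] by
    linearity. *)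
Lemma christoffelE v w z :
  bilin (G x) (Gam v w) z =
  2^-1 * (bilin ('D_v G x) w z + bilin ('D_w G x) v z - bilin ('D_z G x) v w).
Proof.
have dG u : derivable G x u by exact: smooth_derivable sG Ox.
have dfG : differentiable G x by exact: smooth_differentiable sG Ox.
rewrite {1}/bilin /christoffel mulmxKV ?uG // mxE.
have dz : 'D_z G x = \sum_l z 0 l *: 'D_('e_l) G x.
  rewrite deriveE // [in LHS](row_sum_delta z) linear_sum.
  by apply: eq_bigr => l _; rewrite linearZ deriveE.
have zE u u' : bilin ('D_u G x) u' z
    = \sum_l bilin ('D_u G x) u' (z 0 l *: 'e_l).
  by rewrite [in LHS](row_sum_delta z) bilin_sumr.
rewrite (zE v w) (zE w v) dz bilin_sum -big_split -sumrB mulr_sumr /=.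
apply: eq_bigr => l _; rewrite !mxE; apply: koszul_term.
- by rewrite bilinZr derive_bilin.
- by rewrite bilinZr derive_bilin.
- by rewrite bilinZ derive_bilin.
Qed.

Lemma christoffelC v w : Gam v w = Gam w v.
Proof.
apply: (bilin_injl (uG Ox)) => z.
exact: (koszul_symmetric (christoffelE v w z) (christoffelE w v z)
          (bilin_dG_sym z w v)).
Qed.

Lemma christoffelNr v w : Gam v (- w) = - Gam v w.
Proof.
have dfG : differentiable G x by exact: smooth_differentiable sG Ox.
have dN : 'D_(- w) G x = - 'D_w G x by rewrite !deriveE // linearN.
apply: (bilin_injl (uG Ox)) => z; rewrite bilinNl.
apply: (koszul_opposite (christoffelE v (- w) z) (christoffelE v w z)).
- exact: bilinNl.
- by rewrite dN bilinN.
- exact: bilinNr.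
Qed.

Lemma christoffelNl v w : Gam (- v) w = - Gam v w.
Proof. by rewrite christoffelC christoffelNr christoffelC. Qed.

(** The connection is metric: all other terms cancel in the sum of Koszul's
    formulas for the two terms on the right. *)
Lemma christoffel_metric v w z :
  bilin ('D_v G x) w z = bilin (G x) (Gam v w) z + bilin (G x) w (Gam v z).
Proof.
exact: (koszul_metric (christoffelE v w z) (christoffelE v z w)
          (bilin_dG_sym v z w) (bilin_sym w _)).
Qed.

End LeviCivita.

(** * Covariant derivatives of the Kaehler forms *)
Section Dext.
Context {R : realType} {d : nat} (O : set 'rV[R]_d) (be : 'rV[R]_d -> 'cV[R]_d).
Hypotheses (oO : open O) (sbe : smooth O be).
Implicit Types (u v w y : 'rV[R]_d).

Definition pairing v y : R := (v *m be y) 0 0.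

Lemma smooth_pairing v : smooth O (pairing v).
Proof.
apply: smooth_entry => //; apply: smooth_mulmx => //; exact: smooth_cst.
Qed.

Lemma derive_pairing u v y : O y ->
  'D_u (pairing v) y = (v *m 'D_u be y) 0 0.
Proof.
move=> Oy; have dbe : derivable be y u by exact: smooth_derivable sbe Oy.
have /is_derive_mxP/(_ 0 0)[_ ->] :=
  is_derive_mulmx (is_derive_cst v y u) (derivableP dbe).
by rewrite mul0mx add0r.
Qed.

Lemma bilin_dext y v w : O y ->
  bilin (dext be y) v w = 'D_v (pairing w) y - 'D_w (pairing v) y.
Proof.
move=> Oy; rewrite !derive_pairing //.
have dbe : differentiable be y by exact: smooth_differentiable sbe Oy.
pose N : 'M[R]_d := \matrix_(p, q) 'D_('e_p) be y q 0.
have NE u z : bilin N u z = (z *m 'D_u be y) 0 0.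
  rewrite [in RHS](row_sum_delta u) deriveE // linear_sum mulmx_sumr summxE.
  rewrite [in LHS](row_sum_delta u) bilin_suml; apply: eq_bigr => p _.
  rewrite bilinZl linearZ -scalemxAr [RHS]mxE -deriveE //; congr (_ * _).
  rewrite /bilin -rowE mxE [RHS]mxE; apply: eq_bigr => q _.
  by rewrite !mxE mulrC.
have -> : dext be y = N - N^T.
  apply/matrixP => p q; rewrite !mxE.
  have D r k : 'D_('e_r) (fun z => be z k 0) y = 'D_('e_r) be y k 0.
    have dr : derivable be y 'e_r by exact: smooth_derivable sbe Oy.
    by have /is_derive_mxP/(_ k 0)[_ ->] := derivableP dr.
  by rewrite !D.
by rewrite bilinD bilinN bilin_tr !NE.
Qed.

End Dext.

Fact bianchi_derivative (R : realType) (c a p q f f' g g' df df' dg dg' : R^o) :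
  c *: (p - q) + a *: (f *: dg + g *: df - (g' *: df' + f' *: dg'))
  = c * (p - q) + a * (df * g + f * dg - dg' * f' - g' * df') :> R.
Proof. by rewrite /GRing.scale /=; ring. Qed.

(** The polynomial identity behind [bianchi]: [p, q, r] are second derivatives
    of the potentials, and the letters with two indices are first derivatives.
    The terms of degree three in the potentials cancel cyclically. *)
Fact bianchi_identity (R : realFieldType) (a p q r : R)
    (xu xv xw yu yv yw zu zv zw : R)
    (yuv yvu yuw ywu yvw ywv zuv zvu zuw zwu zvw zwv : R) :
  2^-1 * (p - q) + a * (yuv * zw + yv * zuw - zuv * yw - zv * yuw)
  + (2^-1 * (r - p) + a * (yvw * zu + yw * zvu - zvw * yu - zw * yvu))
  + (2^-1 * (q - r) + a * (ywu * zv + yu * zwv - zwu * yv - zu * ywv))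
  = 2 * a * (zu * (2^-1 * (yvw - ywv) + a * (zv * xw - xv * zw))
             + zv * (2^-1 * (ywu - yuw) + a * (zw * xu - xw * zu))
             + zw * (2^-1 * (yuv - yvu) + a * (zu * xv - xu * zv))
             - (yu * (2^-1 * (zvw - zwv) + a * (xv * yw - yv * xw))
                + yv * (2^-1 * (zwu - zuw) + a * (xw * yu - yw * xu))
                + yw * (2^-1 * (zuv - zvu) + a * (xu * yv - yu * xv)))).
Proof. by field. Qed.

Section QuaternionicChart.
Context {R : realType} {d : nat} (O : set 'rV[R]_d) (G : 'rV[R]_d -> 'M[R]_d)
  (J : 'I_3 -> 'rV[R]_d -> 'M[R]_d) (be : 'I_3 -> 'rV[R]_d -> 'cV[R]_d) (a : R).
Hypotheses (oO : open O) (sG : smooth O G).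
Hypothesis symG : forall y, O y -> (G y)^T = G y.
Hypothesis uG : forall y, O y -> G y \in unitmx.
Hypothesis sJ : forall s, smooth O (J s).
Hypothesis qJ : forall y, O y -> quaternion_identities (fun s => J s y).
Hypothesis hJ : forall y, O y ->
  forall s v w, bilin (G y) (v *m J s y) (w *m J s y) = bilin (G y) v w.
Hypothesis sbe : forall s, smooth O (be s).
Hypothesis curvature : forall s y, O y ->
  kahler_form (G y) (J s y) =
    2^-1 *: dext (be s) y + a *: wedge11 (be (s + 1) y) (be (s + 2%:R) y).
Implicit Types (u v w z y : 'rV[R]_d).

Let F s y := kahler_form (G y) (J s y).

Lemma kahlerE s y v w : bilin (F s y) v w = bilin (G y) (v *m J s y) w.
Proof. by rewrite /F /kahler_form bilinMl. Qed.

Lemma kahler_skew s y v w : O y -> bilin (F s y) v w = - bilin (F s y) w v.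
Proof.
move=> Oy; rewrite !kahlerE (herm_skew (qJ Oy) (hJ Oy)).
by rewrite -bilin_tr symG.
Qed.

Variables (x : 'rV[R]_d) (Ox : O x).
Notation Gam := (christoffel G x).

Lemma derivable_kahler s y u : O y -> derivable (F s) y u.
Proof.
move=> Oy; apply: (@smooth_derivable _ _ _ O) => //.
by apply: smooth_mulmx.
Qed.

(** The exterior derivative of the curvature equation, that is, the Bianchi
    identity of the connection with potentials [be].  The second derivatives
    cancel because they are symmetric, and the curvature equation is used once
    more to eliminate the first derivatives. *)
Lemma bianchi s u v w :
  bilin ('D_u (F s) x) v w + bilin ('D_v (F s) x) w u
    + bilin ('D_w (F s) x) u v =
  2 * a * ((pairing (be (s + 2%:R)) u x * bilin (F (s + 1) x) v w
            + pairing (be (s + 2%:R)) v x * bilin (F (s + 1) x) w u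
            + pairing (be (s + 2%:R)) w x * bilin (F (s + 1) x) u v)
         - (pairing (be (s + 1)) u x * bilin (F (s + 2%:R) x) v w
            + pairing (be (s + 1)) v x * bilin (F (s + 2%:R) x) w u
            + pairing (be (s + 1)) w x * bilin (F (s + 2%:R) x) u v)).
Proof.
pose b t p := pairing (be t) p.
pose db t p q := 'D_p (b t q) x.
have FE t y p q : O y -> bilin (F t y) p q =
    2^-1 * ('D_p (b t q) y - 'D_q (b t p) y)
    + a * (b (t + 1) p y * b (t + 2%:R) q y - b (t + 2%:R) p y * b (t + 1) q y).
  move=> Oy; rewrite /F curvature // bilinD !bilinZ bilin_wedge11.
  by rewrite (bilin_dext (@sbe t)).
have Db t p q y : O y -> derivable (b t p) y q.
  by move=> Oy; exact: smooth_derivable (smooth_pairing oO (@sbe t) p) Oy.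
have DDb t p q r : derivable (fun y => 'D_p (b t q) y) x r.
  apply: (@smooth_derivable _ _ _ O) => //.
  by apply: smooth_derive; exact: smooth_pairing.
pose ddb t p q r := 'D_p (fun y => 'D_q (b t r) y) x.
have ddbC t p q r : ddb t p q r = ddb t q p r.
  exact: derive_comm oO (smooth_pairing oO (@sbe t) r) Ox.
have DF r t p q : bilin ('D_r (F t) x) p q =
    2^-1 * (ddb t r p q - ddb t r q p)
    + a * (db (t + 1) r p * b (t + 2%:R) q x + b (t + 1) p x * db (t + 2%:R) r q
           - db (t + 2%:R) r p * b (t + 1) q x
           - b (t + 2%:R) p x * db (t + 1) r q).
  rewrite -derive_bilin; last exact: derivable_kahler.
  pose f y := 2^-1 * ('D_p (b t q) y - 'D_q (b t p) y)
    + a * (b (t + 1) p y * b (t + 2%:R) q y - b (t + 2%:R) p y * b (t + 1) q y).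
  rewrite (@near_eq_derive _ _ _ _ f); last first.
    apply: (@open_near_eq _ _ _ O (fun y => bilin (F t y) p q) f) => // y.
    by rewrite inE => Oy; exact: FE.
  have D1 := is_deriveZ 2^-1 (is_deriveB (derivableP (DDb t p q r))
                                        (derivableP (DDb t q p r))).
  have DP t1 t2 := is_deriveM (derivableP (Db t1 p r x Ox))
                              (derivableP (Db t2 q r x Ox)).
  have D2 := is_deriveZ a (is_deriveB (DP (t + 1) (t + 2%:R))
                                      (DP (t + 2%:R) (t + 1))).
  have [_ ->] := is_deriveD D1 D2.
  exact: bianchi_derivative.
rewrite !DF !FE // !ord3D.
rewrite (ddbC s v u w) (ddbC s w u v) (ddbC s w v u).
exact: bianchi_identity.
Qed.

Definition nablaF s u v w :=
  bilin ('D_u (F s) x) v w - bilin (F s x) (Gam u v) w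
  - bilin (F s x) v (Gam u w).

(** The part of [nabla F_s] that the connection with potentials [2 a be] does
    not account for. *)
Definition defect s u v w :=
  nablaF s u v w
  - 2 * a * (pairing (be (s + 2%:R)) u x * bilin (F (s + 1) x) v w
             - pairing (be (s + 1)) u x * bilin (F (s + 2%:R) x) v w).

(** The vector [(nabla_u J_s) w]. *)
Let dJ s u w := w *m 'D_u (J s) x - Gam u w *m J s x + Gam u (w *m J s x).

Let nablaFE s u v w : nablaF s u v w = bilin (G x) (dJ s u v) w.
Proof.
have dG : derivable G x u by exact: smooth_derivable sG Ox.
have dJx : derivable (J s) x u by exact: smooth_derivable (@sJ s) Ox.
have [_ DF] := is_derive_mulmx (derivableP dJx) (derivableP dG).
rewrite /nablaF /dJ bilinDl bilinDl bilinNl !kahlerE.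
rewrite [X in bilin X v w]DF bilinD -!bilinMl.
rewrite (christoffel_metric oO sG symG uG Ox u (v *m J s x)).
ring.
Qed.

(** [nabla_u] is a derivation, applied to [J_(s+2) = J_s o J_(s+1)]. *)
Let dJ_succ s u w :
  dJ (s + 2%:R) u w = dJ s u (w *m J (s + 1) x) + dJ (s + 1) u w *m J s x.
Proof.
have D t : derivable (J t) x u by exact: smooth_derivable (@sJ t) Ox.
have [_ DJ] := is_derive_mulmx (derivableP (D (s + 1))) (derivableP (D s)).
have E : 'D_u (J (s + 2%:R)) x = 'D_u (fun y => J (s + 1) y *m J s y) x.
  apply: near_eq_derive.
  apply: (@open_near_eq _ _ _ O (J (s + 2%:R))
    (fun y => J (s + 1) y *m J s y)) => // y; rewrite inE => Oy.
  by rewrite (quat_mul (qJ Oy)).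
have [[[[[q0 _] _] _] _] _] := quat_mul (qJ Ox) s.
rewrite /dJ E DJ -q0 mulmxDr !mulmxDl !mulNmx !mulmxA.
have gen (p q r g k : 'rV[R]_d) : p + q - r + k = q - g + k + (p - r + g).
  by apply/rowP => i; rewrite !mxE; ring.
exact: gen.
Qed.

Let dJ_sq s u w : dJ s u (w *m J s x) = - (dJ s u w *m J s x).
Proof.
have D : derivable (J s) x u by exact: smooth_derivable (@sJ s) Ox.
have [_ DJ] := is_derive_mulmx (derivableP D) (derivableP D).
have E : 'D_u (fun y => J s y *m J s y) x = 0.
  rewrite (@near_eq_derive _ _ _ _ (cst (- 1%:M))) ?derive_cst //.
  apply: (@open_near_eq _ _ _ O (fun y => J s y *m J s y)
    (cst (- 1%:M))) => // y; rewrite inE => Oy.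
  by rewrite (quat_sq (qJ Oy)).
have DJ0 : 'D_u (J s) x *m J s x = - (J s x *m 'D_u (J s) x).
  by apply/eqP; rewrite -addr_eq0 -DJ E.
rewrite /dJ !mulmxDl mulNmx -!mulmxA DJ0 (quat_sq (qJ Ox)) !mulmxN !mulmx1.
by rewrite (christoffelNr sG uG Ox) !opprD !opprK mulmxA addrAC.
Qed.

Let KF y s v w : O y -> bilin (F s y) v w = - bilin (G y) v (w *m J s y).
Proof. by move=> Oy; rewrite kahlerE (herm_skew (qJ Oy) (hJ Oy)). Qed.

Lemma defect_skew s : skew23 (defect s).
Proof.
move=> u v w; rewrite /defect /nablaF.
have DFs : bilin ('D_u (F s) x) w v = - bilin ('D_u (F s) x) v w.
  have dF := @derivable_kahler s x u Ox.
  rewrite -!derive_bilin //.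
  have [dF' _] := is_derive_bilin (derivableP dF) (is_derive_cst v x u)
    (is_derive_cst w x u).
  rewrite -deriveN //; apply: near_eq_derive.
  apply: (@open_near_eq _ _ _ O (fun y => bilin (F s y) w v)
    (- (fun y => bilin (F s y) v w))) => // y; rewrite inE => Oy.
  exact: kahler_skew.
rewrite DFs !(kahler_skew _ w v Ox) (kahler_skew s (Gam u w) v Ox).
rewrite (kahler_skew s w (Gam u v) Ox); ring.
Qed.

Lemma defect_cyclic s : cyclic0 (defect s).
Proof.
move=> u v w; rewrite /defect /nablaF.
have B := bianchi s u v w.
rewrite (christoffelC oO sG symG uG Ox v u) (christoffelC oO sG symG uG Ox w u).
rewrite (christoffelC oO sG symG uG Ox w v).
rewrite (kahler_skew s v (Gam u w) Ox) (kahler_skew s w (Gam u v) Ox).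
rewrite (kahler_skew s u (Gam v w) Ox).
move: B; lra.
Qed.

Lemma defect_type s u v w :
  defect s u (v *m J s x) w = defect s u v (w *m J s x).
Proof.
have anti t : J s x *m J t x = - (J t x *m J s x) ->
    bilin (F t x) (v *m J s x) w = bilin (F t x) v (w *m J s x).
  move=> E; rewrite !kahlerE -mulmxA E mulmxN bilinNl mulmxA.
  by rewrite (herm_skew (qJ Ox) (hJ Ox) s (v *m J t x)) opprK.
rewrite /defect !nablaFE dJ_sq bilinNl (herm_skew (qJ Ox) (hJ Ox)) opprK.
by rewrite !anti // !(quat_mul (qJ Ox)) ?opprK.
Qed.

Lemma defect_succ s u v w :
  defect (s + 2%:R) u v w
  = defect s u (v *m J (s + 1) x) w - defect (s + 1) u v (w *m J s x).
Proof.
have E1 : bilin (F (s + 1) x) (v *m J (s + 1) x) w = - bilin (G x) v w.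
  by rewrite kahlerE -mulmxA (quat_sq (qJ Ox)) mulmxN mulmx1 bilinNl.
have E2 : bilin (F (s + 2%:R) x) (v *m J (s + 1) x) w = - bilin (F s x) v w.
  by rewrite !kahlerE -mulmxA (quat_mul (qJ Ox)) mulmxN bilinNl.
have E3 : bilin (F (s + 2%:R) x) v (w *m J s x) = bilin (F (s + 1) x) v w.
  by rewrite !(KF _ _ _ Ox) -mulmxA (quat_mul (qJ Ox)).
have E4 : bilin (F s x) v (w *m J s x) = bilin (G x) v w.
  by rewrite (KF _ _ _ Ox) -mulmxA (quat_sq (qJ Ox)) mulmxN mulmx1 bilinNr opprK.
have E5 : bilin (G x) (dJ (s + 1) u v *m J s x) w
    = - bilin (G x) (dJ (s + 1) u v) (w *m J s x).
  by rewrite (herm_skew (qJ Ox) (hJ Ox)).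
rewrite /defect !nablaFE dJ_succ bilinDl E5 !ord3D E1 E2 E3 E4.
by ring.
Qed.

Lemma defectNl s u v w : defect s (- u) v w = - defect s u v w.
Proof.
have dF : differentiable (F s) x.
  apply: (@smooth_differentiable _ _ _ O) => //; exact: smooth_mulmx.
rewrite /defect /nablaF !(christoffelNl oO sG symG uG Ox) !deriveE //.
rewrite linearN bilinN bilinNl bilinNr /pairing !mulNmx !mxE; ring.
Qed.

Lemma defectNm s u v w : defect s u (- v) w = - defect s u v w.
Proof.
rewrite /defect /nablaF !(christoffelNr sG uG Ox) !bilinNl; ring.
Qed.

(** The potentials enter [nabla F_s] through a derivation of the quaternion
    algebra.  Subtracting their contribution therefore keeps the relations
    between the three covariant derivatives, and by [bianchi] it makes the
    cyclic sums vanish: the defects satisfy all the hypotheses of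
    [closed_triple_parallel]. *)
Theorem nabla_kahler s u v w :
  nablaF s u v w =
  2 * a * (pairing (be (s + 2%:R)) u x * bilin (F (s + 1) x) v w
           - pairing (be (s + 1)) u x * bilin (F (s + 2%:R) x) v w).
Proof.
have sqr t y : y *m J t x *m J t x = - y.
  by rewrite -mulmxA (quat_sq (qJ Ox)) mulmxN mulmx1.
have IJ y : y *m J (s + 1) x *m J s x = y *m J (s + 2%:R) x.
  by rewrite -mulmxA (quat_mul (qJ Ox)).
have JI y : y *m J s x *m J (s + 1) x = - (y *m J (s + 2%:R) x).
  by rewrite -mulmxA (quat_mul (qJ Ox)) mulmxN.
have D0 := @closed_triple_parallel R 'rV[R]_d (mulmx^~ (J s x))
  (mulmx^~ (J (s + 1) x)) (mulmx^~ (J (s + 2%:R) x)) _ _ _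
  (@defect_skew s) (@defect_skew (s + 1)) (@defect_skew (s + 2%:R))
  (@defectNm s) (@defectNm (s + 1)) (@defectNl (s + 1)) (sqr s) (sqr (s + 1))
  IJ JI (@defect_type s) (@defect_succ s)
  (@defect_cyclic s) (@defect_cyclic (s + 1)) (@defect_cyclic (s + 2%:R)) u v w.
by apply/eqP; rewrite -subr_eq0; apply/eqP; exact: D0.
Qed.

End QuaternionicChart.

(** * Quaternions inside a matrix algebra *)
Section QuaternionSpan.
Context {R : realType} {d : nat}.
Implicit Types (J : 'I_3 -> 'M[R]_d) (M : 'M[R]_d) (c : 'I_3 -> R).

Lemma quat_anticomm J s t : quaternion_identities J ->
  J s *m J t + J t *m J s = (- 2 * (s == t)%:R)%:M.
Proof.
move=> qJ; case: (ord3_cases s t) => ->.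
- by rewrite eqxx mulr1 (quat_sq qJ) -opprD -raddfD -raddfN.
- by rewrite ord3_eq mulr0 !(quat_mul qJ) addNr raddf0.
- by rewrite ord3_eq mulr0 !(quat_mul qJ) subrr raddf0.
Qed.

Definition imag J c : 'M[R]_d := \sum_s c s *: J s.

Lemma imag_anticomm J c e : quaternion_identities J ->
  imag J c *m imag J e + imag J e *m imag J c
  = (- 2 * \sum_s c s * e s)%:M.
Proof.
move=> qJ.
have E c1 c2 : imag J c1 *m imag J c2
    = \sum_s \sum_t (c1 s * c2 t) *: (J s *m J t).
  rewrite mulmx_suml; apply: eq_bigr => s _; rewrite mulmx_sumr.
  by apply: eq_bigr => t _; rewrite -scalemxAl -scalemxAr scalerA.
rewrite !E [X in _ + X]exchange_big -big_split /= mulr_sumr raddf_sum.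
apply: eq_bigr => s _; rewrite -big_split /= (bigD1 s) //= big1 => [|t ts].
  rewrite addr0 [e s * _]mulrC -scalerDr quat_anticomm // eqxx mulr1.
  by rewrite scale_scalar_mx mulrC.
rewrite [e t * _]mulrC -scalerDr quat_anticomm // eq_sym (negPf ts) mulr0.
by rewrite raddf0 scaler0.
Qed.

Lemma imag_sq J c : quaternion_identities J ->
  imag J c *m imag J c = (- \sum_s c s ^+ 2)%:M.
Proof.
move=> qJ; have := imag_anticomm c c qJ.
under eq_bigr do rewrite -expr2.
rewrite -mulr2n -scaler_nat mulNr raddfN /= -scale_scalar_mx -scalerN -raddfN /=.
by move/scalerI; apply; rewrite pnatr_eq0.
Qed.

Definition quat J (c0 : R) c : 'M[R]_d := c0%:M + imag J c.

Definition in_quat J M := exists (c0 : R) c, M = quat J c0 c.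

Lemma in_quatD J M N : in_quat J M -> in_quat J N -> in_quat J (M + N).
Proof.
move=> [c0 [c ->]] [e0 [e ->]]; exists (c0 + e0), (fun s => c s + e s).
rewrite /quat raddfD /= addrACA; congr (_ + _).
by rewrite -big_split /=; apply: eq_bigr => s _; rewrite scalerDl.
Qed.

Lemma in_quatZ J k M : in_quat J M -> in_quat J (k *: M).
Proof.
move=> [c0 [c ->]]; exists (k * c0), (fun s => k * c s).
rewrite /quat scalerDr scale_scalar_mx scaler_sumr; congr (_ + _).
by apply: eq_bigr => s _; rewrite scalerA.
Qed.

Lemma in_quatN J M : in_quat J M -> in_quat J (- M).
Proof. by rewrite -scaleN1r; exact: in_quatZ. Qed.

Lemma in_quat_sum J (F : 'I_3 -> 'M[R]_d) :
  (forall s, in_quat J (F s)) -> in_quat J (\sum_s F s).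
Proof.
by move=> qF; rewrite (sum_ord3 F 0); do 2! apply: in_quatD => //.
Qed.

Lemma in_quat1 J : in_quat J 1%:M.
Proof.
exists 1, (fun=> 0); rewrite /quat /imag big1 ?addr0 // => s _.
by rewrite scale0r.
Qed.

Lemma in_quatJ J s : in_quat J (J s).
Proof.
exists 0, (fun t => (t == s)%:R); rewrite /quat /imag raddf0 add0r.
rewrite (bigD1 s) //= eqxx scale1r big1 ?addr0 // => t /negPf->.
by rewrite scale0r.
Qed.

Lemma in_quat_mulr J M s : quaternion_identities J ->
  in_quat J M -> in_quat J (M *m J s).
Proof.
move=> qJ [c0 [c ->]]; rewrite /quat mulmxDl mul_scalar_mx mulmx_suml.
apply: in_quatD; first by apply: in_quatZ; exact: in_quatJ.
rewrite (sum_ord3 _ s) -!scalemxAl (quat_sq qJ) !(quat_mul qJ).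
apply: in_quatD; last by apply/in_quatZ/in_quatN/in_quatJ.
apply: in_quatD; first by apply/in_quatZ/in_quatN/in_quat1.
exact/in_quatZ/in_quatJ.
Qed.

Lemma in_quat_mull J M s : quaternion_identities J ->
  in_quat J M -> in_quat J (J s *m M).
Proof.
move=> qJ [c0 [c ->]]; rewrite /quat mulmxDr mul_mx_scalar mulmx_sumr.
apply: in_quatD; first by apply: in_quatZ; exact: in_quatJ.
rewrite (sum_ord3 _ s) -!scalemxAr (quat_sq qJ) !(quat_mul qJ).
apply: in_quatD; last by apply/in_quatZ/in_quatJ.
apply: in_quatD; first by apply/in_quatZ/in_quatN/in_quat1.
exact/in_quatZ/in_quatN/in_quatJ.
Qed.

Lemma quat_conj J (c0 : R) c : quaternion_identities J ->
  quat J c0 c *m quat J c0 (fun s => - c s)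
  = (c0 ^+ 2 + \sum_s c s ^+ 2)%:M.
Proof.
move=> qJ.
have -> : quat J c0 (fun s => - c s) = c0%:M - imag J c.
  rewrite /quat; congr (_ + _); rewrite /imag -sumrN.
  by apply: eq_bigr => s _; rewrite scaleNr.
rewrite /quat mulmxBr !mulmxDl !mul_mx_scalar mul_scalar_mx (imag_sq c qJ).
rewrite scale_scalar_mx raddfN /= opprD opprK addrA addrK.
by rewrite raddfD.
Qed.

End QuaternionSpan.

Section BasisChange.
Context {R : realType} {d : nat} (G : 'M[R]_d) (Q : set 'M[R]_d).

(** The tensor [sum_s F_s (x) F_s].  It depends only on the space spanned by
    the basis [J], which it determines, and the fundamental four-form is its
    skew part. *)
Definition four_square (J : 'I_3 -> 'M[R]_d) v w y z : R :=
  \sum_s bilin (kahler_form G (J s)) v w * bilin (kahler_form G (J s)) y z.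

Lemma four_square_rot (J J' : 'I_3 -> 'M[R]_d) (r : 'M[R]_3) v w y z :
  r *m r^T = 1%:M -> (forall s, J' s = \sum_t r s t *: J t) ->
  four_square J' v w y z = four_square J v w y z.
Proof.
move=> rr EJ; have rr' := mulmx1C rr.
have EF s p q : bilin (kahler_form G (J' s)) p q
    = \sum_t r s t * bilin (kahler_form G (J t)) p q.
  rewrite /kahler_form EJ mulmx_suml bilin_sum; apply: eq_bigr => t _.
  by rewrite -scalemxAl bilinZ.
rewrite /four_square.
under eq_bigr do rewrite !EF mulr_suml.
rewrite exchange_big /=; apply: eq_bigr => t _.
under eq_bigr do rewrite mulr_sumr.
rewrite exchange_big /= (bigD1 t) //= [X in _ + X]big1 => [|u ut].
  rewrite addr0; have := congr1 (fun m : 'M[R]_3 => m t t) rr'.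
  rewrite !mxE eqxx -[true%:R]/(1 : R) => E.
  rewrite -[RHS]mul1r -E mulr_suml.
  by apply: eq_bigr => s _; rewrite !mxE; ring.
have := congr1 (fun m : 'M[R]_3 => m t u) rr'.
rewrite !mxE eq_sym (negPf ut) -[false%:R]/(0 : R) => E.
transitivity ((\sum_j r^T t j * r j u)
  * (bilin (kahler_form G (J t)) v w * bilin (kahler_form G (J u)) y z));
  last by rewrite E mul0r.
rewrite mulr_suml.
by apply: eq_bigr => s _; rewrite !mxE; ring.
Qed.

(** The change of basis is orthogonal because the anticommutators of the
    imaginary quaternions determine their euclidean structure. *)
Lemma quaternionic_basis_rot (J J' : 'I_3 -> 'M[R]_d) : (0 < d)%N ->
  quaternionic_basis G Q J -> quaternionic_basis G Q J' ->
  exists2 r : 'M[R]_3, r *m r^T = 1%:M &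
    forall s, J' s = \sum_t r s t *: J t.
Proof.
move=> d0 [qJ _ QJ] [qJ' _ QJ'].
have H s : exists c : 'I_3 -> R, J' s = \sum_t c t *: J t.
  have : Q (J' s).
    rewrite QJ'; exists (fun t => (t == s)%:R).
    rewrite (bigD1 s) //= eqxx scale1r big1 ?addr0 // => t /negPf->.
    by rewrite scale0r.
  by rewrite QJ.
have [c cP] := choice H.
exists (\matrix_(s, t) c s t); last first.
  by move=> s; rewrite cP; apply: eq_bigr => t _; rewrite mxE.
apply/matrixP => s t; rewrite !mxE.
have := imag_anticomm (c s) (c t) qJ; rewrite /imag -!cP quat_anticomm //.
move=> /(congr1 (fun m : 'M[R]_d => m (Ordinal d0) (Ordinal d0))).
rewrite !mxE eqxx /= !mulr1n => /mulfI E.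
under eq_bigr do rewrite !mxE.
by rewrite -E // oppr_eq0 pnatr_eq0.
Qed.

Lemma four_square_basis (J J' : 'I_3 -> 'M[R]_d) v w y z : (0 < d)%N ->
  quaternionic_basis G Q J -> quaternionic_basis G Q J' ->
  four_square J' v w y z = four_square J v w y z.
Proof.
move=> d0 bJ bJ'; have [r rr EJ] := quaternionic_basis_rot d0 bJ bJ'.
exact: four_square_rot rr EJ.
Qed.

End BasisChange.

(** * Isometries that preserve the square of the Kaehler forms *)
Section Intertwiner.
Context {R : realType} {d : nat} (J J' : 'I_3 -> 'M[R]_d).
Hypotheses (d0 : (0 < d)%N).
Hypotheses (qJ : quaternion_identities J) (qJ' : quaternion_identities J').

(** The sum of [J'_q x J_q^-1] over the four units [q = 1, i, j, k]; averaging
    over this group up to sign makes the result an intertwiner. *)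
Definition average x : 'M[R]_d := x - \sum_s J' s *m x *m J s.

Lemma average_intertwines x t : average x *m J t = J' t *m average x.
Proof.
rewrite /average mulmxBl mulmxBr (sum_ord3 _ t) !mulmxDl !mulmxDr !mulmxA.
have sqJ M : M *m J t *m J t = - M.
  by rewrite -mulmxA (quat_sq qJ) mulmxN mulmx1.
have s1 M : M *m J (t + 1) *m J t = M *m J (t + 2%:R).
  by rewrite -mulmxA (quat_mul qJ).
have s2 M : M *m J (t + 2%:R) *m J t = - (M *m J (t + 1)).
  by rewrite -mulmxA (quat_mul qJ) mulmxN.
rewrite sqJ s1 s2 (quat_sq qJ') !(quat_mul qJ') !mulNmx mul1mx.
have gen (p q r s : 'M[R]_d) : p - (- q + r - s) = q - (- p - s + r).
  by apply/matrixP => i j; rewrite !mxE; ring.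
exact: gen.
Qed.

Hypothesis J'E : forall s, exists c, J' s = imag J c.

Lemma in_quat_average x : in_quat J x -> in_quat J (average x).
Proof.
move=> qx; apply: in_quatD => //; apply: in_quatN.
apply: in_quat_sum => s; apply: in_quat_mulr => //.
have [c ->] := J'E s; rewrite mulmx_suml; apply: in_quat_sum => t.
by rewrite -scalemxAl; apply: in_quatZ; exact: in_quat_mull.
Qed.

(** If all averages of quaternions vanished, so would the sum of
    [x^bar (average x)] over the units [x = 1, i, j, k].  But this sum is [4],
    because [sum_x x^bar y x] vanishes for every imaginary [y]. *)
Lemma average_neq0 : exists2 x, in_quat J x & average x != 0.
Proof.
apply: contrapT => noX.
have av0 x : in_quat J x -> average x = 0.
  by move=> qx; apply/eqP; apply: contrapT => /negP ax; apply: noX; exists x.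
have A1 := av0 _ (in_quat1 J).
have AJ t := av0 _ (in_quatJ J t).
have K s : \sum_t J t *m J s *m J t = J s.
  rewrite (sum_ord3 _ s) (quat_sq qJ) !(quat_mul qJ) !mulNmx mul1mx.
  by rewrite !(quat_mul qJ) opprK addNr add0r.
have K' s : \sum_t J t *m J' s *m J t = J' s.
  have [c ->] := J'E s; rewrite /imag.
  under eq_bigr do rewrite mulmx_sumr mulmx_suml.
  rewrite exchange_big; apply: eq_bigr => u _ /=.
  under eq_bigr do rewrite -scalemxAr -scalemxAl.
  by rewrite -scaler_sumr K.
have : (4%:R : R)%:M = 0 :> 'M[R]_d.
  have -> : (4%:R : R)%:M = average 1%:M - \sum_t J t *m average (J t).
    rewrite /average; under [in X in _ - X]eq_bigr do
      rewrite mulmxBr (quat_sq qJ) mulmx_sumr.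
    rewrite sumrB exchange_big /=.
    have -> : \sum_s \sum_t J t *m (J' s *m J t *m J s)
        = \sum_s J' s *m J s.
      apply: eq_bigr => s _; rewrite -[in RHS]K' mulmx_suml.
      by apply: eq_bigr => t _; rewrite !mulmxA.
    under [X in _ - X - _]eq_bigr do rewrite mulmx1.
    rewrite opprB addrA subrK sumr_const card_ord -[4%N]/(1 + 3)%N.
    by rewrite natrD raddfD /= mulNrn opprK -raddfMn.
  rewrite A1; under eq_bigr do rewrite AJ mulmx0.
  by rewrite big1 ?subr0.
move=> /(congr1 (fun m : 'M[R]_d => m (Ordinal d0) (Ordinal d0))).
by rewrite !mxE eqxx mulr1n => /eqP; rewrite pnatr_eq0.
Qed.

(** Normalize a nonzero average: the nonzero elements of the span of
    [1, J_1, J_2, J_3] have a positive norm. *)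
Lemma unit_intertwiner : exists (c0 : R) (c : 'I_3 -> R),
  c0 ^+ 2 + \sum_s c s ^+ 2 = 1 /\
  forall t, quat J c0 c *m J t = J' t *m quat J c0 c.
Proof.
have [x qx ax] := average_neq0; have [e0 [e eE]] := in_quat_average qx.
pose N := e0 ^+ 2 + \sum_s e s ^+ 2.
have Nge0 : 0 <= N by rewrite addr_ge0 ?sqr_ge0 ?sumr_ge0 // => s _; exact: sqr_ge0.
have N0 : 0 < N.
  rewrite lt_def Nge0 andbT; apply: contra ax => /eqP N0.
  have e00 : e0 = 0.
    apply/eqP; rewrite -sqrf_eq0; move/eqP: N0.
    rewrite paddr_eq0 ?sqr_ge0 ?sumr_ge0 // => [/andP[]//|s _].
    exact: sqr_ge0.
  have es s : e s = 0.
    apply/eqP; rewrite -sqrf_eq0; move/eqP: N0.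
    rewrite paddr_eq0 ?sqr_ge0 ?sumr_ge0 // => [/andP[_]|? _]; last first.
      exact: sqr_ge0.
    by rewrite psumr_eq0 => [/allP/(_ s)|? _]; [apply; rewrite mem_index_enum|exact: sqr_ge0].
  rewrite eE /quat /imag e00 raddf0 big1 ?addr0 // => s _.
  by rewrite es scale0r.
pose k := (Num.sqrt N)^-1.
have k2 : k ^+ 2 * N = 1.
  by rewrite /k exprVn sqr_sqrtr // mulVf // gt_eqF.
exists (k * e0), (fun s => k * e s); split.
  rewrite -k2 /N mulrDr mulr_sumr exprMn; congr (_ + _).
  by apply: eq_bigr => s _; rewrite exprMn.
have -> : quat J (k * e0) (fun s => k * e s) = k *: average x.
  rewrite eE /quat scalerDr scale_scalar_mx scaler_sumr; congr (_ + _).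
  by apply: eq_bigr => s _; rewrite scalerA.
by move=> t; rewrite -scalemxAl -scalemxAr average_intertwines.
Qed.

End Intertwiner.

Section Invariance.
Context {R : realType} {d : nat} (G : 'M[R]_d) (Q : set 'M[R]_d).
Hypotheses (d0 : (0 < d)%N) (uG : G \in unitmx).
Hypothesis pG : forall v, v != 0 -> 0 < bilin G v v.

Lemma herm_orthogonal (J : 'I_3 -> 'M[R]_d) s t v :
  G^T = G -> quaternion_identities J ->
  (forall s v w, bilin G (v *m J s) (w *m J s) = bilin G v w) ->
  bilin G (v *m J s) (v *m J t) = (s == t)%:R * bilin G v v.
Proof.
move=> sG qJ hJ; have [<-|st] := eqVneq s t; first by rewrite hJ mul1r.
have := quat_anticomm s t qJ; rewrite (negPf st) mulr0 raddf0.
move/eqP; rewrite addr_eq0 => /eqP E.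
have H1 := herm_skew qJ hJ s v (v *m J t).
have H2 := herm_skew qJ hJ t (v *m J s) v.
have H3 : bilin G v (v *m J t *m J s) = bilin G (v *m J t *m J s) v.
  by rewrite -[LHS]bilin_tr sG.
have H4 : v *m J s *m J t = - (v *m J t *m J s).
  by rewrite -!mulmxA E mulmxN.
rewrite H4 bilinNl in H2.
rewrite mul0r; move: H1 H2; rewrite H3; lra.
Qed.

(** Conjugation by [P] yields another triple [J'] of hermitian structures with
    the same tensor [four_square].  Evaluating the tensor on a pair
    [v, v J'_s] expresses [J'_s] as a combination of the [J_t], because the
    vectors [v J'_t] are orthogonal.  So a unit quaternion [q] intertwines [J]
    and [J'], and [q^-1] followed by [P] commutes with the quaternions. *)
Lemma invariant_SpSp1 (J : 'I_3 -> 'M[R]_d) (P : 'M[R]_d) :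
  G^T = G -> quaternionic_basis G Q J ->
  (forall v w, bilin G (v *m P) (w *m P) = bilin G v w) ->
  (forall v w y z, four_square G J (v *m P) (w *m P) (y *m P) (z *m P)
                   = four_square G J v w y z) ->
  SpSp1 G Q P.
Proof.
move=> sG bJ iG i4; have [qJ hJ QJ] := bJ.
have uP : P \in unitmx.
  have E : P *m G *m P^T = G.
    by apply: bilin_inj => v w; rewrite -[RHS]iG bilinMl bilinMr.
  by move: uG; rewrite -{1}E !unitmx_mul => /andP[/andP[]].
pose J' s := P *m J s *m invmx P.
have PJ s : P *m J s = J' s *m P by rewrite /J' mulmxKV.
have qJ' : quaternion_identities J'.
  have mulJ' s t : J' s *m J' t = P *m (J s *m J t) *m invmx P.
    by rewrite /J' !mulmxA mulmxKV.
  case: (qJ) => q1 q2 q3 q4; rewrite /ecomp in q1 q2 q3 q4.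
  split; rewrite /ecomp.
  - by move=> s; rewrite mulJ' q1 mulmxN mulmx1 mulNmx mulmxV.
  - by rewrite mulJ' q2.
  - by rewrite mulJ' q3 mulmxN mulNmx.
  - rewrite mulJ' /J' !mulmxA mulmxKV //.
    have -> : P *m J 2%:R *m J 1 *m J 0 = P *m (J 2%:R *m J 1 *m J 0).
      by rewrite !mulmxA.
    by rewrite q4 mulmxN mulmx1 mulNmx mulmxV.
have hJ' s v w : bilin G (v *m J' s) (w *m J' s) = bilin G v w.
  by rewrite -iG /J' !mulmxA !mulmxKV // hJ iG.
have FJ' s v w : bilin (kahler_form G (J' s)) v w
    = bilin (kahler_form G (J s)) (v *m P) (w *m P).
  rewrite /kahler_form -!bilinMl -[v *m P *m J s]mulmxA PJ mulmxA.
  by rewrite iG.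
have i4' v w y z : four_square G J' v w y z = four_square G J v w y z.
  by rewrite -i4; apply: eq_bigr => s _; rewrite !FJ'.
have J'E s : exists c, J' s = imag J c.
  pose v0 : 'rV[R]_d := 'e_(Ordinal d0).
  have v00 : v0 != 0.
    apply/eqP => /(congr1 (fun v : 'rV[R]_d => v 0 (Ordinal d0))).
    by rewrite !mxE !eqxx => /eqP; rewrite oner_eq0.
  have N0 := pG v00; set N := bilin G v0 v0 in N0.
  exists (fun t => N^-1 * bilin (kahler_form G (J t)) v0 (v0 *m J' s)).
  rewrite -[LHS](mulmxK uG) -[RHS](mulmxK uG); congr (_ *m _).
  apply: bilin_inj => x y.
  have := i4' x y v0 (v0 *m J' s).
  rewrite /four_square (bigD1 s) //= big1 => [|t ts]; last first.
    rewrite /kahler_form -[in X in _ * X]bilinMl herm_orthogonal //.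
    by rewrite (negPf ts) mul0r mulr0.
  rewrite addr0 /kahler_form -[in X in _ * X]bilinMl hJ' -/N => E.
  apply: (mulIf (lt0r_neq0 N0)); rewrite E mulmx_suml bilin_sum mulr_suml.
  apply: eq_bigr => t _; rewrite -scalemxAl bilinZ.
  by field; rewrite gt_eqF.
have [c0 [c [c1 cJ]]] := unit_intertwiner d0 qJ qJ' J'E.
set q := quat J c0 c in cJ; pose q' := quat J c0 (fun s => - c s).
have qq' : q *m q' = 1%:M by rewrite quat_conj // c1.
have q'q := mulmx1C qq'.
exists J, (q' *m P), c0, c; split=> //.
- move=> v w; rewrite !mulmxA iG.
  have adj u z : bilin G u (z *m q') = bilin G (u *m q) z.
    rewrite /q /q' /quat !mulmxDr !mul_mx_scalar bilinDl bilinDr.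
    rewrite bilinZl bilinZr /imag !mulmx_sumr bilin_suml bilin_sumr.
    congr (_ + _); apply: eq_bigr => s _.
    rewrite -!scalemxAr bilinZl bilinZr (herm_skew qJ hJ); ring.
  by rewrite adj -mulmxA q'q mulmx1.
- move=> s; rewrite /ecomp -[RHS]mulmxA PJ !mulmxA; congr (_ *m _).
  transitivity (q' *m (q *m J s) *m q'); first by rewrite mulmxA q'q mul1mx.
  by rewrite cJ -!mulmxA qq' mulmx1.
- by rewrite /ecomp -/(imag J c) -/(quat J c0 c) mulmxA -/q qq' mul1mx.
Qed.

End Invariance.

(** * Parallel transport and holonomy *)
(** The local functions [f] are compared with [H] only inside [[0, 1]], because
    parallel fields are unconstrained at other times; at the end points this
    still gives one-sided continuity. *)
Lemma eq_ends (R : realType) (H : R -> R) :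
  (forall t : R, 0 <= t <= 1 -> exists f : R -> R, is_derive t 1 f 0 /\
     \forall s \near t, 0 <= s <= 1 -> H s = f s) ->
  H 0 = H 1.
Proof.
move=> loc.
have HD (t : R) : t \in `]0, 1[%R -> is_derive t 1 H 0.
  rewrite in_itv /= => /andP[t0 t1].
  have [|f [Df fH]] := loc t; first by rewrite !ltW.
  apply: near_eq_is_derive Df; near=> s; apply/esym.
  have s01 : 0 <= s <= 1.
    by apply/andP; split; apply: ltW; near: s; [exact: lt_nbhsr|exact: lt_nbhsl].
  by move: s01; near: s.
have cont (t : R) : 0 <= t <= 1 -> exists f : R -> R,
    {for t, continuous f} /\ \forall s \near t, 0 <= s <= 1 -> H s = f s.
  move=> /loc[f [[Df _] fH]]; exists f; split=> //.
  by apply: differentiable_continuous; exact/derivable1_diffP.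
have Hcont : {within `[0, 1], continuous H}.
  apply/continuous_within_itvP; first exact: ltr01.
  split.
  - move=> t /HD[Dt _]; apply: differentiable_continuous.
    exact/derivable1_diffP.
  - have [|f [fc fH]] := cont 0; first by rewrite lexx ler01.
    rewrite (_ : H 0 = f 0); last first.
      by have := nbhs_singleton fH; apply; rewrite lexx ler01.
    apply: cvg_trans (cvg_at_right_filter fc); apply: near_eq_cvg.
    near=> s; apply/esym.
    have s01 : 0 <= s <= 1.
      by apply/andP; split; apply: ltW; near: s;
        [exact: nbhs_right_gt|exact: nbhs_right_lt].
    by move: s01; near: s; apply: cvg_within; exact: fH.
  - have [|f [fc fH]] := cont 1; first by rewrite lexx ler01.
    rewrite (_ : H 1 = f 1); last first.
      by have := nbhs_singleton fH; apply; rewrite lexx ler01.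
    apply: cvg_trans (cvg_at_left_filter fc); apply: near_eq_cvg.
    near=> s; apply/esym.
    have s01 : 0 <= s <= 1.
      by apply/andP; split; apply: ltW; near: s;
        [exact: nbhs_left_gt|exact: nbhs_left_lt].
    by move: s01; near: s; apply: cvg_within; exact: fH.
have [c _] := @MVT R H (fun=> 0) 0 1 ltr01 HD Hcont.
by rewrite mul0r => /eqP; rewrite subr_eq0 => /eqP ->.
Unshelve. all: by end_near. Qed.

Section ChartTopology.
Context {R : realType} {T : topologicalType} {d : nat} (A : atlas R T d).
Hypothesis mfd : smooth_manifold A.

Lemma open_coord_image (U : set T) (i : chart A) :
  open U -> open (coord i @` (dom i `&` U)).
Proof.
move=> oU; have [_ _ /(_ i)[_ oi pK _ pc] _] := mfd.
rewrite openE => x [p [ip Up] <-]; rewrite /interior.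
have nx : nbhs (coord i p) (coord i @` dom i).
  by apply: open_nbhs_nbhs; split=> //; exists p.
have nU : nbhs (coord i p) (param i @^-1` U).
  apply: pc; first by exists p.
  by rewrite pK //; exact: open_nbhs_nbhs.
near=> y.
have [q iq qy] : (coord i @` dom i) y by near: y.
have Uq : U (param i y) by near: y.
by rewrite -qy pK // in Uq *; exists q.
Unshelve. all: by end_near. Qed.

Lemma open_carrier : open (carrier A).
Proof.
have [_ _ od _] := mfd.
have -> : carrier A = \bigcup_(i in [set: chart A]) dom i.
  by apply/seteqP; split=> [p [i ip]|p [i _ ip]]; exists i.
by apply: bigcup_open => i _; case: (od i).
Qed.

End ChartTopology.

Section ChosenBasis.
Context {R : realType} {d : nat}.

(** The quaternion space is given without a preferred basis; any choice will
    do for tensors that do not depend on it. *)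
Definition chosen_basis (G : 'M[R]_d) (Q : set 'M[R]_d) : 'I_3 -> 'M[R]_d :=
  if pselect (exists J, quaternionic_basis G Q J) is left e
  then projT1 (cid e) else fun=> 0.

Lemma chosen_basisP G Q J : quaternionic_basis G Q J ->
  quaternionic_basis G Q (chosen_basis G Q).
Proof.
move=> bJ; rewrite /chosen_basis; case: pselect => [e|[]]; last by exists J.
exact: projT2 (cid e).
Qed.

Lemma four_square_chosen G Q J v w y z : (0 < d)%N ->
  quaternionic_basis G Q J ->
  four_square G (chosen_basis G Q) v w y z = four_square G J v w y z.
Proof. by move=> d0 bJ; apply: four_square_basis (chosen_basisP bJ). Qed.

End ChosenBasis.

(** The derivative of [sum_s x_s z_s] when both triples are rotated by the
    skew matrix with entries [k b_s]. *)
Fact rotation_invariant (R : realType) (k b0 b1 b2 x0 x1 x2 z0 z1 z2 : R^o) :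
  x0 *: (k * (b2 * z1 - b1 * z2)) + z0 *: (k * (b2 * x1 - b1 * x2))
  + (x1 *: (k * (b0 * z2 - b2 * z0)) + z1 *: (k * (b0 * x2 - b2 * x0)))
  + (x2 *: (k * (b1 * z0 - b0 * z1)) + z2 *: (k * (b1 * x0 - b0 * x1))) = 0 :> R.
Proof. by rewrite /GRing.scale /=; ring. Qed.

(** The hypothesis [potentials] asks for local quaternionic frames whose
    Kaehler forms are the curvature of a connection, as in
    [nabla_kahler]. *)
Section Holonomy.
Context {R : realType} {T : topologicalType} {d : nat} (A : atlas R T d)
  (g : field A 'M[R]_d) (Q : field A (set 'M[R]_d)) (a : R).
Hypothesis d0 : (0 < d)%N.
Hypothesis mfd : smooth_manifold A.
Hypothesis riem : riemannian_metric g.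
Hypothesis potentials : forall p, carrier A p -> exists U J be,
  [/\ U p, quaternionic_frame g Q U J, forall s : 'I_3, smooth_field U (be s) &
      forall (s : 'I_3) (i : chart A) q, U q -> dom i q ->
        kahler_form (at_pt g i q) (at_pt (J s) i q)
        = 2^-1 *: dext (be s i) (coord i q)
          + a *: wedge11 (at_pt (be (s + 1)) i q)
                         (at_pt (be (s + 2%:R)) i q)].

Lemma metric_unit i p : dom i p -> at_pt g i p \in unitmx.
Proof.
by move=> ip; have [_ /(_ i p ip)[_ pos]] := riem; exact: definite_unitmx.
Qed.

Lemma is_derive_parallel (c : R -> T) (X Y : chart A -> R -> 'rV[R]_d) i t
    (B : 'rV[R]_d -> 'M[R]_d) :
  0 <= t <= 1 -> dom i (c t) -> derivable (coord i \o c) t 1 ->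
  differentiable B (coord i (c t)) ->
  parallel_along g c X -> parallel_along g c Y ->
  let u := 'D_1 (coord i \o c) t in
  let Gam := christoffel (g i) (coord i (c t)) u in
  is_derive t 1 (fun s => bilin (B (coord i (c s))) (X i s) (Y i s))
    (bilin ('D_u B (coord i (c t))) (X i t) (Y i t)
     - bilin (B (coord i (c t))) (Gam (X i t)) (Y i t)
     - bilin (B (coord i (c t))) (X i t) (Gam (Y i t))).
Proof.
move=> t01 ic dc dB pX pY u Gam.
have [_ /(_ i ic) DX] := pX t t01.
have [_ /(_ i ic) DY] := pY t t01.
have DB := is_derive_comp_curve dB (derivableP dc).
by have := is_derive_bilin DB DX DY; rewrite bilinNl bilinNr.
Qed.

(** A scalar along a curve that leaves its charts, computed at each time in
    some chart; the default value is used only where the curve is outside the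
    manifold. *)
Definition in_some_chart (c : R -> T) (h : chart A -> R -> R) t : R :=
  if pselect (exists i, dom i (c t)) is left e then h (projT1 (cid e)) t else 0.

Lemma in_some_chartE (c : R -> T) h i t :
  (forall j k, dom j (c t) -> dom k (c t) -> h j t = h k t) ->
  dom i (c t) -> in_some_chart c h t = h i t.
Proof.
move=> hE ic; rewrite /in_some_chart; case: pselect => [e|[]]; last by exists i.
exact: hE (projT2 (cid e)) ic.
Qed.

Lemma constant_along (c : R -> T) (h : chart A -> R -> R) i j :
  smooth_curve A c ->
  (forall (t : R) k l, 0 <= t <= 1 -> dom k (c t) -> dom l (c t) ->
     h k t = h l t) ->
  (forall (t : R) k, 0 <= t <= 1 -> dom k (c t) -> derivable (coord k \o c) t 1 ->
     exists f : R -> R, is_derive t 1 f 0 /\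
       \forall s \near t, 0 <= s <= 1 -> dom k (c s) -> h k s = f s) ->
  dom i (c 0) -> dom j (c 1) -> h i 0 = h j 1.
Proof.
move=> sc hE hD ic jc.
have i01 : 0 <= (0 : R) <= 1 by rewrite lexx ler01.
have i11 : 0 <= (1 : R) <= 1 by rewrite lexx ler01.
rewrite -(@in_some_chartE c h i 0) // => [|k l]; last exact: hE.
rewrite -(@in_some_chartE c h j 1) // => [|k l]; last exact: hE.
apply: eq_ends => t t01.
have [k [W [oW Wt kW sW]]] := sc t t01.
have [f [Df fE]] := hD t k t01 (kW _ Wt) (smooth_derivable sW Wt).
exists f; split=> //; near=> s => s01.
have ks : dom k (c s) by apply: kW; near: s; exact: open_nbhs_nbhs.
rewrite (@in_some_chartE _ _ k) //; last by move=> *; exact: hE.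
by move: s01 ks; near: s.
Unshelve. all: by end_near. Qed.

Lemma parallel_metric (c : R -> T) (X Y : chart A -> R -> 'rV[R]_d) i j :
  smooth_curve A c -> parallel_along g c X -> parallel_along g c Y ->
  dom i (c 0) -> dom j (c 1) ->
  bilin (at_pt g i (c 0)) (X i 0) (Y i 0)
  = bilin (at_pt g j (c 1)) (X j 1) (Y j 1).
Proof.
move=> sc pX pY; have [[sg gE] gP] := riem.
apply: (@constant_along c
  (fun i t => bilin (at_pt g i (c t)) (X i t) (Y i t)) i j) => //.
  move=> t k l t01 kc lc; have [XE _] := pX t t01; have [YE _] := pY t t01.
  rewrite (XE _ _ kc lc) (YE _ _ kc lc) bilinMl bilinMr -gE //.
  by exists k.
move=> t k t01 kc dc; have kcC : carrier A (c t) by exists k.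
pose O := coord k @` (dom k `&` carrier A).
have Ot : O (coord k (c t)) by exists (c t).
have oC := open_carrier mfd.
have oO : open O by exact: open_coord_image.
have symO y : O y -> (g k y)^T = g k y.
  by move=> [p [kp _] <-]; have [] := gP _ _ kp.
have uO y : O y -> g k y \in unitmx.
  by move=> [p [kp _] <-]; exact: metric_unit.
exists (fun s => bilin (at_pt g k (c s)) (X k s) (Y k s)); split; last first.
  by near=> s.
have /= := is_derive_parallel t01 kc dc
  (smooth_differentiable (sg k) Ot) pX pY.
rewrite (christoffel_metric oO (sg k) symO uO Ot).
by rewrite addrAC addrK subrr.
Unshelve. all: by end_near. Qed.

(** The covariant derivative rotates the triple of the Kaehler forms by a skew
    matrix, so the sum of their squares is constant. *)
Lemma parallel_four_square (c : R -> T) (X Y Z W : chart A -> R -> 'rV[R]_d)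
    i j :
  smooth_curve A c -> parallel_along g c X -> parallel_along g c Y ->
  parallel_along g c Z -> parallel_along g c W ->
  dom i (c 0) -> dom j (c 1) ->
  let th i t := four_square (at_pt g i (c t))
    (chosen_basis (at_pt g i (c t)) (at_pt Q i (c t)))
    (X i t) (Y i t) (Z i t) (W i t) in
  th i 0 = th j 1.
Proof.
move=> sc pX pY pZ pW ic jc th; have [[sg gE] gP] := riem.
apply: (@constant_along c th i j) => //.
  move=> t k l t01 kc lc; have kcC : carrier A (c t) by exists k.
  have [XE _] := pX t t01; have [YE _] := pY t t01.
  have [ZE _] := pZ t t01; have [WE _] := pW t t01.
  have [U [J [be [Up [_ eJ bJ] _ _]]]] := potentials kcC.
  rewrite /th !(four_square_chosen _ _ _ _ _ (bJ _ _ Up _)) //.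
  apply: eq_bigr => s _; rewrite /kahler_form.
  have FE : at_pt (J s) k (c t) *m at_pt g k (c t) =
      jac k l (c t) *m (at_pt (J s) l (c t) *m at_pt g l (c t))
      *m (jac k l (c t))^T.
    by rewrite (gE k l) // !mulmxA (proj2 (eJ s) k l).
  rewrite FE (XE _ _ kc lc) (YE _ _ kc lc) (ZE _ _ kc lc) (WE _ _ kc lc).
  by rewrite !bilinMl !bilinMr.
move=> t k t01 kc dc; have kcC : carrier A (c t) by exists k.
have [U [J [be [Up [oU eJ bJ] sbe curv]]]] := potentials kcC.
pose O := coord k @` (dom k `&` U).
have Ot : O (coord k (c t)) by exists (c t).
have oO : open O by exact: open_coord_image.
have symO y : O y -> (g k y)^T = g k y.
  by move=> [p [kp _] <-]; have [] := gP _ _ kp.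
have uO y : O y -> g k y \in unitmx.
  by move=> [p [kp _] <-]; exact: metric_unit.
have sgO : smooth O (g k).
  apply: sub_smooth (sg k) => _ [p [kp _] <-]; exists p => //; split=> //.
  by exists k.
have sJ s : smooth O (J s k) by exact: (proj1 (eJ s)).
have qJ y : O y -> quaternion_identities (fun s => J s k y).
  by move=> [p [kp Up'] <-]; have [] := bJ _ _ Up' kp.
have hJ y : O y -> forall s v w, bilin (g k y) (v *m J s k y) (w *m J s k y)
    = bilin (g k y) v w.
  by move=> [p [kp Up'] <-]; have [] := bJ _ _ Up' kp.
have cJ s y : O y -> kahler_form (g k y) (J s k y) =
    2^-1 *: dext (be s k) y + a *: wedge11 (be (s + 1) k y) (be (s + 2%:R) k y).
  by move=> [p [kp Up'] <-]; exact: curv.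
pose F s y := kahler_form (g k y) (J s k y).
exists (fun s => \sum_r bilin (F r (coord k (c s))) (X k s) (Y k s)
                     * bilin (F r (coord k (c s))) (Z k s) (W k s)).
split; last first.
  have cc : {for t, continuous (coord k \o c)}.
    by apply: differentiable_continuous; exact/derivable1_diffP.
  near=> s => s01 ks.
  have : O (coord k (c s)).
    by near: s; apply: cc; exact: open_nbhs_nbhs.
  move=> [p [kp Up'] E].
  have pE : p = c s.
    have [_ _ /(_ k)[_ _ pK _ _] _] := mfd.
    by rewrite -(pK p kp) E pK.
  by rewrite pE in Up'; rewrite /th (four_square_chosen _ _ _ _ _ (bJ _ _ Up' ks)).
have dF r : differentiable (F r) (coord k (c t)).
  by apply: (@smooth_differentiable _ _ _ O) => //; exact: smooth_mulmx.
set u := 'D_1 (coord k \o c) t.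
pose b r := pairing (be r k) u (coord k (c t)).
pose FX r (X' Y' : chart A -> R -> 'rV[R]_d) s :=
  bilin (F r (coord k (c s))) (X' k s) (Y' k s).
have DF r X' Y' : parallel_along g c X' -> parallel_along g c Y' ->
    is_derive t 1 (FX r X' Y')
      (2 * a * (b (r + 2%:R) * FX (r + 1) X' Y' t
                - b (r + 1) * FX (r + 2%:R) X' Y' t)).
  move=> pX' pY'; apply: is_derive_eq.
    exact: is_derive_parallel t01 kc dc (dF r) pX' pY'.
  exact: (@nabla_kahler R d O (g k) (fun s => J s k) (fun s => be s k) a oO
    sgO symO uO sJ qJ hJ (fun s => sbe s k) cJ _ Ot r u (X' k t) (Y' k t)).
have D := is_derive_sum
  (fun r => is_deriveM (DF r X Y pX pY) (DF r Z W pZ pW)).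
move: D; set f := (X in is_derive _ _ X _).
have -> : f = (fun s => \sum_r FX r X Y s * FX r Z W s).
  by apply/funext => s; rewrite /f fct_sumE.
move/is_derive_eq; apply; rewrite (sum_ord3 _ 0) !ord3E.
exact: rotation_invariant.
Unshelve. all: by end_near. Qed.

(** Both invariants pass through a concatenation of transports; along a smooth
    curve each value of them is carried by the parallel fields that extend its
    arguments. *)
Lemma transport_invariant i p j q P : parallel_transport g i p j q P ->
  (forall v w, bilin (at_pt g j q) (v *m P) (w *m P)
               = bilin (at_pt g i p) v w) /\
  (forall v w y z,
     four_square (at_pt g j q) (chosen_basis (at_pt g j q) (at_pt Q j q))
       (v *m P) (w *m P) (y *m P) (z *m P)
     = four_square (at_pt g i p) (chosen_basis (at_pt g i p) (at_pt Q i p))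
       v w y z).
Proof.
elim=> [c {}i {}j {}P sc ic jc XP|{}i {}p {}j {}q k r {}P P' _ [g1 f1] _ [g2 f2]].
  split=> [v w|v w y z].
    have [[X [pX <- <-]] [Y [pY <- <-]]] := (XP v, XP w).
    by rewrite (parallel_metric sc pX pY ic jc).
  have [[X [pX <- <-]] [Y [pY <- <-]]] := (XP v, XP w).
  have [[Z [pZ <- <-]] [W [pW <- <-]]] := (XP y, XP z).
  by have := parallel_four_square sc pX pY pZ pW ic jc.
split=> [v w|v w y z]; rewrite /ecomp !mulmxA; first by rewrite g2 g1.
by rewrite f2 f1.
Qed.

Lemma holonomy_SpSp1 i p : dom i p ->
  holonomy g i p `<=` SpSp1 (at_pt g i p) (at_pt Q i p).
Proof.
move=> ip P /transport_invariant[gP fP].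
have [_ /(_ i p ip)[sym pos]] := riem.
have [|U [J [be [Up [_ _ bJ] _ _]]]] := potentials (p := p); first by exists i.
exact: (invariant_SpSp1 d0 (metric_unit ip) pos sym
          (chosen_basisP (bJ _ _ Up ip)) gP fP).
Qed.

End Holonomy.

(** * The cylinder as a manifold *)
Section ProductTopology.

Lemma hausdorff_prod (T U : topologicalType) :
  hausdorff_space T -> hausdorff_space U -> hausdorff_space (T * U)%type.
Proof.
move=> hT hU [x u] [y v] cl; congr pair.
  apply: hT => A B xA yB.
  have [||[z w] [[Az _] [Bz _]]] := cl (A `*` setT) (B `*` setT); last by exists z.
    by exists (A, setT) => //=; split=> //; exact: filterT.
  by exists (B, setT) => //=; split=> //; exact: filterT.
apply: hU => A B uA vB.
have [||[z w] [[_ Aw] [_ Bw]]] := cl (setT `*` A) (setT `*` B);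
  last by exists w.
  by exists (setT, A) => //=; split=> //; exact: filterT.
by exists (setT, B) => //=; split=> //; exact: filterT.
Qed.

Lemma second_countable_prod (T U : topologicalType) :
  @second_countable T -> @second_countable U ->
  @second_countable (T * U)%type.
Proof.
move=> [B cB [oB bB]] [C cC [oC bC]].
exists ((fun p : set T * set U => p.1 `*` p.2) @` (B `*` C)).
  by apply: sub_countable (card_image_le _ _) _; exact: countableX.
split=> [_ [[V W] [/= BV CW] <-]|[x u] A [[V W] /= [xV uW] VWA]].
  rewrite openE => -[x u] [/= Vx Wu]; exists (V, W) => //=.
  by split; apply: open_nbhs_nbhs; split=> //; [exact: oB|exact: oC].
have [V' [BV' V'x] sV] := bB x _ xV; have [W' [CW' W'u] sW] := bC u _ uW.
exists (V' `*` W'); first by split=> //; exists (V', W').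
by move=> [y v] [/= /sV Vy /sW Wv]; exact: VWA.
Qed.

Lemma second_countable_real (R : realType) : @second_countable R.
Proof.
pose I (q : rat * rat) : set R := `](ratr q.1), (ratr q.2)[%classic.
exists (range I); first by apply: sub_countable (card_image_le _ _) _; exact: countableP.
split=> [_ [q _ <-]|x A /nbhs_ballP[e /= e0 eA]]; first exact: interval_open.
have /rat_in_itvoo[q /itvP qx] : x - e < x by rewrite gtrBl.
have /rat_in_itvoo[r /itvP rx] : x < x + e by rewrite ltrDl.
exists (I (q, r)).
  by split; [exists (q, r)|rewrite /I /= in_itv /= qx rx].
move=> y; rewrite /I /= in_itv /= => /andP[qy yr]; apply: eA.
rewrite /ball /= distrC ltr_distl (lt_trans _ qy) ?qx //=.
by rewrite (lt_trans yr) ?rx.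
Qed.

End ProductTopology.

Section RowMx.
Context {R : realType} {d : nat}.

Definition height (y : 'rV[R]_(1 + d)) : R := lsubmx y 0 0.

Lemma heightE u (x : 'rV[R]_d) : height (row_mx u%:M x) = u.
Proof. by rewrite /height row_mxKl mxE eqxx mulr1n. Qed.

Lemma row_mx_height y : row_mx (height y)%:M (rsubmx y) = y.
Proof. by rewrite /height -mx11_scalar hsubmxK. Qed.

Lemma height_continuous : continuous height.
Proof.
rewrite (_ : height = (fun M : 'M[R]_1 => M 0 0) \o lsubmx) //.
by move=> y; apply: continuous_comp;
  [exact: continuous_lsubmx|exact: coord_continuous].
Qed.

Lemma row_mx_continuous (T : topologicalType) (f : T -> R) (h : T -> 'rV[R]_d)
    (p : T) :
  {for p, continuous f} -> {for p, continuous h} ->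
  {for p, continuous (fun q => row_mx (f q)%:M (h q) : 'rV[R]_(1 + d))}.
Proof.
move=> fc hc; apply/cvg_ballP => e e0.
have nf : \forall q \near p, ball (f p) e (f q) by move/cvg_ballP: fc; apply.
have nh : \forall q \near p, ball (h p) e (h q) by move/cvg_ballP: hc; apply.
near=> q; split=> // i j; rewrite !ord1 !mxE; case: splitP => k jk.
  by rewrite !ord1 !mxE eqxx !mulr1n; near: q.
have [_ hq] : ball (h p) e (h q) by near: q.
exact: hq.
Unshelve. all: by end_near. Qed.

Lemma smooth_height (U : set 'rV[R]_(1 + d)) : open U -> smooth U height.
Proof.
move=> oU; apply: (@eq_smooth _ _ _ _ (fun y : 'rV[R]_(1 + d) => y 0 (lshift d 0))) => //.
  by move=> y _; rewrite /height mxE.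
by apply: smooth_entry => //; exact: smooth_id.
Qed.

Lemma smooth_rsubmx (W : normedModType R) (O : set 'rV[R]_d)
    (U : set 'rV[R]_(1 + d)) (f : 'rV[R]_d -> W) :
  open U -> (forall y, U y -> O (rsubmx y)) -> smooth O f ->
  smooth U (fun y => f (rsubmx y)).
Proof.
move=> oU UO sf.
exact: (smooth_precomp (@continuous_rsubmx R 1 1 d) UO oU sf).
Qed.

Lemma smooth_row_mx (U : set 'rV[R]_(1 + d)) (f : 'rV[R]_(1 + d) -> R)
    (h : 'rV[R]_(1 + d) -> 'rV[R]_d) :
  open U -> smooth U f -> smooth U h ->
  smooth U (fun y => row_mx (f y)%:M (h y) : 'rV[R]_(1 + d)).
Proof.
move=> oU sf sh; apply: smooth_mx => // i j; rewrite !ord1.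
case: (split_ordP j) => k ->.
  apply: (@eq_smooth _ _ _ _ f) => // y _.
  by rewrite row_mxEl ord1 mxE eqxx mulr1n.
apply: (@eq_smooth _ _ _ _ (fun y => h y 0 k)) => [//|y _|].
  by rewrite row_mxEr.
exact: smooth_entry.
Qed.

End RowMx.

Section CylinderManifold.
Context {R : realType} {M : topologicalType} {d : nat} (A : atlas R M d)
  (Om : set R).
Hypotheses (mfd : smooth_manifold A) (oOm : open Om).
Notation N := (cylinder A Om).

Definition cyl_image (i : chart A) (U : set M) : set 'rV[R]_(1 + d) :=
  [set y | (coord i @` (dom i `&` U)) (rsubmx y) /\ Om (height y)].

Lemma open_cyl_image i U : open U -> open (cyl_image i U).
Proof.
move=> oU; apply: openI.
  apply: open_comp => [y _|]; first exact: continuous_rsubmx.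
  exact: open_coord_image.
by apply: open_comp => // y _; exact: height_continuous.
Qed.

Lemma coord_cylinder (i : chart N) p u :
  coord i (p, u) = row_mx u%:M (coord (i : chart A) p).
Proof. by []. Qed.

Lemma sub_cyl_image (i : chart N) (U : set M) (U' : set (M * R)) :
  (forall q, dom i q -> U' q -> U q.1) ->
  coord i @` (dom i `&` U') `<=` cyl_image i U.
Proof.
move=> UU' _ [[p u] [[/= ip uO] Uq] <-].
split; last by rewrite heightE.
rewrite row_mxKr; exists p => //; split=> //.
by apply: (UU' (p, u)).
Qed.

Lemma smooth_cylinder : smooth_manifold N.
Proof.
have [hM cM pt tr] := mfd; split.
- by apply: hausdorff_prod => //; exact: Rhausdorff.
- by apply: second_countable_prod => //; exact: second_countable_real.
- move=> i; have [oi oi' pK cc pc] := pt i.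
  split.
  + rewrite /dom /=; apply: openI.
      by apply: open_comp => // q _; exact: cvg_fst.
    by apply: open_comp => // q _; exact: cvg_snd.
  + rewrite (_ : _ @` _ = cyl_image i setT); first exact: open_cyl_image openT.
    apply/seteqP; split=> [|y [[p [ip _] py] uy]].
      by rewrite -[dom i in X in X `<=` _]setIT; exact: sub_cyl_image.
    exists (p, height y) => //.
    by rewrite coord_cylinder py row_mx_height.
  + move=> [p u] [/= ip uO]; rewrite row_mxKr pK //.
    by rewrite -/(height _) heightE.
  + move=> [p u] [/= ip uO]; apply: (@row_mx_continuous _ _ _ snd
      (fun q : M * R => coord (i : chart A) q.1)); first exact: cvg_snd.
    by apply: (@continuous_comp _ _ _ fst (coord (i : chart A)));
      [exact: cvg_fst|exact: cc].
  + move=> _ [[p u] [/= ip uO] <-]; set y := row_mx _ _.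
    have c1 : {for y, continuous (param (i : chart A) \o rsubmx)}.
      apply: (@continuous_comp _ _ _ rsubmx (param (i : chart A))).
        exact: continuous_rsubmx.
      by rewrite row_mxKr; apply: pc; exists p.
    have c2 : {for y, continuous height} by exact: height_continuous.
    exact: cvg_pair c1 c2.
- move=> i j; have [oj _ _ _ _] := pt j.
  apply: (@sub_smooth _ _ _ (cyl_image i (dom (j : chart A)))).
    by apply: sub_cyl_image => -[p u] _ [].
  apply: smooth_row_mx; first exact: open_cyl_image.
    exact/smooth_height/open_cyl_image.
  apply: smooth_rsubmx (tr i j); first exact: open_cyl_image.
  by move=> y [].
Qed.

(** In charts the change of coordinates is the identity on the height. *)
Lemma jac_cylinder (i j : chart N) (p : M) (u : R) :
  dom (i : chart A) p -> dom (j : chart A) p -> Om u ->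
  jac i j (p, u) = block_mx 1%:M 0 0 (jac (i : chart A) (j : chart A) p).
Proof.
move=> ip jp uO; have [_ _ pt tr] := mfd.
set phi := coord (j : chart A) \o param (i : chart A).
have dphi : differentiable phi (coord (i : chart A) p).
  by apply: (smooth_differentiable (tr i j)); exists p.
pose Y : 'rV[R]_(1 + d) := row_mx u%:M (coord (i : chart A) p).
have YE : rsubmx Y = coord (i : chart A) p by rewrite /Y row_mxKr.
pose f (y : 'rV[R]_(1 + d)) : 'rV[R]_(1 + d) :=
  row_mx (height y)%:M (phi (rsubmx y)).
have Df v : is_derive Y v f
    (row_mx (lsubmx v) ('D_(rsubmx v) phi (rsubmx Y))).
  apply/is_derive_mxP => k l; rewrite !ord1; case: (split_ordP l) => m ->.
    rewrite row_mxEl mxE ord1.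
    rewrite (_ : (fun y => _) = (fun y : 'rV[R]_(1 + d) => y 0 (lshift d 0))).
      by have /is_derive_mxP := is_derive_id Y v.
    by apply/funext => y; rewrite /f row_mxEl mxE eqxx mulr1n /height mxE.
  rewrite row_mxEr.
  rewrite (_ : (fun y => _) = (fun y => phi (rsubmx y) 0 m)); last first.
    by apply/funext => y; rewrite /f row_mxEr.
  have dr : differentiable (rsubmx : 'rV[R]_(1 + d) -> 'rV[R]_d) Y.
    exact: differentiable_rsubmx.
  rewrite -YE in dphi; have dc := differentiable_comp dr dphi.
  have D : is_derive Y v (phi \o rsubmx) ('D_(rsubmx v) phi (rsubmx Y)).
    apply: DeriveDef; first exact: diff_derivable.
    rewrite !deriveE // (diff_comp dr dphi) /=.
    have cr := @continuous_rsubmx R 1 1 d.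
    by rewrite (diff_lin Y cr).
  by have /is_derive_mxP := D.
have df : differentiable f Y.
  have [_ _ _ /(_ i j) sf] := smooth_cylinder.
  by apply: (smooth_differentiable sf); exists (p, u).
have dphi' : differentiable phi (rsubmx Y) by rewrite YE.
apply/row_matrixP => k; rewrite !rowE /jac -deriveEjacobian //.
have [_ ->] := Df 'e_k; rewrite deriveEjacobian // YE.
rewrite -[in RHS](hsubmxK ('e_k : 'rV[R]_(1 + d))) mul_row_block.
by rewrite mulmx1 !mulmx0 addr0 add0r.
Qed.

End CylinderManifold.

(** * The quaternionic structure at a point *)
Section FourByFour.
Context {R : realType}.

(** The matrices of the left multiplications by i, j, k in the basis
    1, i, j, k, acting on row vectors. *)
Definition quat4 (s : 'I_3) : 'M[R]_4 :=
  \matrix_(p, q) nth 0 (nth [::] (nth [::]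
   [:: [:: [:: 0; 1; 0; 0]; [:: - 1; 0; 0; 0]; [:: 0; 0; 0; 1]; [:: 0; 0; - 1; 0]];
       [:: [:: 0; 0; 1; 0]; [:: 0; 0; 0; - 1]; [:: - 1; 0; 0; 0]; [:: 0; 1; 0; 0]];
       [:: [:: 0; 0; 0; 1]; [:: 0; 0; 1; 0]; [:: 0; - 1; 0; 0]; [:: - 1; 0; 0; 0]]]
   s) p) q.

Ltac by_entries :=
  apply/matrixP => -[[|[|[|[|//]]]] ?] [[|[|[|[|//]]]] ?];
  rewrite !mxE ?big_ord_recl ?big_ord0 ?mxE /=; ring.

Lemma quat4_sq s : quat4 s *m quat4 s = - 1%:M.
Proof. by elim/ord3_ind: s; by_entries. Qed.

Lemma quat4_10 : quat4 1 *m quat4 0 = quat4 2%:R.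
Proof. by by_entries. Qed.

Lemma quat4_01 : quat4 0 *m quat4 1 = - quat4 2%:R.
Proof. by by_entries. Qed.

Lemma quat4_tr s : (quat4 s)^T = - quat4 s.
Proof. by elim/ord3_ind: s; by_entries. Qed.

End FourByFour.

(** The orthogonal sum of a space with form [u g], on which the quaternions act
    by [L], and of a four-dimensional one with orthonormal coframe [Th] and
    dual frame [E], on which they act by [quat4]. *)
Section QuaternionicSum.
Context {R : realType} {d : nat} (L : 'I_3 -> 'M[R]_d) (g : 'M[R]_d)
  (Th : 'M[R]_(d, 4)) (E : 'M[R]_(4, d)) (u : R).
Hypotheses (ETh : E *m Th = 1%:M) (EL : forall s, E *m L s = 0)
  (LTh : forall s, L s *m Th = 0).
Hypothesis L2 : forall s, L s *m L s = Th *m E - 1%:M.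
Hypotheses (L10 : L 1 *m L 0 = L 2%:R) (L01 : L 0 *m L 1 = - L 2%:R).
Hypotheses (Eg : E *m g = 0) (gE : g *m E^T = 0).
Hypothesis hL : forall s, L s *m g *m (L s)^T = g.

Definition sumJ s : 'M[R]_d := L s + Th *m quat4 s *m E.
Definition sumG : 'M[R]_d := u *: g + Th *m Th^T.

Let sumJM s t : sumJ s *m sumJ t = L s *m L t + Th *m (quat4 s *m quat4 t) *m E.
Proof.
rewrite /sumJ mulmxDl !mulmxDr !mulmxA LTh !mul0mx addr0.
rewrite -[_ *m E *m L t]mulmxA EL mulmx0 add0r.
by rewrite -[_ *m E *m Th]mulmxA ETh mulmx1.
Qed.

Lemma sumJ_identities : quaternion_identities sumJ.
Proof.
have sq s : sumJ s *m sumJ s = - 1%:M.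
  by rewrite sumJM L2 quat4_sq mulmxN mulmx1 mulNmx addrAC subrr add0r.
have J10 : sumJ 1 *m sumJ 0 = sumJ 2%:R by rewrite sumJM L10 quat4_10.
have J01 : sumJ 0 *m sumJ 1 = - sumJ 2%:R.
  by rewrite sumJM L01 quat4_01 mulmxN mulNmx -opprD.
split; rewrite /ecomp //.
by rewrite -mulmxA J10 sq.
Qed.

Lemma sumJ_kahler s :
  kahler_form sumG (sumJ s) = u *: (L s *m g) + Th *m quat4 s *m Th^T.
Proof.
rewrite /kahler_form /sumG /sumJ mulmxDl !mulmxDr -!scalemxAr.
rewrite !mulmxA LTh mul0mx addr0 -[_ *m E *m g]mulmxA Eg mulmx0 scaler0 add0r.
by rewrite -[_ *m E *m Th]mulmxA ETh mulmx1.
Qed.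

Lemma sumJ_hermitian s v w :
  bilin sumG (v *m sumJ s) (w *m sumJ s) = bilin sumG v w.
Proof.
rewrite bilinMl bilinMr -/(kahler_form sumG (sumJ s)) sumJ_kahler.
congr (bilin _ v w); rewrite /sumJ linearD /= !trmx_mul mulmxDl !mulmxDr.
rewrite -!scalemxAl hL !mulmxA.
have gE0 : L s *m g *m E^T = 0 by rewrite -mulmxA gE mulmx0.
have LTh0 : Th^T *m (L s)^T = 0 by rewrite -trmx_mul LTh trmx0.
have EE : Th^T *m E^T = 1%:M by rewrite -trmx_mul ETh trmx1.
rewrite gE0 !mul0mx scaler0 addr0 -[_ *m Th^T *m (L s)^T]mulmxA LTh0 mulmx0.
rewrite add0r -[_ *m Th^T *m E^T]mulmxA EE mulmx1 quat4_tr mulmxN.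
by rewrite -[_ *m quat4 s *m quat4 s]mulmxA quat4_sq mulmxN mulmx1 opprK.
Qed.

End QuaternionicSum.

Section Coframe.
Context {R : realType} {m : nat}.
Implicit Types (x : 'cV[R]_m) (y : 'I_3 -> 'cV[R]_m)
  (e : 'rV[R]_m) (z : 'I_3 -> 'rV[R]_m).

Definition cols x y : 'M[R]_(m, 4) :=
  \matrix_(p, q) nth 0 [:: x; y 0; y 1; y 2%:R] q p 0.
Definition rows e z : 'M[R]_(4, m) :=
  \matrix_(q, p) nth 0 [:: e; z 0; z 1; z 2%:R] q 0 p.

Lemma cols_quat4 x y s :
  cols x y *m quat4 s *m (cols x y)^T
  = wedge11 (y (s + 1)) (y (s + 2%:R)) - wedge11 (y s) x.
Proof.
by elim/ord3_ind: s; rewrite !ord3E; apply/matrixP => p q;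
  rewrite !mxE !big_ord_recl !big_ord0 !mxE !big_ord_recl !big_ord0 !mxE /=; ring.
Qed.

Lemma cols_sq x y :
  cols x y *m (cols x y)^T = \sum_s sqcov (y s) + sqcov x.
Proof.
rewrite (sum_ord3 _ 0) !ord3E; apply/matrixP => p q.
by rewrite !mxE !big_ord_recl !big_ord0 !mxE /=; ring.
Qed.

Lemma cols_rows x y e z :
  cols x y *m rows e z = x *m e + \sum_s y s *m z s.
Proof.
rewrite (sum_ord3 _ 0) !ord3E; apply/matrixP => p q.
by rewrite !mxE !big_ord_recl !big_ord0 !mxE /=; ring.
Qed.

Lemma rows_mul e z n (B : 'M[R]_(m, n)) :
  e *m B = 0 -> (forall s, z s *m B = 0) -> rows e z *m B = 0.
Proof.
move=> e0B zB; apply/row_matrixP => q; rewrite row0 row_mul.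
have -> : row q (rows e z) = nth 0 [:: e; z 0; z 1; z 2%:R] q.
  by apply/rowP => p; rewrite !mxE.
by case: q => -[|[|[|[|//]]]] i /=.
Qed.

Lemma mul_cols x y n (B : 'M[R]_(n, m)) :
  B *m x = 0 -> (forall s, B *m y s = 0) -> B *m cols x y = 0.
Proof.
move=> Bx0 By; apply/trmx_inj/row_matrixP => q; rewrite -tr_col colE -mulmxA -colE trmx0 row0.
have -> : col q (cols x y) = nth 0 [:: x; y 0; y 1; y 2%:R] q.
  by apply/colP => p; rewrite !mxE.
by case: q => -[|[|[|[|//]]]] i /=; rewrite ?Bx0 ?By trmx0.
Qed.

Lemma rows_cols x y e z :
  e *m x = 1%:M -> (forall s, e *m y s = 0) -> (forall s, z s *m x = 0) ->
  (forall s t, z s *m y t = (s == t)%:R%:M) ->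
  rows e z *m cols x y = 1%:M.
Proof.
move=> ex0 e0y zx0 zy; apply/matrixP => p q.
have -> : (rows e z *m cols x y) p q =
    (nth 0 [:: e; z 0; z 1; z 2%:R] p *m nth 0 [:: x; y 0; y 1; y 2%:R] q) 0 0.
  by rewrite !mxE; apply: eq_bigr => k _; rewrite !mxE.
by case: p => -[|[|[|[|//]]]] ip; case: q => -[|[|[|[|//]]]] iq /=;
  rewrite ?ex0 ?e0y ?zx0 ?zy !mxE.
Qed.

Lemma sqcovZ c (al : 'cV[R]_m) : sqcov (c *: al) = (c * c) *: sqcov al.
Proof. by rewrite /sqcov linearZ /= -scalemxAl -scalemxAr scalerA. Qed.

Lemma wedge11Z c c' (al be : 'cV[R]_m) :
  wedge11 (c *: al) (c' *: be) = (c * c') *: wedge11 al be.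
Proof.
apply/matrixP => p q.
by rewrite !mxE !big_ord_recl !big_ord0 !mxE; ring.
Qed.

End Coframe.

Section Lift.
Context {R : realType} {d : nat}.

Definition dual_du : 'rV[R]_(1 + d) := row_mx 1%:M 0.
Definition liftv (v : 'rV[R]_d) : 'rV[R]_(1 + d) := row_mx 0 v.

Lemma lift2_mul (B C : 'M[R]_d) : lift2 B *m lift2 C = lift2 (B *m C).
Proof. by rewrite /lift2 mulmx_block !(mul0mx, mulmx0, addr0, add0r). Qed.
Lemma lift2N (B : 'M[R]_d) : lift2 (- B) = - lift2 B.
Proof. by rewrite /lift2 opp_block_mx !oppr0. Qed.
Lemma lift2D (B C : 'M[R]_d) : lift2 (B + C) = lift2 B + lift2 C.
Proof. by rewrite /lift2 add_block_mx !addr0. Qed.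
Lemma lift2_sum (F : 'I_3 -> 'M[R]_d) : lift2 (\sum_s F s) = \sum_s lift2 (F s).
Proof. by rewrite !(sum_ord3 _ 0) !lift2D. Qed.
Lemma lift2_tr (B : 'M[R]_d) : (lift2 B)^T = lift2 B^T.
Proof. by rewrite /lift2 tr_block_mx !trmx0. Qed.
Lemma lift2_lift1 (B : 'M[R]_d) al : lift2 B *m lift1 al = lift1 (B *m al).
Proof. by rewrite /lift2 /lift1 mul_block_col !(mul0mx, mulmx0, addr0, add0r). Qed.
Lemma lift2_du (B : 'M[R]_d) : lift2 B *m du R d = 0.
Proof.
by rewrite /lift2 /du mul_block_col !(mul0mx, mulmx0, addr0, add0r) col_mx0.
Qed.
Lemma dual_du_lift2 (B : 'M[R]_d) : dual_du *m lift2 B = 0.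
Proof.
by rewrite /lift2 /dual_du mul_row_block !(mul0mx, mulmx0, addr0, add0r) row_mx0.
Qed.
Lemma liftv_lift2 v (B : 'M[R]_d) : liftv v *m lift2 B = liftv (v *m B).
Proof. by rewrite /lift2 /liftv mul_row_block !(mul0mx, mulmx0, addr0, add0r). Qed.
Lemma dual_du_du : dual_du *m du R d = 1%:M.
Proof. by rewrite /du /dual_du mul_row_col !(mul0mx, mulmx0, addr0, add0r) mulmx1. Qed.
Lemma dual_du_lift1 al : dual_du *m lift1 al = 0.
Proof. by rewrite /lift1 /dual_du mul_row_col !(mul0mx, mulmx0, addr0, add0r). Qed.
Lemma liftv_du v : liftv v *m du R d = 0.
Proof. by rewrite /liftv /du mul_row_col !(mul0mx, mulmx0, addr0, add0r). Qed.
Lemma liftv_lift1 v (al : 'cV[R]_d) : liftv v *m lift1 al = v *m al.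
Proof. by rewrite /liftv /lift1 mul_row_col !(mul0mx, mulmx0, addr0, add0r). Qed.
Lemma lift1_liftv (al : 'cV[R]_d) (v : 'rV[R]_d) :
  lift1 al *m liftv v = lift2 (al *m v).
Proof. by rewrite /lift1 /liftv mul_col_row !(mul0mx, mulmx0, addr0, add0r). Qed.
Lemma du_dual_du : du R d *m dual_du + lift2 1%:M = 1%:M.
Proof.
rewrite /du /dual_du mul_col_row mulmx1 mul0mx !mulmx0 /lift2 add_block_mx !addr0.
by rewrite add0r -scalar_mx_block.
Qed.
Lemma sqcov_lift1 (al : 'cV[R]_d) : sqcov (lift1 al) = lift2 (sqcov al).
Proof.
by rewrite /sqcov /lift1 tr_col_mx trmx0 mul_col_row !(mul0mx, mulmx0, addr0, add0r).
Qed.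
Lemma bilin_lift2 (B : 'M[R]_d) v w :
  bilin (lift2 B) v w = bilin B (rsubmx v) (rsubmx w).
Proof.
rewrite /bilin /lift2 -[v in LHS]hsubmxK -[w in LHS]hsubmxK.
rewrite mul_row_block !mulmx0 !addr0 add0r tr_row_mx mul_row_col.
by rewrite !(mul0mx, mulmx0, addr0, add0r).
Qed.
Lemma mul_du (v : 'rV[R]_(1 + d)) : v *m du R d = lsubmx v.
Proof. by rewrite -[v in LHS]hsubmxK /du mul_row_col !(mul0mx, mulmx0, addr0, add0r) mulmx1. Qed.
Lemma mul_lift1 (v : 'rV[R]_(1 + d)) al : v *m lift1 al = rsubmx v *m al.
Proof. by rewrite -[v in LHS]hsubmxK /lift1 mul_row_col !(mul0mx, mulmx0, addr0, add0r). Qed.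

End Lift.

(** An adapted frame at one point: the vectors [xi s] are dual to the [eta s]
    and span [V]. *)
Section Adapted.
Context {R : realType} {d : nat} (g gH : 'M[R]_d) (H V : set 'rV[R]_d)
  (eta : 'I_3 -> 'cV[R]_d) (I : 'I_3 -> 'M[R]_d) (xi : 'I_3 -> 'rV[R]_d).
Hypothesis sg : g^T = g.
Hypothesis pg : forall v, v != 0 -> 0 < bilin g v v.
Hypothesis gHH : forall v w, H v -> H w -> bilin gH v w = bilin g v w.
Hypothesis gHV : forall v w, V v -> bilin gH v w = 0 /\ bilin gH w v = 0.
Hypothesis HE : H = [set v | forall s, v *m eta s = 0].
Hypothesis VE : V = [set v | forall w, H w -> bilin g v w = 0].
Hypothesis xiP : forall s, V (xi s) /\
  forall t, bilin g (xi s) (xi t) = (s == t)%:R /\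
            xi s *m eta t = (s == t)%:R%:M.
Hypothesis IP : forall s,
  (forall v, V v -> v *m I s = 0) /\ (forall v, H v -> H (v *m I s)).
Hypothesis IH : forall v, H v ->
  [/\ forall s, v *m ecomp (I s) (I s) = - v,
      v *m ecomp (I 0) (I 1) = v *m I 2%:R,
      v *m ecomp (I 1) (I 0) = - (v *m I 2%:R),
      v *m ecomp (I 0) (ecomp (I 1) (I 2%:R)) = - v &
      forall s w, H w -> bilin g (v *m I s) (w *m I s) = bilin g v w].

(** The projection to [H] along [V]. *)
Let hor v : 'rV[R]_d := v - \sum_t (v *m eta t) 0 0 *: xi t.

Let horE v : v = hor v + \sum_t (v *m eta t) 0 0 *: xi t.
Proof. by rewrite /hor subrK. Qed.

Let H_hor v : H (hor v).
Proof.
rewrite HE => s; rewrite /hor mulmxBl mulmx_suml (sum_ord3 _ s).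
have E t : xi t *m eta s = (t == s)%:R%:M by have [_ /(_ s)[]] := xiP t.
rewrite -!scalemxAl !E eqxx !ord3_eq raddf0 !scaler0 !addr0.
by rewrite -mul_scalar_mx mulmx1 -mx11_scalar subrr.
Qed.

Let Vxi s : V (xi s). Proof. by have [] := xiP s. Qed.

Let mx_ext m (B C : 'M[R]_(d, m)) : (forall v : 'rV_d, v *m B = v *m C) -> B = C.
Proof. by move=> BC; apply/row_matrixP => p; rewrite !rowE. Qed.

Let gH_hor v w : bilin gH v w = bilin g (hor v) (hor w).
Proof.
have zr x (y : 'rV[R]_d) : bilin gH x (\sum_t (y *m eta t) 0 0 *: xi t) = 0.
  rewrite bilin_sumr big1 // => t _.
  by rewrite bilinZr (proj2 (gHV _ (Vxi t))) mulr0.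
have zl x (y : 'rV[R]_d) : bilin gH (\sum_t (y *m eta t) 0 0 *: xi t) x = 0.
  rewrite bilin_suml big1 // => t _.
  by rewrite bilinZl (proj1 (gHV _ (Vxi t))) mulr0.
by rewrite -gHH // [in LHS](horE v) [in LHS](horE w) (bilinDl _ (hor v)) !(bilinDr _ (hor w)) !zr !zl !addr0.
Qed.

Let I_hor s v : v *m I s = hor v *m I s.
Proof.
rewrite {1}[v]horE mulmxDl mulmx_suml big1 ?addr0 // => t _.
by rewrite -scalemxAl (proj1 (IP s)) ?scaler0.
Qed.

Let I_eta s t : I s *m eta t = 0.
Proof.
apply: mx_ext => v; rewrite mulmx0 mulmxA I_hor.
by have := (proj2 (IP s)) _ (H_hor v); rewrite HE; apply.
Qed.

Let xi_I s t : xi s *m I t = 0. Proof. exact: (proj1 (IP t)). Qed.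

Let gHsym : gH^T = gH.
Proof.
by apply: bilin_inj => v w; rewrite bilin_tr !gH_hor -bilin_tr sg.
Qed.

Let xi_gH s : xi s *m gH = 0.
Proof.
by apply/rowP => q; have := proj1 (gHV 'e_q (Vxi s));
  rewrite /bilin trmx_delta -colE !mxE.
Qed.

Lemma metric_split : g = gH + \sum_s sqcov (eta s).
Proof.
apply: bilin_inj => v w; rewrite bilinD gH_hor bilin_sum.
have H0 x t : H x -> bilin g x (xi t) = 0 /\ bilin g (xi t) x = 0.
  move=> Hx; have := Vxi t; rewrite VE => /(_ _ Hx) E.
  by rewrite -bilin_tr sg.
have zr x (y : 'rV[R]_d) : H x -> bilin g x (\sum_t (y *m eta t) 0 0 *: xi t) = 0.
  move=> Hx; rewrite bilin_sumr big1 // => t _.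
  by rewrite bilinZr (proj1 (H0 _ _ Hx)) mulr0.
have zl x (y : 'rV[R]_d) : H x -> bilin g (\sum_t (y *m eta t) 0 0 *: xi t) x = 0.
  move=> Hx; rewrite bilin_suml big1 // => t _.
  by rewrite bilinZl (proj2 (H0 _ _ Hx)) mulr0.
rewrite [in LHS](horE v) [in LHS](horE w) (bilinDl _ (hor v)) !(bilinDr _ (hor w)).
rewrite (zr (hor v) w (H_hor v)) (zl (hor w) v (H_hor w)) addr0 add0r.
congr (_ + _).
rewrite bilin_suml; apply: eq_bigr => s _; rewrite bilin_sumr bilin_sqcov.
rewrite (sum_ord3 _ s) !bilinZl !bilinZr.
have E t : bilin g (xi s) (xi t) = (s == t)%:R by have [_ /(_ t)[]] := xiP s.
by rewrite !E eqxx !ord3_eq !mulr0 !addr0 mulr1.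
Qed.

Variables (u f : R).
Hypotheses (u0 : 0 < u) (f0 : 0 < f).

Definition coneG : 'M[R]_(1 + d) :=
  u *: lift2 gH + f *: \sum_(s < 3) sqcov (lift1 (eta s))
  + (4 * f)^-1 *: sqcov (du R d).

Definition coneF s : 'M[R]_(1 + d) :=
  u *: lift2 (kahler_form gH (I s))
  + f *: wedge11 (lift1 (eta (s + 1))) (lift1 (eta (s + 2%:R)))
  - 2^-1 *: wedge11 (lift1 (eta s)) (du R d).

Lemma coneG_sym : coneG^T = coneG.
Proof.
apply: bilin_inj => v w; rewrite bilin_tr /coneG !bilinD !bilinZ !bilin_sum.
rewrite !bilin_lift2 !bilin_sqcov; congr (_ * _ + _ * _ + _ * _).
- by rewrite -bilin_tr gHsym.
- by apply: eq_bigr => s _; rewrite !bilin_sqcov mulrC.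
- by rewrite mulrC.
Qed.

Lemma coneG_pos v : v != 0 -> 0 < bilin coneG v v.
Proof.
move=> v0; rewrite /coneG !bilinD !bilinZ bilin_sum bilin_lift2 bilin_sqcov.
under eq_bigr do rewrite bilin_sqcov mul_lift1 -expr2.
rewrite mul_du -expr2; set w := rsubmx v.
have ge1 : 0 <= u * bilin gH w w.
  rewrite mulr_ge0 ?(ltW u0) // gH_hor.
  by have [->|/pg/ltW//] := eqVneq (hor w) 0; rewrite bilin0l.
have ge2 : 0 <= f * \sum_(s < 3) (w *m eta s) 0 0 ^+ 2.
  by rewrite mulr_ge0 ?(ltW f0) ?sumr_ge0 // => s _; exact: sqr_ge0.
have k0 : 0 < (4 * f)^-1 by rewrite invr_gt0 mulr_gt0.
have ge3 : 0 <= (4 * f)^-1 * lsubmx v 0 0 ^+ 2.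
  by rewrite mulr_ge0 ?sqr_ge0 ?ltW.
have [h0|h0] := eqVneq (lsubmx v 0 0) 0; last first.
  by rewrite ltr_wpDl ?addr_ge0 // mulr_gt0 // lt_def sqr_ge0 sqrf_eq0 h0.
have w0 : w != 0.
  apply: contra v0 => /eqP w0; rewrite -[v]hsubmxK -/w w0.
  by rewrite [lsubmx v]mx11_scalar h0 raddf0 row_mx0.
rewrite ltr_wpDr //.
have [e0|/existsNP[s /eqP es]] := pselect (forall s, w *m eta s = 0).
  have Hw : H w by rewrite HE.
  by rewrite ltr_wpDr // mulr_gt0 // gHH // pg.
rewrite ltr_wpDl // mulr_gt0 // (bigD1 s) //= ltr_pwDl //.
  rewrite lt_def sqr_ge0 sqrf_eq0 andbT; apply: contra es => /eqP e.
  by rewrite [w *m _]mx11_scalar e raddf0.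
by rewrite sumr_ge0 // => t _; exact: sqr_ge0.
Qed.

(** The orthonormal coframe [du / (2 sqrt f), sqrt f eta_s] splits off a
    four-dimensional quaternionic space on which the almost complex structures
    are the multiplications by the quaternion units. *)
Lemma cone_quaternionic : exists J : 'I_3 -> 'M[R]_(1 + d),
  [/\ quaternion_identities J,
      forall s v w, bilin coneG (v *m J s) (w *m J s) = bilin coneG v w &
      forall s, kahler_form coneG (J s) = coneF s].
Proof.
pose r := Num.sqrt f.
have r0 : r != 0 by rewrite gt_eqF // sqrtr_gt0.
have rr : r * r = f by rewrite -expr2 sqr_sqrtr // ltW.
pose k := (2 * r)^-1.
pose x0 := k *: du R d; pose y s := r *: lift1 (eta s).
pose e0 : 'rV[R]_(1 + d) := (2 * r) *: dual_du.
pose z s : 'rV[R]_(1 + d) := r^-1 *: liftv (xi s).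
pose L s : 'M[R]_(1 + d) := lift2 (I s).
have k2 : (2 * r) * k = 1 by rewrite /k divff // mulf_neq0.
have k3 : r^-1 * r = 1 by rewrite mulVf.
have ETh : rows e0 z *m cols x0 y = 1%:M.
  apply: rows_cols => [|s|s|s t]; rewrite -scalemxAl -scalemxAr scalerA.
  - by rewrite k2 dual_du_du scale1r.
  - by rewrite dual_du_lift1 scaler0.
  - by rewrite liftv_du scaler0.
  - by rewrite k3 liftv_lift1 scale1r; have [_ /(_ t)[]] := xiP s.
have EL s : rows e0 z *m L s = 0.
  apply: rows_mul => [|t]; rewrite -scalemxAl ?dual_du_lift2 ?liftv_lift2 ?scaler0 //.
  by rewrite xi_I /liftv row_mx0 scaler0.
have LTh s : L s *m cols x0 y = 0.
  apply: mul_cols => [|t]; rewrite -scalemxAr ?lift2_du ?lift2_lift1 ?scaler0 //.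
  by rewrite I_eta /lift1 col_mx0 scaler0.
have L2 s : L s *m L s = cols x0 y *m rows e0 z - 1%:M.
  rewrite cols_rows lift2_mul.
  have -> : I s *m I s = \sum_t eta t *m xi t - 1%:M.
    apply: mx_ext => v; rewrite mulmxA [v *m I s]I_hor -mulmxA.
    have [sq _ _ _ _] := IH (H_hor v); rewrite -/(ecomp _ _) sq /hor opprB.
    rewrite mulmxBr mulmx1 mulmx_sumr; congr (_ - _); apply: eq_bigr => t _.
    by rewrite mulmxA [v *m eta t]mx11_scalar mul_scalar_mx mxE eqxx mulr1n.
  rewrite lift2D lift2N lift2_sum -du_dual_du opprD addrA; congr (_ - _).
  rewrite -scalemxAl -scalemxAr scalerA [k * _]mulrC k2 scale1r.
  rewrite addrAC subrr add0r.
  apply: eq_bigr => t _.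
  by rewrite -scalemxAl -scalemxAr scalerA mulrC k3 scale1r lift1_liftv.
have L10 : L 1 *m L 0 = L 2%:R.
  rewrite lift2_mul; congr lift2; apply: mx_ext => v.
  have [_ q _ _ _] := IH (H_hor v).
  by rewrite mulmxA [v *m I 1]I_hor -mulmxA -/(ecomp _ _) q -I_hor.
have L01 : L 0 *m L 1 = - L 2%:R.
  rewrite lift2_mul -lift2N; congr lift2; apply: mx_ext => v.
  have [_ _ q _ _] := IH (H_hor v).
  by rewrite mulmxA [v *m I 0]I_hor -mulmxA -/(ecomp _ _) q -I_hor mulmxN.
have Eg : rows e0 z *m lift2 gH = 0.
  apply: rows_mul => [|t]; rewrite -scalemxAl ?dual_du_lift2 ?liftv_lift2 ?scaler0 //.
  by rewrite xi_gH /liftv row_mx0 scaler0.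
have gE : lift2 gH *m (rows e0 z)^T = 0.
  by apply: trmx_inj; rewrite trmx_mul trmxK lift2_tr gHsym Eg trmx0.
have hL s : L s *m lift2 gH *m (L s)^T = lift2 gH.
  rewrite lift2_tr !lift2_mul; congr lift2; apply: bilin_inj => v w.
  rewrite -bilinMr -bilinMl [v *m _]I_hor [w *m _]I_hor.
  have [_ _ _ _ h] := IH (H_hor v).
  rewrite gHH; [|exact: (proj2 (IP s))|exact: (proj2 (IP s))].
  by rewrite h // gH_hor.
have kk : k ^+ 2 = (4 * f)^-1.
  by rewrite -rr /k; field.
have GE : coneG = sumG (lift2 gH) (cols x0 y) u.
  rewrite /coneG /sumG cols_sq addrA; congr (_ + _ + _).
    rewrite scaler_sumr; apply: eq_bigr => s _.
    by rewrite /y sqcovZ rr.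
  by rewrite /x0 sqcovZ -expr2 kk.
exists (sumJ L (cols x0 y) (rows e0 z)); split.
- exact: sumJ_identities.
- by move=> s v w; rewrite GE sumJ_hermitian.
- move=> s; rewrite GE sumJ_kahler // cols_quat4 lift2_mul addrA /coneF.
  rewrite /y /x0 !wedge11Z rr; congr (_ + _ - _ *: _).
  by rewrite /k; field.
Qed.

End Adapted.

(** * Rotations of frames, smoothness and exterior derivatives of lifts *)
Section Rotation.
Context {R : realType}.

Lemma det_mx3 (r : 'M[R]_3) (s : 'I_3) :
  \det r = \sum_t r s t * (r (s + 1) (t + 1) * r (s + 2%:R) (t + 2%:R)
                           - r (s + 1) (t + 2%:R) * r (s + 2%:R) (t + 1)).
Proof.
pose h i j := r (inord i) (inord j).
have rE i j : r i j = h i j by rewrite /h !inord_val.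
rewrite [RHS](sum_ord3 _ 0) !ord3E.
rewrite (expand_det_row _ ord0) !big_ord_recl !big_ord0 /cofactor.
rewrite !(expand_det_row _ ord0) !big_ord_recl !big_ord0 /cofactor !det_mx11.
rewrite !mxE !rE.
have e1 : (1 %% 3)%N = 1%N by [].
have e2 : ((1 + 1) %% 3)%N = 2%N by [].
by elim/ord3_ind: s; rewrite !ord3E /= /bump /= ?e1 ?e2 !(addn0, add0n, add1n);
  ring.
Qed.

(** The rows of a rotation matrix form an oriented orthonormal basis, so each
    of them is the cross product of the next two. *)
Lemma rotation_cofactor (r : 'M[R]_3) s t : r *m r^T = 1%:M -> \det r = 1 ->
  r s t = r (s + 1) (t + 1) * r (s + 2%:R) (t + 2%:R)
          - r (s + 1) (t + 2%:R) * r (s + 2%:R) (t + 1).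
Proof.
move=> rr detr.
pose c : 'rV[R]_3 := \row_t (r (s + 1) (t + 1) * r (s + 2%:R) (t + 2%:R)
          - r (s + 1) (t + 2%:R) * r (s + 2%:R) (t + 1)).
have cr : c *m r^T = 'e_s.
  apply/rowP => q; rewrite !mxE.
  have -> : \sum_j c 0 j * r^T j q = \sum_j r q j * c 0 j.
    by apply: eq_bigr => j _; rewrite [r^T j q]mxE mulrC.
  case: (ord3_cases s q) => ->.
  - rewrite !eqxx -detr (det_mx3 r s); apply: eq_bigr => j _.
    by rewrite mxE.
  - by rewrite ord3_eq andbF -[RHS]/(0 : R) (sum_ord3 _ 0) !ord3E !mxE !ord3E; ring.
  - by rewrite ord3_eq andbF -[RHS]/(0 : R) (sum_ord3 _ 0) !ord3E !mxE !ord3E; ring.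
have : c = row s r.
  by rewrite rowE -cr -mulmxA (mulmx1C rr) mulmx1.
by move/rowP => /(_ t); rewrite !mxE => <-.
Qed.

End Rotation.

Fact cross_product_rotation (R : realType) (u f k0 k1 k2 a0 a1 a2 b0 b1 b2 : R)
    (r0 r1 r2 p0 p1 p2 q0 q1 q2 x y : R) :
  r0 = p1 * q2 - p2 * q1 -> r1 = p2 * q0 - p0 * q2 -> r2 = p0 * q1 - p1 * q0 ->
  u * (r0 * k0 + r1 * k1 + r2 * k2)
  + f * ((p0 * a0 + p1 * a1 + p2 * a2) * (q0 * b0 + q1 * b1 + q2 * b2)
         - (q0 * a0 + q1 * a1 + q2 * a2) * (p0 * b0 + p1 * b1 + p2 * b2))
  - 2^-1 * ((r0 * a0 + r1 * a1 + r2 * a2) * y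
            - x * (r0 * b0 + r1 * b1 + r2 * b2))
  = r0 * (u * k0 + f * (a1 * b2 - a2 * b1) - 2^-1 * (a0 * y - x * b0))
  + r1 * (u * k1 + f * (a2 * b0 - a0 * b2) - 2^-1 * (a1 * y - x * b1))
  + r2 * (u * k2 + f * (a0 * b1 - a1 * b0) - 2^-1 * (a2 * y - x * b2)).
Proof. by move=> -> -> ->; ring. Qed.

Section ConeFrames.
Context {R : realType} {d : nat} (gH : 'M[R]_d) (u f : R).

Lemma bilin_coneF (eta : 'I_3 -> 'cV[R]_d) (I : 'I_3 -> 'M[R]_d) s v w :
  bilin (coneF gH eta I u f s) v w =
  u * bilin (kahler_form gH (I s)) (rsubmx v) (rsubmx w)
  + f * ((rsubmx v *m eta (s + 1)) 0 0 * (rsubmx w *m eta (s + 2%:R)) 0 0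
         - (rsubmx v *m eta (s + 2%:R)) 0 0 * (rsubmx w *m eta (s + 1)) 0 0)
  - 2^-1 * ((rsubmx v *m eta s) 0 0 * height w
            - height v * (rsubmx w *m eta s) 0 0).
Proof.
rewrite /coneF bilinD bilinN bilinD !bilinZ !bilin_wedge11 bilin_lift2.
by rewrite !mul_lift1 !mul_du.
Qed.

(** The terms [eta_j /\ eta_k] are transformed by the cofactors of [r], which
    are the entries of [r] itself. *)
Lemma coneF_rotation (eta eta' : 'I_3 -> 'cV[R]_d) (I I' : 'I_3 -> 'M[R]_d)
    (r : 'M[R]_3) s :
  r *m r^T = 1%:M -> \det r = 1 ->
  (forall s, eta' s = \sum_t r s t *: eta t) ->
  (forall s, I' s = \sum_t r s t *: I t) ->
  coneF gH eta' I' u f s = \sum_t r s t *: coneF gH eta I u f t.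
Proof.
move=> rr detr eta'E I'E; apply: bilin_inj => v w.
have E (x : 'rV[R]_d) q : (x *m eta' q) 0 0 = \sum_t r q t * (x *m eta t) 0 0.
  rewrite eta'E mulmx_sumr summxE; apply: eq_bigr => t _.
  by rewrite -scalemxAr [LHS]mxE.
have EI x y : bilin (kahler_form gH (I' s)) x y
    = \sum_t r s t * bilin (kahler_form gH (I t)) x y.
  rewrite /kahler_form I'E mulmx_suml bilin_sum.
  by apply: eq_bigr => t _; rewrite -scalemxAl bilinZ.
rewrite bilin_sum; under [RHS]eq_bigr do rewrite bilinZ bilin_coneF.
rewrite bilin_coneF EI !E.
have c0 := rotation_cofactor s 0 rr detr.
have c1 := rotation_cofactor s 1 rr detr.
have c2 := rotation_cofactor s 2%:R rr detr.
move: c0 c1 c2; rewrite !(sum_ord3 _ 0) !ord3E => c0 c1 c2.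
exact: cross_product_rotation.
Qed.

End ConeFrames.

Section SmoothLift.
Context {R : realType} {d : nat}.
Implicit Types (U : set 'rV[R]_(1 + d)).

Definition base_incl : 'M[R]_(1 + d, d) := col_mx 0 1%:M.

Lemma lift1E al : lift1 al = base_incl *m al.
Proof. by rewrite /base_incl mul_col_mx mul0mx mul1mx. Qed.

Lemma lift2E B : lift2 B = base_incl *m B *m base_incl^T.
Proof.
rewrite /base_incl mul_col_mx mul0mx mul1mx tr_col_mx trmx0 trmx1 mul_col_row.
by rewrite !mul0mx !mulmx0 mulmx1.
Qed.

Lemma smooth_lift1 U (f : 'rV[R]_(1 + d) -> 'cV[R]_d) : open U -> smooth U f ->
  smooth U (fun y => lift1 (f y)).
Proof.
move=> oU sf; apply: (@eq_smooth _ _ _ _ (fun y => base_incl *m f y)) => //.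
  by move=> y _; rewrite lift1E.
by apply: smooth_mulmx => //; exact: smooth_cst.
Qed.

Lemma smooth_lift2 U (f : 'rV[R]_(1 + d) -> 'M[R]_d) : open U -> smooth U f ->
  smooth U (fun y => lift2 (f y)).
Proof.
move=> oU sf; apply: (@eq_smooth _ _ _ _ (fun y => base_incl *m f y *m base_incl^T)) => //.
  by move=> y _; rewrite lift2E.
apply: smooth_mulmx => //; last exact: smooth_cst.
by apply: smooth_mulmx => //; exact: smooth_cst.
Qed.

Lemma smooth_wedge11 m U (f h : 'rV[R]_(1 + d) -> 'cV[R]_m) :
  open U -> smooth U f -> smooth U h ->
  smooth U (fun y => wedge11 (f y) (h y)).
Proof.
move=> oU sf sh.
have E (f1 h1 : 'rV[R]_(1 + d) -> 'cV[R]_m) : smooth U f1 -> smooth U h1 ->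
    smooth U (fun y => f1 y *m (h1 y)^T).
  by move=> s1 s2; apply: smooth_mulmx => //; exact: smooth_trmx.
apply: (@eq_smooth _ _ _ _
  (fun y => f y *m (h y)^T + (-1) *: (h y *m (f y)^T))) => //.
  by move=> y _; rewrite scaleN1r.
apply: smoothD => //; first exact: E.
by apply: smoothZ => //; [exact: smooth_cst|exact: E].
Qed.

Section Dilation.
Variables (O : set 'rV[R]_d) (U : set 'rV[R]_(1 + d)) (eta : 'rV[R]_d -> 'cV[R]_d).
Hypotheses (oO : open O) (oU : open U) (UO : forall y, U y -> O (rsubmx y)).
Hypothesis seta : smooth O eta.

(** The one-form [u eta] on the cylinder; for the contact forms these are the
    potentials of the connection whose curvature is the Kaehler forms. *)
Definition dilation (y : 'rV[R]_(1 + d)) : 'cV[R]_(1 + d) :=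
  height y *: lift1 (eta (rsubmx y)).

Lemma smooth_dilation : smooth U dilation.
Proof.
apply: smoothZ => //; first exact: smooth_height.
by apply: smooth_lift1 => //; exact: smooth_rsubmx UO seta.
Qed.

Lemma dext_dilation y : U y ->
  dext dilation y = wedge11 (du R d) (lift1 (eta (rsubmx y)))
                    + height y *: lift2 (dext eta (rsubmx y)).
Proof.
move=> Uy; apply: bilin_inj => v w.
rewrite (bilin_dext smooth_dilation) //.
have Oy := UO Uy.
have D v' w' : 'D_v' (pairing dilation w') y =
    height v' * (w' *m lift1 (eta (rsubmx y))) 0 0
    + height y * 'D_(rsubmx v') (pairing eta (rsubmx w')) (rsubmx y).
  pose p (x : 'rV[R]_d) := pairing eta (rsubmx w') x.
  have dp : differentiable p (rsubmx y).
    exact: smooth_differentiable (smooth_pairing oO seta (rsubmx w')) Oy.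
  have dr : differentiable (rsubmx : 'rV[R]_(1 + d) -> 'rV[R]_d) y.
    exact: differentiable_rsubmx.
  have Dp : is_derive y v' (p \o rsubmx) ('D_(rsubmx v') p (rsubmx y)).
    apply: DeriveDef; first exact/diff_derivable/differentiable_comp.
    rewrite !deriveE //; last exact: differentiable_comp.
    have cr := @continuous_rsubmx R 1 1 d.
    by rewrite (diff_comp dr dp) /= (diff_lin y cr).
  have Dh : is_derive y v' height (height v').
    rewrite (_ : height = (fun z : 'rV[R]_(1 + d) => z 0 (lshift d 0))).
      by have /is_derive_mxP := is_derive_id y v'.
    by apply/funext => z; rewrite /height mxE.
  have -> : pairing dilation w' = height * (p \o rsubmx).
    apply/funext => z; rewrite /pairing /dilation -scalemxAr mxE mul_lift1.
    by [].
  have [_ ->] := is_deriveM Dh Dp.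
  by rewrite addrC /= /p /pairing -mul_lift1 mulrC.
rewrite !D bilinD bilinZ bilin_lift2 bilin_wedge11 (bilin_dext seta) // !mul_du.
rewrite -!/(height _); ring.
Qed.

End Dilation.

End SmoothLift.

(** * The quaternionic Kaehler structure on the cylinder *)
Section Cone.
Context {R : realType} {M : topologicalType} {d : nat} (A : atlas R M d)
  (S : spn_data A) (tau a : R).
Hypotheses (mfd : smooth_manifold A) (S_spn : spn_structure S).

Definition profile (u : R) : R := tau * u + a * u ^+ 2.
Definition cone_range : set R := [set u | 0 < u /\ 0 < profile u].
Notation Om := cone_range.
Notation N := (cylinder A Om).

(** In any frame [eta_1^2 + eta_2^2 + eta_3^2 = g - g_H], so this global
    expression does not refer to a frame. *)
Definition cone_metric : field N 'M[R]_(1 + d) := fun i y =>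
  height y *: lift2 (sp_gH S i (rsubmx y))
  + profile (height y) *: lift2 (sp_g S i (rsubmx y) - sp_gH S i (rsubmx y))
  + (4 * profile (height y))^-1 *: sqcov (du R d).

Definition cone_form (f : local_frame A) s : field N 'M[R]_(1 + d) := fun i y =>
  coneF (sp_gH S i (rsubmx y)) (fun t => fr_eta f t i (rsubmx y))
        (fun t => fr_I f t i (rsubmx y)) (height y) (profile (height y)) s.

Definition cone_J (f : local_frame A) s : field N 'M[R]_(1 + d) := fun i y =>
  cone_form f s i y *m invmx (cone_metric i y).

(** The union over all frames defined at the point; each of them yields the
    same space, by [cone_basis]. *)
Definition cone_Q : field N (set 'M[R]_(1 + d)) := fun i y =>
  [set E | exists (f : local_frame A) (c : 'I_3 -> R),
     [/\ sp_frames S f, fr_dom f (param (i : chart A) (rsubmx y)) &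
         E = \sum_s c s *: cone_J f s i y]].

Lemma open_cone_range : open Om.
Proof.
have cprof : continuous profile.
  move=> u; apply: cvgD.
    by apply: cvgM; [exact: cvg_cst|exact: cvg_id].
  by apply: cvgM; [exact: cvg_cst|exact: exprn_continuous].
apply: openI; first exact: open_gt.
apply: (@open_comp _ _ profile [set x | 0 < x]) => [u _|]; first exact: cprof.
exact: open_gt.
Qed.

Lemma cone_manifold : smooth_manifold N.
Proof. exact: smooth_cylinder mfd open_cone_range. Qed.

Section AtPoint.
Variables (i : chart A) (p : M) (u : R).
Hypotheses (ip : dom i p) (uO : Om u).
Let y : 'rV[R]_(1 + d) := row_mx u%:M (coord i p).

Lemma cone_metric_pt :
  cone_metric i y = u *: lift2 (at_pt (sp_gH S) i p)
  + profile u *: lift2 (at_pt (sp_g S) i p - at_pt (sp_gH S) i p)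
  + (4 * profile u)^-1 *: sqcov (du R d).
Proof. by rewrite /cone_metric heightE row_mxKr. Qed.

Lemma cone_form_pt f s :
  cone_form f s i y = coneF (at_pt (sp_gH S) i p)
    (fun t => at_pt (fr_eta f t) i p) (fun t => at_pt (fr_I f t) i p)
    u (profile u) s.
Proof. by rewrite /cone_form heightE row_mxKr. Qed.

Variables (f : local_frame A) (Sf : sp_frames S f) (fp : fr_dom f p).

Lemma frame_adapted : adapted_frame S f.
Proof. by case: S_spn => _ _ _ _ /(_ f)[/(_ Sf)[]]. Qed.

Lemma cone_metricE : cone_metric i y =
  coneG (at_pt (sp_gH S) i p) (fun t => at_pt (fr_eta f t) i p) u (profile u).
Proof.
have [_ _ _ /(_ i p fp ip) /= [HE [xi xiP] IP IH QE]] := frame_adapted.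
have [[_ riem] bil gHc _ _] := S_spn.
have [gHH gHV] := gHc i p ip; have [sg pg] := riem i p ip.
rewrite cone_metric_pt /coneG; congr (_ + _ *: _ + _).
have E : at_pt (sp_g S) i p = at_pt (sp_gH S) i p
    + \sum_s sqcov (at_pt (fr_eta f s) i p).
  exact: (metric_split sg gHH gHV HE erefl xiP).
rewrite E addrAC subrr add0r lift2_sum.
by apply: eq_bigr => s _; rewrite sqcov_lift1.
Qed.

Lemma cone_pos :
  (cone_metric i y)^T = cone_metric i y /\
  (forall v, v != 0 -> 0 < bilin (cone_metric i y) v v).
Proof.
have [_ _ _ /(_ i p fp ip) /= [HE [xi xiP] IP IH QE]] := frame_adapted.
have [[_ riem] bil gHc _ _] := S_spn.
have [gHH gHV] := gHc i p ip; have [sg pg] := riem i p ip.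
have [u0 f0] := uO.
rewrite cone_metricE; split.
  exact: (coneG_sym sg gHH gHV HE xiP).
exact: (coneG_pos pg gHH gHV HE xiP u0 f0).
Qed.

Lemma cone_unit : cone_metric i y \in unitmx.
Proof.
by have [_ pos] := cone_pos; exact: definite_unitmx.
Qed.

Lemma cone_kahler s : kahler_form (cone_metric i y) (cone_J f s i y)
  = cone_form f s i y.
Proof. by rewrite /kahler_form /cone_J mulmxKV // cone_unit. Qed.

(** [cone_J] is defined by raising an index of [cone_form], for the sake of its
    smoothness; the pointwise model of [cone_quaternionic] has the same
    Kaehler forms and the metric is invertible, so both agree. *)
Lemma cone_J_identities :
  quaternion_identities (fun s => cone_J f s i y) /\
  forall s v w, bilin (cone_metric i y) (v *m cone_J f s i y)
     (w *m cone_J f s i y) = bilin (cone_metric i y) v w.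
Proof.
have [_ _ _ /(_ i p fp ip) /= [HE [xi xiP] IP IH QE]] := frame_adapted.
have [[_ riem] bil gHc _ _] := S_spn.
have [gHH gHV] := gHc i p ip; have [sg pg] := riem i p ip.
have [u0 f0] := uO.
have [J [qJ hJ FJ]] := cone_quaternionic sg gHH gHV HE xiP IP IH u f0.
have JE s : cone_J f s i y = J s.
  rewrite /cone_J cone_form_pt -[RHS](mulmxK cone_unit); congr (_ *m _).
  by rewrite -FJ /kahler_form -cone_metricE.
rewrite (_ : (fun s => cone_J f s i y) = J); last by apply/funext.
by split=> // s v w; rewrite JE cone_metricE hJ.
Qed.

Lemma cone_form_rotation f' : sp_frames S f' -> fr_dom f' p ->
  exists2 r : 'M[R]_3, r *m r^T = 1%:M &
    forall s, cone_form f' s i y = \sum_t r s t *: cone_form f t i y.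
Proof.
move=> Sf' f'p; have [_ _ _ _ fr] := S_spn.
have [_ rel] := (fr f').1 Sf'.
have [r [rr detr rE]] := rel f Sf p fp f'p.
exists r => // s; rewrite cone_form_pt.
under eq_bigr do rewrite cone_form_pt.
by apply: coneF_rotation => // t; have [] := rE i t ip.
Qed.

Lemma cone_basis : quaternionic_basis (cone_metric i y) (cone_Q i y)
  (fun s => cone_J f s i y).
Proof.
have [qJ hJ] := cone_J_identities; split=> //.
have pE : param i (rsubmx y) = p.
  have [_ _ /(_ i)[_ _ pK _ _] _] := mfd.
  by rewrite row_mxKr pK.
apply/seteqP; split=> [E [f' [c [Sf' fp' ->]]]|E [c ->]]; last first.
  by exists f, c; rewrite pE.
rewrite pE in fp'; have [r _ rE] := cone_form_rotation Sf' fp'.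
exists (fun t => \sum_s c s * r s t).
under [RHS]eq_bigr do rewrite scaler_suml.
rewrite exchange_big /=; apply: eq_bigr => s _.
rewrite /cone_J rE mulmx_suml scaler_sumr; apply: eq_bigr => t _.
by rewrite -scalemxAl scalerA.
Qed.

End AtPoint.

End Cone.

Arguments cone_metric {R M d A} S tau a.
Arguments cone_form {R M d A} S tau a f s.
Arguments cone_J {R M d A} S tau a f s.
Arguments cone_Q {R M d A} S tau a.

Section BlockJacobian.
Context {R : realType} {d : nat} (K : 'M[R]_d).
Let Kc : 'M[R]_(1 + d) := block_mx 1%:M 0 0 K.

Lemma block_lift1 al : Kc *m lift1 al = lift1 (K *m al).
Proof. by rewrite /lift1 mul_block_col !(mul0mx, mulmx0, addr0, add0r). Qed.

Lemma block_du : Kc *m du R d = du R d.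
Proof. by rewrite /du mul_block_col !(mul0mx, mulmx0, addr0, add0r) mulmx1. Qed.

Lemma block_lift2 B : Kc *m lift2 B *m Kc^T = lift2 (K *m B *m K^T).
Proof.
rewrite /lift2 mulmx_block !(mul0mx, mulmx0, addr0, add0r) tr_block_mx !trmx0.
by rewrite mulmx_block !(mul0mx, mulmx0, addr0, add0r).
Qed.

Lemma conj_sqcov m (P : 'M[R]_m) al : P *m sqcov al *m P^T = sqcov (P *m al).
Proof. by rewrite /sqcov trmx_mul !mulmxA. Qed.

Lemma conj_wedge11 m (P : 'M[R]_m) al be :
  P *m wedge11 al be *m P^T = wedge11 (P *m al) (P *m be).
Proof. by rewrite /wedge11 !trmx_mul mulmxBr mulmxBl !mulmxA. Qed.

Lemma conjD m (P B C : 'M[R]_m) :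
  P *m (B + C) *m P^T = P *m B *m P^T + P *m C *m P^T.
Proof. by rewrite mulmxDr mulmxDl. Qed.

Lemma conjZ m (P B : 'M[R]_m) c : P *m (c *: B) *m P^T = c *: (P *m B *m P^T).
Proof. by rewrite -scalemxAr -scalemxAl. Qed.

End BlockJacobian.

Section ConeFields.
Context {R : realType} {M : topologicalType} {d : nat} (A : atlas R M d)
  (S : spn_data A) (tau a : R).
Hypotheses (mfd : smooth_manifold A) (S_spn : spn_structure S).
Notation Om := (cone_range tau a).
Notation N := (cylinder A Om).
Notation g := (cone_metric S tau a).
Notation Q := (cone_Q S tau a).

Lemma smooth_profile (U : set 'rV[R]_(1 + d)) : open U ->
  smooth U (fun y => profile tau a (height y)).
Proof.
move=> oU; have sh := smooth_height oU; rewrite /profile.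
have sh2 : smooth U (fun y : 'rV[R]_(1 + d) => height y ^+ 2).
  exact: (smoothM oU sh sh).
have sc (c : R) : smooth U (fun _ : 'rV[R]_(1 + d) => c) by exact: smooth_cst.
exact: (smoothD oU (smoothM oU (sc tau) sh) (smoothM oU (sc a) sh2)).
Qed.

Lemma smooth_horizontal i (U : set M) (W : normedModType R)
    (X : 'rV[R]_d -> W) : open U ->
  smooth (coord i @` (dom i `&` U)) X ->
  smooth (cyl_image (A := A) Om i U) (fun y => X (rsubmx y)).
Proof.
move=> oU; apply: smooth_rsubmx; last by move=> y [].
exact: (open_cyl_image mfd (@open_cone_range R tau a)).
Qed.

Lemma cone_riemannian : (forall p, carrier A p -> exists2 f, sp_frames S f & fr_dom f p) ->
  riemannian_metric (A := N) g.
Proof.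
move=> frames; have [[[sg gT] _] [sgH gHT] _ _ _] := S_spn.
split; last first.
  move=> i [p u] [/= ip uO].
  have [|f Sf fp] := frames p; first by exists i.
  exact: (@cone_pos R M d A S tau a S_spn i p u ip uO f Sf fp).
have oC := open_carrier mfd.
split.
  move=> i; pose U := cyl_image (A := A) Om i (carrier A).
  have oU : open U by exact: (open_cyl_image mfd (@open_cone_range R tau a)).
  apply: (@sub_smooth _ _ _ U).
    by apply: sub_cyl_image => -[p u] [/= ip _] _; exists i.
  have sh := smooth_height oU; have sp := smooth_profile oU.
  have shH := smooth_horizontal oC (sgH i).
  have shg := smooth_horizontal oC (sg i).
  rewrite /cone_metric; apply: smoothD => //; last first.
    apply: smoothZ => //; last exact: smooth_cst.
    apply: smoothV => //; last by apply: smoothM => //; exact: smooth_cst.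
    by move=> y [_ [_ f0]]; rewrite mulf_neq0 // gt_eqF.
  apply: smoothD => //; apply: smoothZ => //; apply: smooth_lift2 => //.
  apply: (@eq_smooth _ _ _ _ (fun y => sp_g S i (rsubmx y)
    + (-1) *: sp_gH S i (rsubmx y))) => //.
    by move=> y _; rewrite scaleN1r.
  by apply: smoothD => //; apply: smoothZ => //; exact: smooth_cst.
move=> i j [p u] _ [/= ip uO] [/= jp _].
have pC : carrier A p by exists i.
rewrite (jac_cylinder mfd (@open_cone_range R tau a) ip jp uO).
rewrite /at_pt !coord_cylinder !cone_metric_pt.
rewrite !conjD !conjZ !block_lift2 conj_sqcov block_du.
by rewrite mulmxBr mulmxBl -gT // -gHT.
Qed.

Section Frame.
Variables (f : local_frame A) (Sf : sp_frames S f).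
Notation U := [set q : M * R | fr_dom f q.1 /\ Om q.2].

Lemma open_frame_domain : open U.
Proof.
have [of_ _ _ _] := frame_adapted S_spn Sf.
apply: openI; first by apply: open_comp => // q _; exact: cvg_fst.
by apply: open_comp => [q _|]; [exact: cvg_snd|exact: open_cone_range].
Qed.

Lemma smooth_cone_form s : smooth_field (A := N) U (cone_form S tau a f s).
Proof.
have [oF eF IF _] := frame_adapted S_spn Sf.
have [_ [sgH _] _ _ _] := S_spn.
move=> i; pose U' := cyl_image (A := A) Om i (fr_dom f).
have oU : open U' by exact: (open_cyl_image mfd (@open_cone_range R tau a)).
apply: (@sub_smooth _ _ _ U').
  by apply: sub_cyl_image => -[p u] _ [].
have sh := smooth_height oU; have sp := smooth_profile oU.
have se t := smooth_horizontal oF (proj1 (eF t) i).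
have sI t := smooth_horizontal oF (proj1 (IF t) i).
have sH : smooth U' (fun y => sp_gH S i (rsubmx y)).
  apply: (smooth_horizontal oF); apply: sub_smooth (sgH i).
  by move=> _ [p [ip _] <-]; exists p => //; split=> //; exists i.
rewrite /cone_form /coneF.
apply: (@eq_smooth _ _ _ _ (fun y =>
  height y *: lift2 (kahler_form (sp_gH S i (rsubmx y)) (fr_I f s i (rsubmx y)))
  + profile tau a (height y) *: wedge11 (lift1 (fr_eta f (s + 1) i (rsubmx y)))
      (lift1 (fr_eta f (s + 2%:R) i (rsubmx y)))
  + (- 2^-1) *: wedge11 (lift1 (fr_eta f s i (rsubmx y))) (du R d))) => //.
  by move=> y _; rewrite scaleNr.
apply: smoothD => //; last first.
  apply: smoothZ => //; first exact: smooth_cst.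
  by apply: smooth_wedge11 => //; [exact: smooth_lift1|exact: smooth_cst].
apply: smoothD => //; apply: smoothZ => //.
  by apply: smooth_lift2 => //; exact: smooth_mulmx.
by apply: smooth_wedge11 => //; exact: smooth_lift1.
Qed.

Lemma cone_form_transform s (i j : chart A) p u :
  fr_dom f p -> dom i p -> dom j p -> Om u ->
  at_pt (A := N) (cone_form S tau a f s) i (p, u)
  = jac (A := N) i j (p, u) *m at_pt (A := N) (cone_form S tau a f s) j (p, u)
    *m (jac (A := N) i j (p, u))^T.
Proof.
move=> fp ip jp uO; have pC : carrier A p by exists i.
have [oF eF IF _] := frame_adapted S_spn Sf.
have [_ [_ gHT] _ _ _] := S_spn.
rewrite (jac_cylinder mfd (@open_cone_range R tau a) ip jp uO).
rewrite /at_pt !coord_cylinder !cone_form_pt /coneF.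
rewrite !conjD -!scaleNr !conjZ !block_lift2 !conj_wedge11 !block_lift1 block_du.
have eT t := proj2 (eF t) i j p fp ip jp.
have IT := proj2 (IF s) i j p fp ip jp.
rewrite -!eT; congr (_ *: lift2 _ + _ + _).
rewrite /kahler_form (gHT i j p pC ip jp) !mulmxA.
by rewrite /at_pt in IT *; rewrite IT.
Qed.

(** The transformation law of the [J] follows from those of the metric and of
    the forms: the Jacobian is invertible because the metric is. *)
Lemma cone_quaternionic_frame : quaternionic_frame (A := N) g Q U (cone_J S tau a f).
Proof.
have frames : forall p, carrier A p -> exists2 f, sp_frames S f & fr_dom f p.
  by case: S_spn.
have [[sg gT] gP] := cone_riemannian frames.
split; first exact: open_frame_domain.
  move=> s; split.
    move=> i; pose O := coord (i : chart N) @` (dom (i : chart N) `&` U).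
    have oO : open O.
      exact: (open_coord_image (cone_manifold tau a mfd)) open_frame_domain.
    have sg' : smooth O (g i).
      apply: sub_smooth (sg i) => _ [q [iq _] <-]; exists q => //.
      by split=> //; exists i.
    apply: smooth_mulmx => //; first exact: smooth_cone_form.
    apply: smooth_invmx => // _ [[p u] [[/= ip uO] [fp _]] <-].
    exact: (@cone_unit R M d A S tau a S_spn i p u ip uO f Sf fp).
  move=> i j [p u] [/= fp uO] [/= ip _] [/= jp _].
  have ui := cone_unit S_spn ip uO Sf fp.
  have uj := cone_unit S_spn jp uO Sf fp.
  have gE := gT i j (p, u) _ (conj ip uO) (conj jp uO).
  have FE := cone_form_transform s fp ip jp uO.
  rewrite /at_pt !coord_cylinder in gE FE *.
  set K := jac _ _ _ in gE FE *.
  have uK : K \in unitmx.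
    move: ui; rewrite gE; last by exists i.
    by rewrite !unitmx_mul => /andP[/andP[]].
  have uKT : K^T \in unitmx by rewrite unitmx_tr.
  rewrite -[LHS](mulmxK uj) -[RHS](mulmxK uj); congr (_ *m _).
  rewrite -[LHS](mulmxK uKT) -[RHS](mulmxK uKT); congr (_ *m _).
  rewrite -[in LHS]mulmxA -[in LHS]mulmxA (mulmxA K) -gE; last by exists i.
  have Ei := cone_kahler S_spn ip uO Sf fp s.
  have Ej := cone_kahler S_spn jp uO Sf fp s.
  rewrite /kahler_form in Ei Ej.
  by rewrite Ei FE -Ej !mulmxA.
by move=> i [p u] [/= fp uO] [/= ip _]; exact: cone_basis.
Qed.

Hypothesis feq : structure_equations S tau f.

Definition potential s : field N 'cV[R]_(1 + d) :=
  fun i => dilation (fr_eta f s i).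

Lemma smooth_potential s : smooth_field (A := N) U (potential s).
Proof.
have [oF eF IF _] := frame_adapted S_spn Sf.
move=> i; pose U' := cyl_image (A := A) Om i (fr_dom f).
have oU : open U' by exact: (open_cyl_image mfd (@open_cone_range R tau a)).
apply: (@sub_smooth _ _ _ U').
  by apply: sub_cyl_image => -[p u] _ [].
by apply: smooth_dilation (proj1 (eF s) i) => // y [].
Qed.

(** With [b = u eta], the structure equation turns [d b_s / 2] into
    [du /\ eta_s / 2 + u omega_s + tau u eta_j /\ eta_k], and the quadratic
    term supplies the remaining [a u^2 eta_j /\ eta_k]. *)
Lemma cone_curvature s (i : chart A) p u : fr_dom f p -> dom i p -> Om u ->
  at_pt (A := N) (cone_form S tau a f s) i (p, u)
  = 2^-1 *: dext (potential s i) (coord (i : chart N) (p, u))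
    + a *: wedge11 (at_pt (potential (s + 1)) i (p, u))
                   (at_pt (potential (s + 2%:R)) i (p, u)).
Proof.
move=> fp ip uO; have [oF eF IF _] := frame_adapted S_spn Sf.
pose U' := cyl_image (A := A) Om i (fr_dom f).
have oU : open U' by exact: (open_cyl_image mfd (@open_cone_range R tau a)).
have oO : open (coord i @` (dom i `&` fr_dom f)).
  exact: (open_coord_image mfd).
have UO (y : 'rV[R]_(1 + d)) : U' y -> (coord i @` (dom i `&` fr_dom f)) (rsubmx y).
  by case.
have Uy : U' (row_mx u%:M (coord i p)).
  by split; [rewrite row_mxKr; exists p|rewrite heightE].
rewrite /at_pt coord_cylinder cone_form_pt /potential.
rewrite (dext_dilation oO oU UO (proj1 (eF s) i) Uy) heightE row_mxKr.
rewrite feq // /dilation heightE row_mxKr wedge11Z.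
apply: bilin_inj => v w; rewrite bilin_coneF.
rewrite bilinD !bilinZ bilinD !bilinZ !bilin_wedge11 bilin_lift2 bilinD !bilinZ.
rewrite !bilin_wedge11 !mul_lift1 !mul_du /sp_omega.
rewrite -!/(height _) /profile /at_pt.
by field.
Qed.

End Frame.

End ConeFields.

Arguments potential {R M d A} tau a f s.

Lemma fundamental4E (R : realType) (d : nat) (G : 'M[R]_d) J v w x y :
  fundamental4 (fun s => kahler_form G (J s)) v w x y =
  four_square G J v w x y - four_square G J v x w y + four_square G J v y w x
  + four_square G J w x v y - four_square G J w y v x + four_square G J x y v w.
Proof. by rewrite /fundamental4 /wedge22 /four_square !(sum_ord3 _ 0); ring. Qed.

Lemma fundamental4_basis (R : realType) (d : nat) (G : 'M[R]_d) Q J J' :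
  (0 < d)%N -> quaternionic_basis G Q J -> quaternionic_basis G Q J' ->
  fundamental4 (fun s => kahler_form G (J' s))
  = fundamental4 (fun s => kahler_form G (J s)).
Proof.
move=> d0 bJ bJ'; apply/funext => v; apply/funext => w.
apply/funext => x; apply/funext => y; rewrite !fundamental4E.
by rewrite !(four_square_basis _ _ _ _ d0 bJ bJ').
Qed.

Section ConeTheorem.
Context {R : realType} {M : topologicalType} {d : nat} (A : atlas R M d)
  (S : spn_data A) (tau a : R).
Hypotheses (mfd : smooth_manifold A) (S_spn : spn_structure S).
Hypothesis S_eqs : forall p, exists f : local_frame A,
  [/\ sp_frames S f, fr_dom f p & structure_equations S tau f].
Notation Om := (cone_range tau a).
Notation N := (cylinder A Om).
Notation g := (cone_metric S tau a).
Notation Q := (cone_Q S tau a).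

Definition cone_Phi : field N (four_tensor R (1 + d)) := fun i y =>
  fundamental4 (fun s => kahler_form (g i y) (chosen_basis (g i y) (Q i y) s)).

Lemma cone_riem : riemannian_metric (A := N) g.
Proof. by apply: cone_riemannian => //; case: S_spn. Qed.

Lemma cone_quaternionic_kahler : quaternionic_kahler (A := N) g Q.
Proof.
split.
  split; first exact: cone_riem.
  move=> [p u] [i [/= ip uO]]; have [f [Sf fp feq]] := S_eqs p.
  exists [set q : M * R | fr_dom f q.1 /\ Om q.2], (cone_J S tau a f).
  by split=> //; exact: cone_quaternionic_frame.
move=> i0 p0 ip0.
apply: (@holonomy_SpSp1 R _ _ N g Q a) => //.
- exact: cone_manifold.
- exact: cone_riem.
move=> [p u] [i [/= ip uO]]; have [f [Sf fp feq]] := S_eqs p.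
exists [set q : M * R | fr_dom f q.1 /\ Om q.2], (cone_J S tau a f).
exists (potential tau a f); split=> //.
- exact: cone_quaternionic_frame.
- by move=> s; exact: (@smooth_potential R M d A S tau a mfd S_spn f Sf s).
move=> s j [q v] [/= fq vO] [/= jq _].
rewrite -(cone_curvature mfd S_spn Sf feq s fq jq vO).
exact: (@cone_kahler R M d A S tau a S_spn j q v jq vO f Sf fq s).
Qed.

Lemma cone_fundamental : fundamental_4form (A := N) g Q cone_Phi.
Proof.
move=> U J [_ _ bJ] i p Up ip; rewrite /cone_Phi /at_pt.
have b := bJ i p Up ip.
by apply: (fundamental4_basis _ b (chosen_basisP b)).
Qed.

Lemma cone_frame f : sp_frames S f -> structure_equations S tau f ->
  exists J : 'I_3 -> field N 'M[R]_(1 + d),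
    quaternionic_frame (A := N) g Q
      [set q : M * R | fr_dom f q.1 /\ Om q.2] J /\
    forall (i : chart A) (p : M) (u : R),
      fr_dom f p -> dom i p -> Om u ->
      [/\ at_pt (A := N) g i (p, u) = qk_metric S tau a f i p u,
          (forall s : 'I_3,
             kahler_form (at_pt (A := N) g i (p, u)) (at_pt (A := N) (J s) i (p, u))
             = qk_F S tau a f s i p u) &
          at_pt cone_Phi i (p, u)
          = fundamental4 (fun s => qk_F S tau a f s i p u)].
Proof.
move=> Sf feq; exists (cone_J S tau a f).
have qf := cone_quaternionic_frame tau a mfd S_spn Sf.
split=> // i p u fp ip uO.
have FE s : kahler_form (at_pt (A := N) g i (p, u))
    (at_pt (A := N) (cone_J S tau a f s) i (p, u)) = qk_F S tau a f s i p u.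
  rewrite /at_pt coord_cylinder (cone_kahler S_spn ip uO Sf fp) cone_form_pt.
  by rewrite /coneF /qk_F /profile [tau * u + _]addrC.
split=> //.
  by rewrite /at_pt coord_cylinder (cone_metricE tau a S_spn u ip Sf fp).
rewrite (cone_fundamental qf (p := (p, u))) //; congr fundamental4.
exact/funext.
Qed.

End ConeTheorem.

Arguments cone_Phi {R M d A} S tau a.

Theorem theorem5p1 (R : realType) (n : nat) (M : topologicalType)
    (A : atlas R M (4 * n + 3)) (S : spn_data A) (tau : R)
    (n_ge1 : (1 <= n)%N)
    (M_manifold : smooth_manifold A)
    (M_carrier : carrier A = [set: M])
    (S_spn : spn_structure S)
    (S_eqs : forall p : M, exists f : local_frame A,
       [/\ sp_frames S f, fr_dom f p & structure_equations S tau f])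
    (a : R) :
  let Om : set R := [set u | 0 < u /\ 0 < tau * u + a * u ^+ 2] in
  let N := cylinder A Om in
  smooth_manifold N /\
  exists (g : field N 'M[R]_(1 + (4 * n + 3)))
         (Q : field N (set 'M[R]_(1 + (4 * n + 3))))
         (Phi : field N (four_tensor R (1 + (4 * n + 3)))),
    [/\ quaternionic_kahler g Q,
        fundamental_4form g Q Phi &
        forall f : local_frame A,
          sp_frames S f -> structure_equations S tau f ->
          exists J : 'I_3 -> field N 'M[R]_(1 + (4 * n + 3)),
            quaternionic_frame g Q
              [set q : M * R | fr_dom f q.1 /\ Om q.2] J /\
            forall (i : chart A) (p : M) (u : R),
              fr_dom f p -> dom i p -> Om u ->
              [/\ at_pt g i (p, u) = qk_metric S tau a f i p u,
                  (forall s : 'I_3,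
                     kahler_form (at_pt g i (p, u)) (at_pt (J s) i (p, u))
                     = qk_F S tau a f s i p u) &
                  at_pt Phi i (p, u)
                  = fundamental4 (fun s => qk_F S tau a f s i p u)]].
Proof.
move=> Om N; split; first exact: (cone_manifold tau a M_manifold).
exists (cone_metric S tau a), (cone_Q S tau a), (cone_Phi S tau a); split.
- exact: cone_quaternionic_kahler.
- exact: cone_fundamental.
- by move=> f Sf feq; exact: cone_frame.
Qed.
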